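(* Let $G$ be a plane graph without cycles of lengths $4$ to $8$. Let $S$ be a set of vertices of $G$ such that either $|S|\le 1$, or $S$ consists of all vertices incident with a face of $G$. Let $C$ be a $3$-correspondence assignment for $G$ such that $C$ is consistent on every closed walk of length $3$ in $G$. If $|S|\le 12$, then for any $C$-coloring $f_0$ of $G[S]$, there exists a $C$-coloring $f$ of $G$ whose restriction to $S$ is equal to $f_0$.
   Context: All graphs are finite and simple; $[k]=\{1,\dots,k\}$. Fix an orientation $\vec G$ of $G$. A $k$-correspondence assignment for $G$ is a function $C$ assigning to every edge $e\in E(\vec G)$ an injective, not necessarily total, function $C_e:[k]\to[k]$. A $C$-coloring of $G$ (or of a subgraph, using the restriction of $C$ to its edges) is a function $f:V(G)\to[k]$ such that for every directed edge $e=uv$, either $f(u)\notin\mathrm{dom}(C_e)$ or $C_e(f(u))\ne f(v)$. For $uv\in E(\vec G)$ set $C_{vu}=C_{uv}^{-1}$. For injective partial functions $A,B$ on $[k]$, $A\circ B$ is the partial function with domain $\{c\in\mathrm{dom}(A):A(c)\in\mathrm{dom}(B)\}$ and $(A\circ B)(c)=B(A(c))$. For a walk $W=v_1\dots v_m$, $C_W=C_{v_1v_2}\circ\dots\circ C_{v_{m-1}v_m}$. A closed walk ($v_1=v_m$) $W$ has length $m-1$, and $C$ is consistent on $W$ if $C_W(c)=c$ for every $c\in\mathrm{dom}(C_W)$. *)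

(* Defs.v *)
From HB Require Import structures.
From mathcomp Require Import all_boot all_order all_fingroup.

Set Implicit Arguments.
Unset Strict Implicit.
Unset Printing Implicit Defensive.

Record sgraph := SGraph {
  svertex :> finType;
  adj : rel svertex;
  adj_sym : symmetric adj;
  adj_irrefl : irreflexive adj }.

Definition edge_set (G : sgraph) : {set {set G}} :=
  [set [set x; y] | x in G, y in G & adj x y].

Definition no_cycle_of_length (G : sgraph) (n : nat) : Prop :=
  forall p : seq G, size p = n -> ~ ucycle (@adj G) p.

(** * Plane graphs

  Plane graphs are represented by combinatorial maps on the sphere, as usual in
  formal developments, except that the graph need not be connected.  The drawing
  is given by the cyclic order of the neighbours around each vertex and by the
  set of faces.  In a disconnected graph the boundary of a face consists of
  several facial walks, and the rotations alone do not determine which facial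
  walks bound the same face; this is the role of [side]. *)

(** The neighbours of [v], or [v] itself if [v] is isolated.  A corner is a pair
  [(u, v)] with [u \in ends v]: if [u] is a neighbour of [v], it is the angle at
  [v] between the edge [vu] and the next edge in the rotation at [v]; if [v] is
  isolated, [(v, v)] is the full angle around [v]. *)
Definition ends (G : sgraph) (v : G) : {set G} :=
  if [exists w, adj v w] then [set w | adj v w] else [set v].

(** The facial walks are the orbits of [face_step] on corners.  The orbit of
  [(v, v)] with [v] isolated is the trivial facial walk at [v]. *)
Definition face_step (G : sgraph) (rot : G -> {perm G}) (d : G * G) : G * G :=
  (d.2, rot d.2 d.1).

Definition incident_vertices (G : sgraph) (F : finType) (side : G * G -> F)
    (a : F) : {set G} :=
  [set v : G | [exists u in ends v, side (u, v) == a]].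

Definition vertex_face_rel (G : sgraph) (F : finType) (side : G * G -> F) :
    rel (G + F) :=
  fun x y => match x, y with
  | inl u, inl v => adj u v
  | inl v, inr a | inr a, inl v => v \in incident_vertices side a
  | inr _, inr _ => false
  end.

(** Gluing, for each face, a sphere with one hole per facial walk of that face to
  these walks gives a closed orientable surface.  [plane_connected] says that
  this surface is connected.  Given this, Euler's formula
  |V| - |E| + |F| = 1 + (number of components) says that it is the sphere.
  Indeed, if g is the sum of the genera of the components of the graph, c the
  number of components and W the number of facial walks, then
  |V| - |E| + W = 2c - 2g, and |F| <= W - c + 1 because the bipartite multigraph
  of components and faces, with W edges, is connected.  So the formula holds
  exactly when g = 0 and this bipartite multigraph is a tree.  The graph without
  vertices has one face, incident with no vertex. *)
Record plane_embedding (G : sgraph) := PlaneEmbedding {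
  rotation : G -> {perm G};
  rotation_cyclic : forall v u : G,
    u \in ends v -> porbit (rotation v) u = ends v;
  face : finType;
  side : G * G -> face;
  side_walk : forall u v : G,
    u \in ends v -> side (face_step rotation (u, v)) = side (u, v);
  plane_connected : forall x y : G + face, connect (vertex_face_rel side) x y;
  plane_euler :
    #|G| + #|face| = #|edge_set G| + n_comp (@adj G) G + 1 }.

Definition face_vertices (G : sgraph) (M : plane_embedding G) (a : face M) :
  {set G} := incident_vertices (@side G M) a.

(** * Correspondence coloring *)

(** Partial functions from [k] to [k]; the colors are 0, ..., k - 1. *)
Definition pfun (k : nat) := 'I_k -> option 'I_k.

Definition pfun_injective (k : nat) (A : pfun k) : Prop :=
  forall c c' d, A c = Some d -> A c' = Some d -> c = c'.

Definition pfun_inv (k : nat) (A : pfun k) : pfun k :=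
  fun d => [pick c | A c == Some d].

(** Diagrammatic order: [A] is applied first. *)
Definition pfun_comp (k : nat) (A B : pfun k) : pfun k :=
  fun c => obind B (A c).

Record orientation (G : sgraph) := Orientation {
  arc :> rel G;
  arc_adj : forall u v : G, adj u v = arc u v || arc v u;
  arc_asym : forall u v : G, ~~ (arc u v && arc v u) }.

(** The values of [corr] at pairs that are not arcs are irrelevant. *)
Record correspondence (k : nat) (G : sgraph) (o : orientation G) :=
  Correspondence {
    corr :> G -> G -> pfun k;
    corr_inj : forall u v : G, o u v -> pfun_injective (corr u v) }.

Section Correspondence.
Variables (k : nat) (G : sgraph) (o : orientation G) (C : correspondence k o).

(** A coloring of the subgraph of [G] induced by [S]; only the values of [f] on
  [S] matter. *)
Definition coloring_on (S : {set G}) (f : G -> 'I_k) : Prop :=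
  forall u v : G, u \in S -> v \in S -> o u v -> C u v (f u) <> Some (f v).

Definition coloring (f : G -> 'I_k) : Prop := coloring_on [set: G] f.

(** C_uv for an edge uv traversed in either direction. *)
Definition edge_corr (u v : G) : pfun k :=
  if o u v then C u v else pfun_inv (C v u).

(** C_W for the walk W that starts at [v] and continues along [p]. *)
Fixpoint walk_corr (v : G) (p : seq G) : pfun k :=
  if p is w :: p' then pfun_comp (edge_corr v w) (walk_corr w p')
  else fun c => Some c.

Definition consistent_on (v : G) (p : seq G) : Prop :=
  forall c d, walk_corr v p c = Some d -> d = c.

End Correspondence.

Definition closed_walk (G : sgraph) (v : G) (p : seq G) : Prop :=
  path (@adj G) v p /\ last v p = v.

(* Main.v *)
From mathcomp Require Import all_boot all_order all_fingroup all_algebra.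
From mathcomp Require Import zify.
Require Import Defs.

(** A plane graph is encoded by two permutations of its darts: the involution [e]
  reversing a dart and the rotation [n] around its origin; the faces are the cycles
  of [f = e * n].  For a pair of permutations, multiplying one factor by a
  transposition that splits one of its cycles never increases the genus.  Hence
  deletions preserve planarity, and a split of both a factor and the product must
  disconnect; this yields both the cut vertex argument and the Jordan curve theorem.

  In a counterexample with fewest edges, every face is a cycle, vertices outside S
  have degree at least 3, and no cycle of length at most 12 has vertices on both
  sides: otherwise color the side of S first and extend to the other side with the
  cycle precolored.  A tetrad is a path v1 v2 v3 v4 of vertices of degree 3 outside S
  on a face of length at least 9, with v1 v2 in a triangular face v1 v2 x and v3 v4
  in a triangular face v3 v4 y.  If v0 precedes v1 on the face, deleting v1, ..., v4
  and identifying v0 with y, after permuting the colors of y, gives a smaller graph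
  all of whose colorings extend; it has no new short cycle because a short path from
  y to v0 would close to a cycle of length at most 12 separating x from v4.

  Finally, vertices get charge 2 deg - 6 and faces |f| - 6, so that the total is
  -12 per component.  Triangles take 1 from each of their vertices, and a vertex of
  degree 3 takes 1/2 from its other two faces.  Without tetrads this leaves a total
  larger than -12. *)

Set Implicit Arguments.
Unset Strict Implicit.
Unset Printing Implicit Defensive.
Import Order.TTheory GRing.Theory Num.Theory.

(** * Permutation pairs of genus zero *)

Section Classes.
Variable T : finType.
Implicit Types (r : rel T) (x y u v : T).

(** Twice the genus of a pair of permutations is [|T| + 2 c] minus the numbers of cycles of both and
    of their product, with c the number of joint classes. So every separation statement becomes a
    count that would otherwise make the genus negative.

    Identifying v0 and y is the reason for correspondences instead of lists: lists of two vertices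
    may differ, while a correspondence allows the colors of one of them to be renamed. Consistency
    on triangles survives, since the identification creates no new triangle.

    The bound 12 comes from the balance. In half units the total is at most -24; a face S of length
    l has 2l - 12 and each of its vertices keeps at least -3, together at least -l - 12. This is -24
    for l = 12, so one extra unit has to be found near S. The same 12 gives two vertices of S an arc
    of at most 6 edges, short enough to exclude that the identification spoils the precoloring.

    A face of a disconnected graph may have several boundary walks. By Euler's formula it has at
    most one in each component, so the components are colored separately and each sees a face
    bounded by a single walk or at most one vertex of S. *)

Definition ncl r := #|[set [set y | connect r x y] | x in T]|.

Lemma eq_ncl r r' : connect r =2 connect r' -> ncl r = ncl r'.
Proof.
move=> E; rewrite /ncl; congr #|pred_of_set _|.
by apply: eq_imset => x; apply/setP=> y; rewrite !inE E.
Qed.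

(** Up to reachability [r'] is [r] with one more edge xy, so the classes of x and y fuse and the
    others stay. The last hypothesis lets a step of [r'] use that edge in either direction. *)
Lemma ncl_add r r' x y : connect_sym r -> connect_sym r' ->
  (forall u v, r u v -> connect r' u v) -> connect r' x y ->
  (forall u v, r' u v -> [|| connect r u v, connect r u x && connect r y v
                          | connect r u y && connect r x v]) ->
  ncl r' + ~~ connect r x y = ncl r.
Proof.
move=> sr sr' rr' xy' r'r.
have rr'c u v : connect r u v -> connect r' u v.
  by move: u v; apply: connect_sub.
have E u v : connect r' u v = [|| connect r u v, connect r u x && connect r y v
                          | connect r u y && connect r x v].
  apply/idP/idP; last first.
    case/or3P=> [/rr'c //|/andP[/rr'c ux /rr'c yv]|/andP[/rr'c uy /rr'c xv]].
      exact: connect_trans ux (connect_trans xy' yv).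
    by apply: connect_trans uy (connect_trans _ xv); rewrite sr'.
  case/connectP=> p + ->; elim/last_ind: p => [|p w IH] /=.
    by rewrite connect0.
  rewrite rcons_path last_rcons => /andP[/IH {}IH /r'r].
  set z := last u p in IH *.
  case/or3P: IH => [uz|/andP[ux yz]|/andP[uy xz]] /or3P[zw|/andP[zx yw]|/andP[zy xw]];
  rewrite ?(connect_trans uz zw) ?(connect_trans uz zx) ?(connect_trans uz zy)
    ?(connect_trans yz zw) ?(connect_trans xz zw) ?ux ?uy ?yw ?xw ?orbT //=;
  by rewrite ?(connect_trans ux xw) ?(connect_trans uy yw) ?orbT.
have [xy|nxy] := boolP (connect r x y); rewrite ?addn0 ?addn1.
  apply: eq_ncl => u v; rewrite E; apply/idP/idP; last by move->.
  case/or3P=> // /andP[ux yv]; first exact: connect_trans ux (connect_trans xy yv).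
  by apply: connect_trans ux (connect_trans _ yv); rewrite sr.
pose cl u := [set v | connect r u v]; pose cl' u := [set v | connect r' u v].
pose P := [set cl u | u in T]; pose P' := [set cl' u | u in T].
have clE u v : connect r u v -> cl u = cl v.
  by move=> uv; apply/setP=> w; rewrite !inE (same_connect sr uv).
have cl0 u : u \in cl u by rewrite inE connect0.
have nxyE : cl x != cl y.
  apply: contra nxy => /eqP e; by rewrite -[connect r x y](in_set (connect r x)) -/(cl x) e.
have xP : cl x \in P by apply: imset_f.
have yP : cl y \in P by apply: imset_f.
have cl'E u : cl' u = if (u \in cl x) || (u \in cl y) then cl x :|: cl y else cl u.
  apply/setP=> v; rewrite !inE E.
  case: (boolP (connect r x u)) => [xu|nxu] /=.
    rewrite !inE (sr u x) xu (sr u y) -(same_connect sr xu).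
    have -> : connect r y u = false.
      apply/negbTE; apply: contra nxy => yu; apply: connect_trans xu _; by rewrite sr.
    by rewrite orbF.
  case: (boolP (connect r y u)) => [yu|nyu] /=.
    rewrite !inE (sr u x) (negbTE nxu) (sr u y) yu -(same_connect sr yu) /=.
    by rewrite orbC.
  by rewrite inE (sr u x) (negbTE nxu) (sr u y) (negbTE nyu) !orbF.
have P'E : P' = (cl x :|: cl y) |: (P :\ cl x :\ cl y).
  apply/setP=> A; rewrite !inE; apply/imsetP/idP.
    case=> u _ ->; rewrite cl'E; case: ifP => [_|/negbT]; first by rewrite eqxx.
    rewrite negb_or => /andP[ux uy].
    rewrite imset_f // andbT; apply/orP; right; apply/andP; split.
      by apply: contra uy => /eqP <-.
    by apply: contra ux => /eqP <-.
  case/orP=> [/eqP->|].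
    by exists x => //; rewrite cl'E cl0.
  case/and3P=> Ay Ax /imsetP[u _ Au]; exists u => //; rewrite cl'E.
  case: ifP => //; rewrite !inE => /orP[] /clE e; last by rewrite Au e eqxx in Ay.
  by rewrite Au e eqxx in Ax.
have nin : (cl x :|: cl y) \notin (P :\ cl x :\ cl y).
  rewrite !inE; apply/negP=> /and3P[_ _ /imsetP[u _ e]].
  have xu : x \in cl u by rewrite -e inE cl0.
  have yu : y \in cl u by rewrite -e !inE connect0 orbT.
  rewrite !inE in xu yu; case/negP: nxy; apply: connect_trans yu; by rewrite sr.
rewrite /ncl -/P -/P' P'E cardsU1 nin /=.
rewrite (cardsD1 (cl x) P) xP (cardsD1 (cl y) (P :\ cl x)) !inE yP eq_sym nxyE /=.
lia.
Qed.

End Classes.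

Section Genus.
Variable T : finType.
Implicit Types (a b : {perm T}) (x y u v : T) (X : {set T}).
Local Open Scope group_scope.

Definition link2 a b : rel T :=
  fun x y => [|| y == a x, x == a y, y == b x | x == b y].

Lemma link2_sym a b : connect_sym (link2 a b).
Proof.
apply: sym_connect_sym => x y; rewrite /link2.
by apply/or4P/or4P; case; [constructor 2|constructor 1|constructor 4|constructor 3
 |constructor 2|constructor 1|constructor 4|constructor 3].
Qed.

Lemma link2_l a b x : connect (link2 a b) x (a x).
Proof. by apply: connect1; rewrite /link2 eqxx. Qed.

Lemma link2_r a b x : connect (link2 a b) x (b x).
Proof. by apply: connect1; rewrite /link2 eqxx !orbT. Qed.

Lemma link2_sub a b (r : rel T) : connect_sym r ->
  (forall x, connect r x (a x)) -> (forall x, connect r x (b x)) ->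
  forall x y, connect (link2 a b) x y -> connect r x y.
Proof.
move=> sr Ha Hb; apply: connect_sub => x y.
by case/or4P=> /eqP->; rewrite // sr.
Qed.

Lemma link2C a b : connect (link2 a b) =2 connect (link2 b a).
Proof.
move=> x y; apply/idP/idP; apply: link2_sub; do ?exact: link2_sym;
  move=> z; by [apply: link2_l|apply: link2_r].
Qed.

Lemma link2V a b : connect (link2 a^-1 b^-1) =2 connect (link2 a b).
Proof.
have V (c d : {perm T}) : forall x y, connect (link2 c^-1 d^-1) x y -> connect (link2 c d) x y.
  apply: link2_sub; first exact: link2_sym.
    by move=> z; rewrite link2_sym -{2}(permKV c z); apply: link2_l.
  by move=> z; rewrite link2_sym -{2}(permKV d z); apply: link2_r.
move=> x y; apply/idP/idP; first exact: V.
by rewrite -{1}(invgK a) -{1}(invgK b); apply: V.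
Qed.

Lemma link2_mul a b : connect (link2 a (a * b)) =2 connect (link2 a b).
Proof.
move=> x y; apply/idP/idP; apply: link2_sub; do ?exact: link2_sym;
  move=> z; rewrite ?link2_l //.
  by rewrite permM; apply: connect_trans (link2_l _ _ _) (link2_r _ _ _).
have := link2_r a (a * b) (a^-1 z); rewrite permM permKV => h.
by apply: connect_trans h; rewrite link2_sym -{2}(permKV a z); apply: link2_l.
Qed.

Lemma porbit_connect (r : rel T) a x y : (forall z, connect r z (a z)) ->
  y \in porbit a x -> connect r x y.
Proof.
move=> H /porbitP[i ->]; elim: i => [|i IH]; first by rewrite expg0 perm1.
by rewrite expgSr permM; apply: connect_trans IH (H _).
Qed.

Lemma porbit_step a x z : (a z \in porbit a x) = (z \in porbit a x).
Proof.
rewrite !(porbit_sym _ _ x).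
by have := porbit_perm a 1 z; rewrite expg1 => ->.
Qed.

Lemma porbit_stepV a x z : (a^-1 z \in porbit a x) = (z \in porbit a x).
Proof. by rewrite -porbit_step permKV. Qed.

Lemma porbit_ind a x (P : T -> Prop) : P x -> (forall z, P z -> P (a z)) ->
  forall y, y \in porbit a x -> P y.
Proof.
move=> Px H y /porbitP[i ->]; elim: i => [|i IH]; first by rewrite expg0 perm1.
by rewrite expgSr permM; apply: H.
Qed.

Lemma porbit_tperm_mem a x y z : z \in porbit a x ->
  (z \in porbit (a * tperm x y) x) || (z \in porbit (a * tperm x y) y).
Proof.
set b := a * tperm x y; move: z.
apply: (porbit_ind (P := fun z => (z \in porbit b x) || (z \in porbit b y))).
  by rewrite porbit_id.
move=> u H; have : (b u \in porbit b x) || (b u \in porbit b y).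
  by rewrite !porbit_step.
by rewrite permM; case: tpermP => [->|->|_ _ //] _; rewrite porbit_id ?orbT.
Qed.

Lemma porbit_tperm_merge a x y : x \notin porbit a y ->
  x \in porbit (tperm x y * a) y.
Proof.
move=> nxy; apply: contraT => nxy'.
have /= := porbits_mul_tperm a x y; have /= := porbits_mul_tperm (tperm x y * a) x y.
rewrite mulgA tperm2 mul1g nxy nxy' /=; case: (x =P y) => [e|_] /=; last lia.
by rewrite e porbit_id in nxy.
Qed.

Lemma link2_porbit_mul a b x y : y \in porbit (a * b) x -> connect (link2 a b) x y.
Proof.
apply: porbit_connect => z; rewrite permM.
exact: connect_trans (link2_l _ _ _) (link2_r _ _ _).
Qed.

(** The transposition splits the cycle through x and y. Only the steps between the two halves are
    lost, and a single edge xy restores them. *)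
Lemma ncl_tperm a b x y : x \in porbit a y ->
  ncl (link2 a b) + ~~ connect (link2 (tperm x y * a) b) x y
  = ncl (link2 (tperm x y * a) b).
Proof.
move=> xy; apply: ncl_add; do ?exact: link2_sym.
- have cxy : connect (link2 a b) x y.
    by rewrite link2_sym; apply: porbit_connect xy => z; apply: link2_l.
  move=> u v uv; move: (connect1 uv); apply: link2_sub; first exact: link2_sym.
    move=> z; rewrite permM; case: tpermP => [->|->|_ _]; last exact: link2_l.
      by apply: connect_trans cxy (link2_l _ _ _).
    by apply: connect_trans (link2_l _ _ _); rewrite link2_sym.
  by move=> z; apply: link2_r.
- by rewrite link2_sym; apply: porbit_connect xy => z; apply: link2_l.
set c := tperm x y * a.
have st z : [|| connect (link2 c b) z (a z),
     connect (link2 c b) z x && connect (link2 c b) y (a z)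
   | connect (link2 c b) z y && connect (link2 c b) x (a z)].
  have : connect (link2 c b) (tperm x y z) (a z).
    by have := link2_l c b (tperm x y z); rewrite permM tpermK.
  by case: tpermP => [->|->|_ _] ->; rewrite ?connect0 ?orbT.
move=> u v /or4P[/eqP->|/eqP->|/eqP->|/eqP->].
- exact: st.
- case/or3P: (st v) => [h|/andP[h h']|/andP[h h']]; rewrite link2_sym.
  + by rewrite h.
  + by rewrite (link2_sym _ _ (a v) y) h' link2_sym (link2_sym _ _ x) h !orbT.
  + by rewrite (link2_sym _ _ (a v) x) h' (link2_sym _ _ y v) h !orbT.
- by rewrite link2_r.
- by rewrite link2_sym link2_r.
Qed.

(* The genera of all components add up to zero; a common fixed point of [a] and [b]
   is a component that contributes nothing. *)
Definition planar a b :=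
  #|porbits a| + #|porbits b| + #|porbits (a * b)| = #|T| + (ncl (link2 a b)).*2.

Lemma porbits_split a x y : x != y -> x \in porbit a y ->
  #|porbits (tperm x y * a)| = #|porbits a|.+1.
Proof.
move=> nxy xy; have /= := porbits_mul_tperm a x y.
by rewrite nxy xy /= addn0 addn1.
Qed.

Lemma porbits_merge a x y : x \notin porbit a y ->
  #|porbits (tperm x y * a)|.+1 = #|porbits a|.
Proof.
move=> xy; have /= := porbits_mul_tperm a x y.
have -> : x != y by apply: contra xy => /eqP->; rewrite porbit_id.
by rewrite xy /=; lia.
Qed.

(** The factor gains a cycle. If the product also splits, there are two more cycles and at most one
    more class. If the product merges two cycles, x and y stay connected through the merged cycle
    and the counts balance. Either way the genus does not grow. *)
Lemma genus_split a b x y : x != y -> x \in porbit a y ->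
  #|porbits a| + #|porbits b| + #|porbits (a * b)| + (ncl (link2 (tperm x y * a) b)).*2
  <= #|porbits (tperm x y * a)| + #|porbits b| + #|porbits (tperm x y * a * b)|
     + (ncl (link2 a b)).*2.
Proof.
move=> nxy xy; rewrite porbits_split // -(ncl_tperm b xy) -mulgA.
have [xy'|nxy'] := boolP (x \in porbit (a * b) y).
  rewrite (porbits_split nxy xy'); case: connect => /=; lia.
rewrite -(porbits_merge nxy') mulgA link2_sym link2_porbit_mul /=; first by lia.
by rewrite -mulgA; apply: porbit_tperm_merge.
Qed.

(** Split [a] down to the identity, where the classes are the cycles of [b] and the genus is 0. No
    split increases the genus, so it was nonnegative before. *)
Lemma genus_ge a b :
  #|porbits a| + #|porbits b| + #|porbits (a * b)| <= #|T| + (ncl (link2 a b)).*2.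
Proof.
have [k] := ubnP (#|T| - #|porbits a|); elim: k a => // k IH a lek.
have [e|/existsP[x ax]] : (a = 1) \/ [exists x, a x != x].
- case: (boolP [exists x, a x != x]) => [|/existsPn h]; [by right|left].
  by apply/permP=> x; rewrite perm1; have /negPn/eqP := h x.
- subst a; rewrite mul1g.
  have cl : forall x y, connect (link2 1 b) x y = (y \in porbit b x).
    move=> x y; apply/idP/idP; last by apply: porbit_connect => z; apply: link2_r.
    case/connectP=> p + ->; elim/last_ind: p => [|p w IHp] /=; first by rewrite porbit_id.
    rewrite rcons_path last_rcons => /andP[/IHp h].
    case/or4P=> /eqP e; move: h; rewrite ?perm1 in e.
    + by rewrite e.
    + by rewrite e.
    + by rewrite e porbit_step.
    + by rewrite e porbit_step.
  have -> : ncl (link2 1 b) = #|porbits b|.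
    rewrite /ncl /porbits; congr #|pred_of_set _|; apply: eq_imset => x.
    by apply/setP=> y; rewrite inE cl.
  have : #|porbits (1 : {perm T})| <= #|T| by apply: leq_imset_card.
  lia.
have xy : x \in porbit a (a x) by rewrite porbit_sym porbit_step porbit_id.
have nxy : x != a x by rewrite eq_sym.
have := genus_split b nxy xy; have := porbits_split nxy xy.
have le : #|porbits (tperm x (a x) * a)| <= #|T| by apply: leq_imset_card.
have := IH (tperm x (a x) * a).
lia.
Qed.

Lemma planar_split_l a b x y : x \in porbit a y -> planar a b ->
  planar (tperm x y * a) b.
Proof.
have [->|nxy] := eqVneq x y; first by rewrite tperm1 mul1g.
move=> xy; rewrite /planar => pl; have := genus_split b nxy xy.
have := genus_ge (tperm x y * a) b; lia.
Qed.

(** At genus 0, two more cycles must be matched by one more class, and only x and y can have come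
    apart. *)
Lemma planar_cut_l a b x y : planar a b -> x != y -> x \in porbit a y ->
  x \in porbit (a * b) y -> ~~ connect (link2 (tperm x y * a) b) x y.
Proof.
rewrite /planar => pl nxy xy xy'; have := ncl_tperm b xy.
have := genus_ge (tperm x y * a) b.
rewrite -mulgA (porbits_split nxy xy) (porbits_split nxy xy').
case: connect => /=; rewrite ?addn0 ?addn1 => B A //; exfalso.
rewrite -A in B; move: B pl; set p := #|porbits a|; set q := #|porbits b|.
by set r := #|porbits _|; set nn := ncl _; move: p q r nn #|T| => *; lia.
Qed.

(** The factor loses a cycle and the product gains one; x and y are connected through the product
    beforehand, so the classes stay. Geometrically, two vertices on a common face are identified. *)
Lemma planar_merge_l a b x y : planar a b -> x \notin porbit a y ->
  x \in porbit (a * b) y -> planar (tperm x y * a) b.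
Proof.
rewrite /planar => pl nxy xy'.
have nxyE : x != y by apply: contra nxy => /eqP->; rewrite porbit_id.
have := ncl_tperm b (porbit_tperm_merge nxy).
rewrite mulgA tperm2 mul1g (link2_sym _ _ x) (link2_porbit_mul xy') /= addn0 => ->.
have := porbits_merge nxy; rewrite -mulgA (porbits_split nxyE xy'); move: pl.
set p := #|porbits a|; set q := #|porbits b|; set r := #|porbits (a * b)|.
set nn := ncl _; set m := #|porbits _|; move: p q r nn m #|T| => *; lia.
Qed.

(** Inverting reverses the product, which turns statements about the left factor into statements
    about the right one. *)
Lemma planarV a b : planar a b -> planar b^-1 a^-1.
Proof.
rewrite /planar -invMg !porbitsV => pl.
by rewrite (eq_ncl (link2V b a)) (eq_ncl (link2C b a)) -pl (addnC #|porbits b|).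
Qed.

(** Duality: for the edge involution [a], passing from [b] to [a * b] exchanges vertices and
    faces. *)
Lemma planar_mul a b : a * a = 1 -> planar a b -> planar a (a * b).
Proof.
move=> aa; rewrite /planar mulgA aa mul1g (eq_ncl (link2_mul a b)) => <-.
by rewrite addnAC.
Qed.

Lemma tperm_mulV a x y : (a * tperm x y) = (tperm x y * a^-1)^-1.
Proof. by rewrite invMg invgK tpermV. Qed.

Lemma planar_split_r a b x y : x \in porbit b y -> planar a b ->
  planar a (b * tperm x y).
Proof.
move=> xy /planarV pl; rewrite tperm_mulV -[a]invgK; apply: planarV.
by apply: planar_split_l pl; rewrite porbitV.
Qed.

Lemma planar_cut_r a b x y : planar a b -> x != y -> x \in porbit b y ->
  x \in porbit (a * b) y -> ~~ connect (link2 a (b * tperm x y)) x y.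
Proof.
move=> /planarV pl nxy xy xy'.
rewrite tperm_mulV -[a]invgK link2V link2C; apply: planar_cut_l => //.
  by rewrite porbitV.
by rewrite -invMg porbitV.
Qed.

Lemma planar_merge_r a b x y : planar a b -> x \notin porbit b y ->
  x \in porbit (a * b) y -> planar a (b * tperm x y).
Proof.
move=> /planarV pl xy xy'; rewrite tperm_mulV -[a]invgK; apply: planarV.
apply: planar_merge_l => //; first by rewrite porbitV.
by rewrite -invMg porbitV.
Qed.

(* Multiplying by the transposition cuts [x] out of its cycle and makes it a fixed point. *)
Fixpoint dels a (l : seq T) : {perm T} :=
  if l is x :: l' then tperm x ((dels a l')^-1 x) * dels a l' else a.

(** [X] is the set of points that survive. *)
Definition del a (X : {set T}) := dels a (enum (~: X)).

Lemma dels_planar a b l l' : planar a b -> planar (dels a l) (dels b l').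
Proof.
move=> pl; elim: l => [|x l IH] /=; last first.
  by apply: planar_split_l IH; rewrite porbit_sym porbit_stepV porbit_id.
elim: l' => [|x l' IH] //=.
set c := dels b l' in IH *.
have -> : tperm x (c^-1 x) * c = c * tperm (c x) x.
  by apply/permP=> z; rewrite !permM inj_tperm ?permKV //; apply: perm_inj.
by apply: planar_split_r IH; rewrite porbit_step porbit_id.
Qed.

Lemma dels_in a l x : x \in l -> dels a l x = x.
Proof.
elim: l => //= z l IH; rewrite inE permM => /orP[/eqP->|xl].
  by rewrite tpermL permKV.
case: tpermP => [->|e|_ _]; rewrite ?permKV ?IH //.
have := IH xl; rewrite {1}e permKV => zx.
by rewrite zx IH.
Qed.

(** [dels a l] sends a surviving x to the first surviving point after x on its cycle; a property
    handed on by every skipped point reaches that image. *)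
Lemma dels_skip a l (P : T -> Prop) x :
  (forall y, y \in l -> P y -> P (a y)) -> x \notin l -> P (a x) -> P (dels a l x).
Proof.
elim: l x => //= z l IH x H; rewrite inE negb_or => /andP[xz xl] Px.
have H' y : y \in l -> P y -> P (a y) by move=> yl; apply: H; rewrite inE yl orbT.
rewrite permM; case: tpermP => [e|e|_ _]; last exact: IH.
  by rewrite e eqxx in xz.
have Pz : P z by rewrite -(permKV (dels a l) z) -e; apply: IH.
have [zl|zl] := boolP (z \in l); first by rewrite dels_in.
by apply: IH => //; apply: H Pz; rewrite inE eqxx.
Qed.

Lemma dels_porbit a l x y : x \notin l -> y \notin l -> y \in porbit a x ->
  y \in porbit (dels a l) x.
Proof.
elim: l => //= z l IH; rewrite !inE !negb_or => /andP[xz xl] /andP[yz yl] xy.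
have {IH} := IH xl yl xy; set c := dels a l => {}xy.
set c' := _ * c.
(* The old cycle may pass through the removed z; the second alternative records that the walk stands
   at z and came from a point of the new cycle. *)
have : y \in porbit c' x \/ (y = z /\ c^-1 z \in porbit c' x).
  move: y xy {yz yl}.
  apply: (porbit_ind (P := fun y => y \in porbit c' x \/ (y = z /\ c^-1 z \in porbit c' x))).
    by left; rewrite porbit_id.
  move=> w [wx|[-> h]]; last first.
    by left; move: h; rewrite -(porbit_step c') permM tpermR.
  case: (eqVneq w (c^-1 z)) => [e|nwz].
    by right; rewrite e permKV -e.
  case: (eqVneq w z) => [e|nw].
    have c'z : c' z = z by rewrite permM tpermL permKV.
    case/negP: xz; apply/eqP; move: wx; rewrite e porbit_sym; move: (x).
    by apply: (porbit_ind (P := fun u => u = z)) => // u ->.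
  left; rewrite -porbit_step permM tpermD in wx => //; by rewrite eq_sym.
by case=> // -[e]; rewrite e eqxx in yz.
Qed.

Lemma del_planar a b X : planar a b -> planar (del a X) (del b X).
Proof. exact: dels_planar. Qed.

Lemma del_out a X x : x \notin X -> del a X x = x.
Proof. by move=> xX; apply: dels_in; rewrite mem_enum inE. Qed.

Lemma del_skip a X (P : T -> Prop) x : (forall y, y \notin X -> P y -> P (a y)) ->
  x \in X -> P (a x) -> P (del a X x).
Proof.
move=> H xX; apply: dels_skip; last by rewrite mem_enum inE xX.
by move=> y; rewrite mem_enum inE; apply: H.
Qed.

Lemma del_mem a X x : x \in X -> del a X x \in X.
Proof.
move=> xX; apply: contraT => nX; have := del_out a nX => /perm_inj e.
by rewrite e xX in nX.
Qed.

Lemma del_id a X x : x \in X -> a x \in X -> del a X x = a x.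
Proof.
move=> xX axX; apply: (del_skip (P := fun y => y = a x)) => // y nyX e.
by rewrite e axX in nyX.
Qed.

Lemma del_porbit a X x y : x \in X -> y \in X ->
  (y \in porbit (del a X) x) = (y \in porbit a x).
Proof.
move=> xX yX; apply/idP/idP; last by apply: dels_porbit; rewrite mem_enum inE ?xX ?yX.
move: y {yX}.
apply: (porbit_ind (P := fun y => y \in porbit a x)); first exact: porbit_id.
move=> y h; have [yX|yX] := boolP (y \in X); last by rewrite del_out.
apply: (del_skip (P := fun y => y \in porbit a x)) => //; last by rewrite porbit_step.
by move=> z _; rewrite porbit_step.
Qed.

End Genus.

(** * Plane maps *)

Section Maps.
Variables (D V : finType).
Implicit Types (e n : {perm D}) (org : D -> V) (R : D -> rel 'I_3).
Implicit Types (d x y : D) (u v : V) (S : {set V}) (X : {set D}).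

Definition alive e d := e d != d.

Definition adjm e org : rel V :=
  fun u v => [exists d, [&& alive e d, org d == u & org (e d) == v]].

Lemma adjmP e org u v :
  reflect (exists d, [/\ alive e d, org d = u & org (e d) = v]) (adjm e org u v).
Proof.
apply: (iffP existsP) => -[d]; first by case/and3P=> l /eqP a /eqP b; exists d.
by case=> l a b; exists d; rewrite l a b !eqxx.
Qed.

(* Deleted darts are kept as fixed points of [e] and [n], so that [D] and [V] never
   change.  [R d a b] means that colors [a] and [b] conflict at the ends of [d].
   Isolated vertices carry no dart. *)
Record plane_map e n org R : Prop := PlaneMap {
  g_inv : forall d, e (e d) = d;
  g_dead : forall d, ~~ alive e d -> n d = d;
  g_org : forall d, org (n d) = org d;
  g_node : forall d d', alive e d -> alive e d' -> org d = org d' -> d' \in porbit n d;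
  g_planar : planar e n;
  g_loop : forall d, alive e d -> org d != org (e d);
  g_simple : forall d d', alive e d -> alive e d' -> org d = org d' ->
    org (e d) = org (e d') -> d = d';
  g_cyc : forall p, ucycle (adjm e org) p -> 4 <= size p <= 8 -> False;
  g_Rsym : forall d a b, alive e d -> R (e d) b a = R d a b;
  g_Rinj : forall d a b b', alive e d -> R d a b -> R d a b' -> b = b';
  g_Rtri : forall d1 d2 d3 a b c a', alive e d1 -> alive e d2 -> alive e d3 ->
    org (e d1) = org d2 -> org (e d2) = org d3 -> org (e d3) = org d1 ->
    R d1 a b -> R d2 b c -> R d3 c a' -> a = a' }.

(** The face is a single cycle of [f], even if the map is disconnected; faces with several boundary
    walks are reduced to this case one component at a time. *)
Definition face_or_small e n org S :=
  #|S| <= 1 \/ exists2 s, alive e s & S = [set org d | d in porbit (e * n)%g s].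

Definition proper_on e org R S (f : V -> 'I_3) := forall d, alive e d ->
  org d \in S -> org (e d) \in S -> ~~ R d (f (org d)) (f (org (e d))).

Definition proper e org R (f : V -> 'I_3) := forall d, alive e d ->
  ~~ R d (f (org d)) (f (org (e d))).

Definition extendable e n org R := forall S f0, face_or_small e n org S -> #|S| <= 12 ->
  proper_on e org R S f0 -> exists2 f, proper e org R f & {in S, f =1 f0}.

Section Basic.
Variables (e n : {perm D}) (org : D -> V) (R : D -> rel 'I_3).
Hypothesis G : plane_map e n org R.
Local Notation f := (e * n)%g.

Lemma liveE d : alive e (e d) = alive e d.
Proof. by rewrite /alive (g_inv G) eq_sym. Qed.

Lemma live_n d : alive e (n d) = alive e d.
Proof.
apply/idP/idP => h; apply: contraT => nd.
  by rewrite (g_dead G nd) (negbTE nd) in h.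
by have := g_dead G nd => /perm_inj e1; rewrite e1 h in nd.
Qed.

Lemma live_f d : alive e (f d) = alive e d.
Proof. by rewrite permM live_n liveE. Qed.

Lemma fE d : f d = n (e d). Proof. by rewrite permM. Qed.

Lemma f_e d : f (e d) = n d. Proof. by rewrite permM (g_inv G). Qed.

Lemma org_f d : org (f d) = org (e d). Proof. by rewrite permM (g_org G). Qed.

Lemma e_fV d : e (f^-1%g d) = n^-1%g d.
Proof. by apply: (@perm_inj _ n); rewrite permKV -fE permKV. Qed.

Lemma live_fV d : alive e (f^-1%g d) = alive e d.
Proof. by rewrite -live_f permKV. Qed.

Lemma org_porbit d d' : d' \in porbit n d -> org d' = org d.
Proof.
by move: d'; apply: (porbit_ind (P := fun d' => org d' = org d)) => // z; rewrite (g_org G).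
Qed.

Lemma live_porbit d d' : d' \in porbit n d -> alive e d' = alive e d.
Proof.
by move: d'; apply: (porbit_ind (P := fun d' => alive e d' = alive e d)) => // z; rewrite live_n.
Qed.

Lemma live_porbit_f d d' : d' \in porbit f d -> alive e d' = alive e d.
Proof.
by move: d'; apply: (porbit_ind (P := fun d' => alive e d' = alive e d)) => // z; rewrite live_f.
Qed.

Lemma mem_porbit_n d d' : alive e d -> (d' \in porbit n d) = alive e d' && (org d' == org d).
Proof.
move=> ld; apply/idP/andP => [h|[ld' /eqP h]].
  by rewrite (live_porbit h) (org_porbit h).
by apply: (g_node G).
Qed.

Lemma adjm_sym : symmetric (adjm e org).
Proof.
by move=> u v; apply/adjmP/adjmP => -[d [l a b]]; exists (e d); rewrite liveE (g_inv G).
Qed.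

Lemma adjm_live d : alive e d -> adjm e org (org d) (org (e d)).
Proof. by move=> l; apply/adjmP; exists d. Qed.

Lemma adjm_irr u : adjm e org u u = false.
Proof.
apply/negbTE; apply/negP => /adjmP[d [l a b]].
by have := g_loop G l; rewrite a b eqxx.
Qed.

Section Del.
Variable X : {set D}.
Hypothesis eX : forall d, d \in X -> e d \in X.

Lemma delE d : d \in X -> del e X d = e d.
Proof. by move=> dX; rewrite del_id ?eX. Qed.

Lemma live_del d : alive (del e X) d = (d \in X) && alive e d.
Proof.
rewrite /alive; have [dX|dX] := boolP (d \in X); first by rewrite delE.
by rewrite del_out ?eqxx.
Qed.

Lemma plane_map_del : plane_map (del e X) (del n X) org R.
Proof.
split.
- move=> d; have [dX|dX] := boolP (d \in X); last by rewrite !(del_out _ dX).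
  by rewrite !delE ?eX // (g_inv G).
- move=> d; rewrite live_del negb_and; case: (boolP (d \in X)) => [dX|dX _] /=.
    by move/(g_dead G) => h; rewrite del_id ?h.
  by rewrite del_out.
- move=> d; have [dX|dX] := boolP (d \in X); last by rewrite del_out.
  apply: (del_skip (P := fun y => org y = org d)) => //; last exact: (g_org G).
  by move=> y _; rewrite (g_org G).
- move=> d d'; rewrite !live_del => /andP[dX l] /andP[dX' l'] od.
  by rewrite del_porbit //; apply: (g_node G).
- exact: del_planar (g_planar G).
- by move=> d; rewrite live_del => /andP[dX l]; rewrite delE // (g_loop G).
- move=> d d'; rewrite !live_del => /andP[dX l] /andP[dX' l'].
  by rewrite !delE //; apply: (g_simple G).
- move=> p /andP[cp up]; apply: (g_cyc G); rewrite /ucycle up andbT.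
  apply: sub_cycle cp => u v /adjmP[d []]; rewrite live_del => /andP[dX l].
  by rewrite delE // => a b; apply/adjmP; exists d.
- by move=> d a b; rewrite live_del => /andP[dX l]; rewrite delE // (g_Rsym G).
- by move=> d a b b'; rewrite live_del => /andP[dX l]; apply: (g_Rinj G).
- move=> d1 d2 d3 a b c a'; rewrite !live_del => /andP[x1 l1] /andP[x2 l2] /andP[x3 l3].
  by rewrite !delE //; apply: (g_Rtri G).
Qed.

Lemma del_face s : porbit f s \subset X -> porbit (del e X * del n X)%g s = porbit f s.
Proof.
move=> /subsetP sX; have st d : d \in porbit f s -> (del e X * del n X)%g d = f d.
  move=> ds; have dX := sX _ ds; rewrite !permM delE // del_id ?eX //.
  by apply: sX; rewrite -fE porbit_step.
apply/setP=> d; apply/idP/idP.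
  move: d; apply: (porbit_ind (P := fun d => d \in porbit f s)); first exact: porbit_id.
  by move=> z h; rewrite st // porbit_step.
move=> ds; suff [] : d \in porbit f s /\ d \in porbit (del e X * del n X)%g s by [].
move: d ds; apply: (porbit_ind (P := fun d => d \in porbit f s /\ d \in porbit (del e X * del n X)%g s)).
  by rewrite !porbit_id.
by move=> z [h h']; rewrite porbit_step; split => //; rewrite -st // porbit_step.
Qed.

End Del.
End Basic.

End Maps.

(** * Minimal counterexamples *)

(** Each of the at most two x forbids at most one of the three colors. An x that forbids nothing
    contributes the dummy [ord0], which only enlarges the avoided set. *)
Lemma avoid_color (D : finType) (A : {set D}) (P : D -> pred 'I_3) :
  (forall x a a', x \in A -> P x a -> P x a' -> a = a') -> #|A| <= 2 ->
  exists c, forall x, x \in A -> ~~ P x c.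
Proof.
move=> H lA; pose B := [set odflt ord0 [pick a | P x a] | x in A].
have : 0 < #|~: B|.
  have : #|B| <= 2 by apply: leq_trans lA; apply: leq_imset_card.
  by have := cardsC B; rewrite card_ord; lia.
rewrite card_gt0 => /set0Pn[c]; rewrite inE => cB; exists c => x xA.
apply: contra cB => Pc; apply/imsetP; exists x => //.
case: pickP => [a Pa|/(_ c)]; last by rewrite Pc.
exact: H Pc Pa.
Qed.

Section Min.
Variables (D V : finType).
Implicit Types (d x y : D) (u v : V) (X A : {set D}).

(** [mc_IH] lets origins and conflicts vary as well, because the identification of two vertices
    changes both. *)
Record mincex (e n : {perm D}) (org : D -> V) (R : D -> rel 'I_3) (S : {set V})
    (f0 : V -> 'I_3) : Prop := MinCex {
  mc_good : plane_map e n org R;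
  mc_IH : forall e' n' org' R', plane_map e' n' org' R' ->
    #|[set d : D | alive e' d]| < #|[set d | alive e d]| ->
    @extendable D V e' n' org' R';
  mc_S : face_or_small e n org S;
  mc_12 : #|S| <= 12;
  mc_f0 : proper_on e org R S f0;
  mc_no : forall f, proper e org R f -> {in S, f =1 f0} -> False }.

Variables (e n : {perm D}) (org : D -> V) (R : D -> rel 'I_3).
Variables (S : {set V}) (f0 : V -> 'I_3).
Hypothesis M : mincex e n org R S f0.
Let G := mc_good M.
Local Notation f := (e * n)%g.
Local Notation live := (alive e).
Local Notation adj := (adjm e org).

(** Minimality for the map on the darts [X], one live dart being left out. The precoloring is
    arbitrary, so that a coloring of one piece can be prescribed on the boundary of the next. *)
Lemma color_submap X S' g0 : (forall d, d \in X -> e d \in X) ->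
  (exists2 d, live d & d \notin X) -> face_or_small (del e X) (del n X) org S' -> #|S'| <= 12 ->
  (forall d, live d -> d \in X -> org d \in S' -> org (e d) \in S' ->
     ~~ R d (g0 (org d)) (g0 (org (e d)))) ->
  exists2 g, (forall d, live d -> d \in X -> ~~ R d (g (org d)) (g (org (e d)))) &
     {in S', g =1 g0}.
Proof.
move=> eX [d0 l0 d0X] oS cS pS.
have lt : #|[set d | alive (del e X) d]| < #|[set d | live d]|.
  apply: proper_card; apply/properP; split.
    by apply/subsetP=> d; rewrite !inE live_del // => /andP[].
  by exists d0; rewrite !inE // live_del // (negbTE d0X).
have ext := mc_IH M (plane_map_del G eX) lt; have [|g pg gS] := ext S' g0 oS cS.
  by move=> d; rewrite live_del // => /andP[dX l]; rewrite delE //; apply: pS.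
exists g => // d l dX; have := pg d; rewrite live_del // dX l delE //; exact.
Qed.

Lemma face_or_small_face X s : (forall d, d \in X -> e d \in X) -> live s ->
  porbit f s \subset X -> face_or_small (del e X) (del n X) org [set org d | d in porbit f s].
Proof.
move=> eX ls sX; right; exists s.
  by rewrite live_del // ls (subsetP sX) // porbit_id.
by rewrite (del_face eX sX).
Qed.

Lemma face_or_small_del X : (forall d, d \in X -> e d \in X) ->
  (forall d, live d -> org d \in S -> org (e d) \in S -> d \in X) ->
  face_or_small (del e X) (del n X) org S.
Proof.
move=> eX H; case: (mc_S M) => [|[s ls SE]]; first by left.
rewrite SE; apply: face_or_small_face => //; apply/subsetP => d ds; apply: H.
- by rewrite (live_porbit_f G ds).
- by rewrite SE imset_f.
- by rewrite SE -(org_f G) imset_f // porbit_step.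
Qed.

(** Color the map without the edges at v; two neighbours forbid at most two colors there. *)
Lemma deg_ge3 d : live d -> org d \notin S -> 2 < #|porbit n d|.
Proof.
move=> ld dS; rewrite ltnNge; apply/negP=> le2; set v := org d in dS.
pose X := [set x | (org x != v) && (org (e x) != v)].
have eX x : x \in X -> e x \in X by rewrite !inE (g_inv G) andbC.
have [||||g gX gS] := color_submap (X := X) (S' := S) (g0 := f0) eX.
- by exists d => //; rewrite inE eqxx.
- apply: face_or_small_del => // x lx xS exS; rewrite inE.
  by apply/andP; split; [apply: contraNneq dS => <-|apply: contraNneq dS => <-].
- exact: mc_12 M.
- by move=> x lx _; apply: (mc_f0 M).
have [c Hc] : exists c, forall x, x \in porbit n d -> ~~ R x c (g (org (e x))).
  apply: (avoid_color (P := fun x a => R x a (g (org (e x))))) => // x a a' xd.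
  have lx : live x by rewrite (live_porbit G xd).
  rewrite -!(g_Rsym G _ _ lx); apply: (g_Rinj G); by rewrite (liveE G).
apply: (mc_no M (f := fun u => if u == v then c else g u)).
  move=> x lx; have [xv|xv] := eqVneq (org x) v.
    rewrite ifN; last by rewrite -xv eq_sym (g_loop G).
    by apply: Hc; rewrite (mem_porbit_n G) // lx xv eqxx.
  have [exv|exv] := eqVneq (org (e x)) v.
    rewrite -(g_Rsym G) // -{2}(g_inv G x); apply: Hc.
    by rewrite (mem_porbit_n G) // (liveE G) lx exv eqxx.
  by apply: gX => //; rewrite inE xv exv.
by move=> u uS; rewrite ifN ?gS //; apply: contraNneq dS => <-.
Qed.

(** If no edge left [S], the edges off [S] could be colored alone, with nothing precolored, and
    combined with [f0]. *)
Lemma S_exit s : live s -> S = [set org d | d in porbit f s] ->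
  exists d, [/\ live d, org d \in S & org (e d) \notin S].
Proof.
move=> ls SE; case: (boolP [exists d, [&& live d, org d \in S & org (e d) \notin S]]).
  by case/existsP=> d /and3P[]; exists d.
move=> /existsPn H; exfalso.
have {}H d : live d -> org d \in S -> org (e d) \in S.
  by move=> l dS; have := H d; rewrite l dS /= negbK.
pose X := [set x | (org x \notin S) && (org (e x) \notin S)].
have eX x : x \in X -> e x \in X by rewrite !inE (g_inv G) andbC.
have [||||g gX _] := color_submap (X := X) (S' := set0) (g0 := f0) eX.
- by exists s => //; rewrite inE SE imset_f // porbit_id.
- by left; rewrite cards0.
- by rewrite cards0.
- by move=> x lx _; rewrite inE.
apply: (mc_no M (f := fun u => if u \in S then f0 u else g u)); last by move=> u ->.
move=> x lx; have [xS|xS] := boolP (org x \in S).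
  by have exS := H _ lx xS; rewrite exS; apply: (mc_f0 M).
have exS : org (e x) \notin S.
  by apply: contra xS => h; rewrite -(g_inv G x); apply: H; rewrite ?(liveE G).
by rewrite (negbTE exS); apply: gX => //; rewrite inE xS.
Qed.

(** Deleting a chord leaves the face of [S] intact, and the chord is respected anyway since its ends
    keep their colors from [f0]. *)
Lemma S_chord s d : live s -> S = [set org d | d in porbit f s] ->
  live d -> org d \in S -> org (e d) \in S -> (d \in porbit f s) || (e d \in porbit f s).
Proof.
move=> ls SE ld dS edS; apply: contraT; rewrite negb_or => /andP[n1 n2]; exfalso.
pose X := ~: [set d; e d].
have eX x : x \in X -> e x \in X.
  rewrite !inE (can2_eq (g_inv G) (g_inv G)) (inj_eq perm_inj) orbC; exact.
have [||||g gX gS] := color_submap (X := X) (S' := S) (g0 := f0) eX.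
- by exists d => //; rewrite !inE eqxx.
- rewrite SE; apply: face_or_small_face => //; apply/subsetP=> x xs; rewrite !inE negb_or.
  by apply/andP; split; [apply: contraNneq n1 => <-|apply: contraNneq n2 => <-].
- exact: mc_12 M.
- by move=> x lx _; apply: (mc_f0 M).
apply: (mc_no M (f := g)) => // x lx.
have [xX|] := boolP (x \in X); first exact: gX.
rewrite !inE negbK => /orP[] /eqP ->; rewrite ?(g_inv G) !gS //.
  exact: (mc_f0 M).
by rewrite (g_Rsym G) //; apply: (mc_f0 M).
Qed.

(** One side of a cut vertex: its rotation is split between d and d', and [A] is closed under the
    moves of the split map. *)
Definition cutset d d' A := [/\ (forall x, (e x \in A) = (x \in A)),
  (forall x, ((n * tperm d d')%g x \in A) = (x \in A)), d \in A & d' \notin A].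

Lemma cutsetC d d' A : cutset d d' A -> cutset d' d (~: A).
Proof.
case=> eA nA dA dA'; split; rewrite ?inE ?negbK //.
  by move=> x; rewrite !inE eA.
by move=> x; rewrite !inE tpermC nA.
Qed.

(** The transposition splits a vertex and a face at once, so d and d' become disconnected; [A] is
    the class of d. *)
Lemma cutset_ex d d' : d != d' -> d' \in porbit n d -> d' \in porbit f d ->
  exists A, cutset d d' A.
Proof.
move=> nd dn df; have := planar_cut_r (g_planar G) nd; rewrite !(porbit_sym _ d) => /(_ dn df).
set r := link2 _ _ => cn; exists [set x | connect r d x].
have cl x y : connect r x y -> (y \in [set x | connect r d x]) = (x \in [set x | connect r d x]).
  move=> xy; rewrite !inE; apply/idP/idP => h; apply: connect_trans h _ => //.
  by rewrite link2_sym.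
split; rewrite ?inE ?connect0 //; move=> x; apply: cl; by [apply: link2_l|apply: link2_r].
Qed.

(** * Coloring the two sides of a cut vertex separately *)

Section Cut.
Variables (d d' : D) (A : {set D}).
Hypothesis cA : cutset d d' A.
Hypothesis dd' : d' \in porbit n d.
Hypothesis ld : live d.
Local Notation t := (tperm d d').

Lemma cut_e x : x \in A -> e x \in A. Proof. by case: cA => eA _ _ _; rewrite eA. Qed.

(** The rotation leaves [A] only by stepping onto d' and returns to it at d, so deleting the other
    side amounts to splitting the vertex. *)
Lemma cut_n x : x \in A -> del n A x = (n * t)%g x.
Proof.
case: cA => _ nA dA dA' xA; have nx := nA x; rewrite xA permM in nx.
rewrite permM; move: nx; case: tpermP => [e1|e1|e1 e2] nx; last by rewrite del_id.
  by rewrite nx in dA'.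
have : del n A x \notin A \/ del n A x = d.
  apply: (del_skip (P := fun y => y \notin A \/ y = d)) => //; last by left; rewrite e1.
  move=> y yA _; have ny := nA y; rewrite (negbTE yA) permM in ny.
  case: tpermP ny => [->|->|_ _ /negbT]; [by right|by rewrite dA|by left].
by case=> //; rewrite del_mem.
Qed.

Lemma cut_f x : x \in A -> (del e A * del n A)%g x = (f * t)%g x.
Proof.
move=> xA; have exA := cut_e xA.
by rewrite permM (delE (@cut_e)) // cut_n // !permM.
Qed.

(** The split alters the rotation only at the origin of d; every other vertex has all its darts on
    one side. *)
Lemma cut_node x y : x \in A -> y \notin A -> live x -> live y -> org x = org y ->
  org x = org d.
Proof.
case: cA => _ nA dA dA' xA yA lx ly xy; apply/eqP; apply: contraT => xd.
have od := org_porbit G dd'.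
have : y \in porbit n x by apply: (g_node G).
move=> yx; suff [] : y \in A /\ org y = org x by rewrite (negbTE yA).
move: y yx {yA ly xy}.
apply: (porbit_ind (P := fun y => y \in A /\ org y = org x)) => // z [zA oz].
split; last by rewrite (g_org G).
have := nA z; rewrite zA permM; case: tpermP => // [e1|e1].
  by rewrite -oz -(g_org G) e1 eqxx in xd.
by rewrite -oz -(g_org G) e1 od eqxx in xd.
Qed.

(** [S] lives on the side [A]. That side is colored with [S] precolored, then the other side with
    just the cut vertex precolored. *)
Lemma cut_glue1 : face_or_small (del e A) (del n A) org S ->
  (forall y, y \notin A -> live y -> org y \in S -> org y = org d) -> False.
Proof.
move=> oA SA; have [eA nA dA dA'] := cA; set v := org d in SA.
have [||||g gA gS] := color_submap (X := A) (S' := S) (g0 := f0) (@cut_e) => //.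
- by exists d' => //; rewrite (live_porbit G dd').
- exact: mc_12 M.
- by move=> x lx _; apply: (mc_f0 M).
have eA' x : x \in ~: A -> e x \in ~: A by rewrite !inE eA.
have [||||h hA hS] := color_submap (X := ~: A) (S' := [set v]) (g0 := g) eA'.
- by exists d => //; rewrite inE dA.
- by left; rewrite cards1.
- by rewrite cards1.
- by move=> x lx _; rewrite !inE => /eqP a /eqP b; have := g_loop G lx; rewrite a b eqxx.
(* The vertices strictly on the other side; the cut vertex takes its color from [g], and [h] agrees
   with it there. *)
pose B u := (u != v) && [exists y, [&& live y, y \notin A & org y == u]].
have BA x : live x -> x \in A -> B (org x) = false.
  move=> lx xA; apply/negP => /andP[xv /existsP[y /and3P[ly yA /eqP yx]]].
  by rewrite (cut_node xA yA) ?eqxx in xv.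
have BB x : live x -> x \notin A -> (if B (org x) then h (org x) else g (org x)) = h (org x).
  move=> lx xA; case: ifP => // /negbT; rewrite negb_and negbK => /orP[/eqP ->|].
    by rewrite hS ?inE.
  by move=> /existsPn/(_ x); rewrite lx xA eqxx.
apply: (mc_no M (f := fun u => if B u then h u else g u)).
  move=> x lx; have [xA|xA] := boolP (x \in A).
    by rewrite !BA ?(liveE G) ?eA //; apply: gA.
  by rewrite !BB ?(liveE G) ?eA //; apply: hA => //; rewrite inE.
move=> u uS; rewrite ifN ?gS //; apply/negP=> /andP[uv /existsP[y /and3P[ly yA /eqP yu]]].
by move/eqP: uv; apply; rewrite -yu; apply: SA; rewrite ?yu.
Qed.

Lemma cut_face x : x \in porbit (del e A * del n A)%g d -> x \in A /\ x \in porbit (f * t)%g d.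
Proof.
have [eA nA dA dA'] := cA; move: x.
apply: (porbit_ind (P := fun x => x \in A /\ x \in porbit (f * t)%g d)).
  by rewrite dA porbit_id.
move=> z [zA zo]; rewrite cut_f // porbit_step; split => //.
by have := nA (e z); rewrite !permM eA zA.
Qed.

Lemma cut_face' x : x \in porbit (f * t)%g d -> x \in A /\ x \in porbit (del e A * del n A)%g d.
Proof.
have [eA nA dA dA'] := cA; move: x.
apply: (porbit_ind (P := fun x => x \in A /\ x \in porbit (del e A * del n A)%g d)).
  by rewrite dA porbit_id.
move=> z [zA zo]; rewrite -cut_f // porbit_step; split => //.
by rewrite cut_f //; have := nA (e z); rewrite !permM eA zA.
Qed.

(** The face of s contains neither d nor d', so it never passes the place where [A] can be left. *)
Lemma cut_keep s : s \in A -> d \notin porbit f s -> d' \in porbit f d -> porbit f s \subset A.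
Proof.
have [eA nA dA dA'] := cA; move=> sA ds df; apply/subsetP => x xs.
suff [] : x \in A /\ x \in porbit f s by [].
move: x xs; apply: (porbit_ind (P := fun x => x \in A /\ x \in porbit f s)).
  by rewrite porbit_id.
move=> z [zA zs]; rewrite porbit_step; split => //.
have := nA (e z); rewrite eA zA permM -(fE e n); case: tpermP => // e1.
  by rewrite -e1 porbit_step zs in ds.
have ds' : d' \in porbit f s by rewrite -e1 porbit_step.
by move: ds ds'; rewrite !(porbit_sym _ _ s) -!eq_porbit_mem; move: df;
  rewrite -eq_porbit_mem => /eqP-> /negbTE->.
Qed.

End Cut.
End Min.

Section FaceSimple.
Variables (D V : finType).
Implicit Types (d x y : D) (u v : V) (X A : {set D}).
Variables (e n : {perm D}) (org : D -> V) (R : D -> rel 'I_3).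
Variables (S : {set V}) (f0 : V -> 'I_3).
Hypothesis M : mincex e n org R S f0.
Let G := mc_good M.
Local Notation f := (e * n)%g.
Local Notation live := (alive e).
Local Notation adj := (adjm e org).

(** Here the face of [S] runs through the cut vertex twice. It falls into two closed walks, each a
    face of its own side with vertices in [S]; both sides are colored from [f0] and so agree at the
    cut vertex. *)
Lemma cut_glue2 d d' A : cutset e n d d' A -> d' \in porbit n d -> live d ->
  d' \in porbit f d -> S = [set org x | x in porbit f d] -> False.
Proof.
move=> cA dd' ld df SE; have [eA nA dA dA'] := cA; have cB := cutsetC cA.
have dd : d \in porbit n d' by rewrite porbit_sym.
have ld' : live d' by rewrite (live_porbit G dd').
have od := org_porbit G dd'; set v := org d in od.
pose SA := [set org x | x in porbit (del e A * del n A)%g d].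
pose SB := [set org x | x in porbit (del e (~: A) * del n (~: A))%g d'].
have sub x : x \in porbit (f * tperm d d')%g d \/ x \in porbit (f * tperm d d')%g d' ->
    x \in porbit f d.
  case; move: x; apply: (porbit_ind (P := fun x => x \in porbit f d)); rewrite ?porbit_id //;
   move=> z zd; rewrite permM; case: tpermP; rewrite ?porbit_id ?porbit_step //.
have SAS : SA \subset S.
  rewrite SE; apply/subsetP=> _ /imsetP[x /(cut_face cA)[_ xo] ->]; apply: imset_f.
  by apply: sub; left.
have SBS : SB \subset S.
  rewrite SE; apply/subsetP=> _ /imsetP[x /(cut_face cB)[_ xo] ->]; apply: imset_f.
  by apply: sub; right; rewrite tpermC.
have oA : face_or_small (del e A) (del n A) org SA.
  by right; exists d => //; rewrite (live_del (cut_e cA)) dA.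
have oB : face_or_small (del e (~: A)) (del n (~: A)) org SB.
  by right; exists d' => //; rewrite (live_del (cut_e cB)) inE dA'.
have [|||g gA gS] := color_submap M (g0 := f0) (@cut_e _ _ _ _ _ _ cA) _ oA.
- by exists d'.
- exact: leq_trans (subset_leq_card SAS) (mc_12 M).
- by move=> x lx _ xS exS; apply: (mc_f0 M) => //; apply: (subsetP SAS).
have [|||h hB hS] := color_submap M (g0 := f0) (@cut_e _ _ _ _ _ _ cB) _ oB.
- by exists d; rewrite // inE dA.
- exact: leq_trans (subset_leq_card SBS) (mc_12 M).
- by move=> x lx _ xS exS; apply: (mc_f0 M) => //; apply: (subsetP SBS).
have vA : v \in SA by apply: imset_f; apply: porbit_id.
have vB : v \in SB by rewrite -od; apply: imset_f; apply: porbit_id.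
pose B u := (u != v) && [exists y, [&& live y, y \notin A & org y == u]].
have BA x : live x -> x \in A -> B (org x) = false.
  move=> lx xA; apply/negP => /andP[xv /existsP[y /and3P[ly yA /eqP yx]]].
  by rewrite (cut_node M cA dd' xA yA) ?eqxx in xv.
have BB x : live x -> x \notin A -> (if B (org x) then h (org x) else g (org x)) = h (org x).
  move=> lx xA; case: ifP => // /negbT; rewrite negb_and negbK => /orP[/eqP ->|].
    by rewrite hS // gS.
  by move=> /existsPn/(_ x); rewrite lx xA eqxx.
apply: (mc_no M (f := fun u => if B u then h u else g u)).
  move=> x lx; have [xA|xA] := boolP (x \in A).
    by rewrite !BA ?(liveE G) ?eA //; apply: gA.
  by rewrite !BB ?(liveE G) ?eA //; apply: hB => //; rewrite inE.
rewrite SE => _ /imsetP[x xd ->].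
have lx : live x by rewrite (live_porbit_f G xd).
case/orP: (porbit_tperm_mem d' xd) => xo.
  have [xA xo'] := cut_face' cA xo.
  by rewrite BA // gS //; apply: imset_f.
rewrite tpermC in xo; have [xA xo'] := cut_face' cB xo; rewrite inE in xA.
by rewrite BB // hS //; apply: imset_f.
Qed.

(** Two corners of one face at one vertex make it a cut vertex. Either [S] has at most one vertex,
    or it is this very face, or it is a face lying on one side; in each case the sides can be
    colored one after the other. *)
Lemma face_simple d d' : live d -> d' \in porbit n d -> d' \in porbit f d -> d = d'.
Proof.
move=> ld dn df; apply/eqP; apply: contraT => nd; exfalso.
have ld' : live d' by rewrite (live_porbit G dn).
have dn' : d \in porbit n d' by rewrite porbit_sym.
have df' : d \in porbit f d' by rewrite porbit_sym.
have od := org_porbit G dn.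
have [A cA] := cutset_ex M nd dn df; have cB := cutsetC cA.
case: (mc_S M) => [S1|[s ls SE]].
  case: (boolP [exists y, [&& live y, y \notin A, org y \in S & org y != org d]]).
    case/existsP=> y /and4P[ly yA yS yv].
    apply: (cut_glue1 M cB dn' ld'); first by left.
    move=> x; rewrite inE negbK => xA lx xS; rewrite od.
    by apply: (cut_node M cA dn xA yA) => //; apply: (card_le1_eqP S1).
  move=> /existsPn H; apply: (cut_glue1 M cA dn ld); first by left.
  by move=> y yA ly yS; have := H y; rewrite yA ly yS /= negbK => /eqP.
case: (boolP (d \in porbit f s)) => ds.
  apply: (cut_glue2 cA dn ld df); rewrite SE.
  by move: ds; rewrite -eq_porbit_mem => /eqP->.
have [sA|sA] := boolP (s \in A).
  have sub := cut_keep cA sA ds df.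
  apply: (cut_glue1 M cA dn ld).
    by rewrite SE; apply: face_or_small_face => //; exact: (cut_e cA).
  move=> y yA ly; rewrite SE => /imsetP[x xs yx].
  rewrite yx; apply: (cut_node M cA dn _ yA) => //; first exact: (subsetP sub).
  by rewrite (live_porbit_f G xs).
have sB : s \in ~: A by rewrite inE.
have ds' : d' \notin porbit f s.
  apply: contra ds; rewrite !(porbit_sym _ _ s) -!eq_porbit_mem.
  by move: df; rewrite -eq_porbit_mem => /eqP->.
have sub := cut_keep cB sB ds' df'.
apply: (cut_glue1 M cB dn' ld').
  by rewrite SE; apply: face_or_small_face => //; exact: (cut_e cB).
move=> y yA ly; rewrite SE => /imsetP[x xs yx].
rewrite yx; apply: (cut_node M cB dn' _ yA) => //; first exact: (subsetP sub).
by rewrite (live_porbit_f G xs).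
Qed.

End FaceSimple.

(** * The Jordan curve theorem *)

Lemma next_ind (T : finType) (p : seq T) (P : T -> Prop) x : uniq p -> x \in p -> P x ->
  (forall y, y \in p -> P y -> P (next p y)) -> forall y, y \in p -> P y.
Proof.
move=> up xp Px H y yp.
have : fconnect (next p) x y by rewrite (fconnect_cycle (cycle_next up)).
case/connectP=> q + ->; elim/last_ind: q => [|q z IH] //=.
rewrite rcons_path last_rcons => /andP[h /eqP<-].
apply: H; last exact: IH.
have : fconnect (next p) x (last x q) by apply/connectP; exists q.
by rewrite (fconnect_cycle (cycle_next up)).
Qed.

Lemma next2_neq (T : finType) (p : seq T) x : uniq p -> x \in p -> 2 < size p ->
  next p (next p x) != x.
Proof.
move=> up xp; apply: contraTneq => e; rewrite -leqNgt.
have : forall y, y \in p -> (y == x) || (y == next p x).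
  apply: (next_ind (P := fun y => (y == x) || (y == next p x)) up xp); first by rewrite eqxx.
  by move=> y _ /orP[] /eqP->; rewrite ?e eqxx ?orbT.
move=> H; apply: (@uniq_leq_size _ p [:: x; next p x] up) => y /H.
by rewrite !inE.
Qed.

Section Jordan.
Variables (D V : finType).
Implicit Types (d x y : D) (u v : V) (X A : {set D}).
Variables (e n : {perm D}) (org : D -> V) (R : D -> rel 'I_3).
Hypothesis G : plane_map e n org R.
Local Notation f := (e * n)%g.
Local Notation live := (alive e).
Local Notation adj := (adjm e org).

Definition cycle_dart (p : seq V) d := [&& live d, org d \in p & org (e d) == next p (org d)].

Definition cycle_side p (L : {set D}) := [/\ forall x, (f x \in L) = (x \in L),
  forall x, ~~ cycle_dart p x -> ~~ cycle_dart p (e x) -> (e x \in L) = (x \in L) &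
  forall k, cycle_dart p k -> k \in L /\ e k \notin L].

Lemma cycle_dart_rev p d : uniq p -> cycle_dart (rev p) d = cycle_dart p (e d).
Proof.
move=> up; rewrite /cycle_dart (liveE G) mem_rev next_rev // (g_inv G).
have [l|//] := boolP (live d); rewrite /=.
apply/andP/andP => -[h /eqP E].
  by rewrite E mem_prev h next_prev.
by rewrite E mem_next h prev_next.
Qed.

Lemma side_rev p L : uniq p -> cycle_side p L -> cycle_side (rev p) (~: L).
Proof.
move=> up [fL eL kL]; split=> [x|x|k]; first by rewrite !inE fL.
  by rewrite !cycle_dart_rev // (g_inv G) => a b; rewrite !inE eL.
rewrite cycle_dart_rev // => /kL[a b]; rewrite (g_inv G) in b.
by rewrite !inE negbK a b.
Qed.

Section OnCycle.
Variable p : seq V.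
Hypothesis cp : ucycle adj p.
Hypothesis sp : 2 < size p.
Let up : uniq p. Proof. by case/andP: cp. Qed.

Lemma cycle_dart_ex u : u \in p -> exists2 k, cycle_dart p k & org k = u.
Proof.
move=> up'; have /andP[cy _] := cp; have /adjmP[k [l a b]] := next_cycle cy up'.
by exists k => //; rewrite /cycle_dart l a up' b eqxx.
Qed.

Lemma cycle_dart_inj k k' : cycle_dart p k -> cycle_dart p k' -> org k = org k' -> k = k'.
Proof.
move=> /and3P[l h /eqP a] /and3P[l' h' /eqP a'] E.
by apply: (g_simple G) => //; rewrite a a' E.
Qed.

Lemma cycle_dart_live k : cycle_dart p k -> live k. Proof. by case/and3P. Qed.

Lemma cycle_dart_inj_head k k' : cycle_dart p k -> cycle_dart p k' -> org (e k) = org (e k') -> k = k'.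
Proof.
move=> hk hk' E; apply: cycle_dart_inj => //; have /and3P[_ _ /eqP a] := hk.
have /and3P[_ _ /eqP a'] := hk'.
by rewrite -(prev_next up (org k)) -(prev_next up (org k')) -a -a' E.
Qed.

Lemma cycle_dart_e k : cycle_dart p k -> cycle_dart p (e k) = false.
Proof.
move=> /and3P[l h /eqP a]; apply/negP=> /and3P[_ _ /eqP].
rewrite (g_inv G) a => b; have := next2_neq up h sp.
by rewrite -b eqxx.
Qed.

(** Turning around the head of k from [e k], one meets only darts off the cycle until the outgoing
    cycle dart k'. The deletion to [W] makes this turn in a single step. *)
Lemma walk_next (Q : D -> Prop) k k' :
  (forall z, ~~ cycle_dart p z -> ~~ cycle_dart p (e z) -> Q z -> Q (n z)) ->
  cycle_dart p k -> cycle_dart p k' -> org k' = org (e k) -> Q (n (e k)) -> Q k'.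
Proof.
move=> HQ hk hk' E Qk; pose W := [set k'; e k].
have lek : live (e k) by rewrite (liveE G) (cycle_dart_live hk).
have kW : k' \in W by rewrite !inE eqxx.
have ekW : e k \in W by rewrite !inE eqxx orbT.
have ne : k' != e k.
  by apply: contraTneq hk' => ->; rewrite cycle_dart_e.
have [Qd _] : Q (del n W (e k)) /\ org (del n W (e k)) = org (e k) /\ live (del n W (e k)).
  apply: (del_skip (P := fun y => Q y /\ org y = org (e k) /\ live y)) => //.
    move=> y yW [Qy [oy ly]]; rewrite (g_org G) (live_n G); split => //; apply: HQ => //.
      apply: contra yW => hy; rewrite !inE; apply/orP; left; apply/eqP.
      by apply: cycle_dart_inj => //; rewrite oy.
    apply: contra yW => hy; rewrite !inE; apply/orP; right; apply/eqP.
    by rewrite -(g_inv G y); congr (e _); apply: cycle_dart_inj_head => //; rewrite (g_inv G).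
  by rewrite (g_org G) (live_n G).
have : del n W (e k) \in W by apply: del_mem.
rewrite !inE => /orP[/eqP<- //|/eqP E2]; exfalso.
have : k' \in porbit (del n W) (e k).
  rewrite del_porbit //; apply: (g_node G) => //; exact: cycle_dart_live hk'.
have : forall y, y \in porbit (del n W) (e k) -> y = e k.
  by apply: (porbit_ind (P := fun y => y = e k)) => // z ->.
by move=> h /h; apply/eqP.
Qed.

Lemma cycle_dart_ind (Q : D -> Prop) k0 : cycle_dart p k0 -> Q k0 ->
  (forall z, ~~ cycle_dart p z -> ~~ cycle_dart p (e z) -> Q z -> Q (n z)) ->
  (forall k, cycle_dart p k -> Q k -> Q (n (e k))) -> forall k, cycle_dart p k -> Q k.
Proof.
move=> h0 Q0 HQ Hk k hk; have kp : org k \in p by case/and3P: hk.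
have k0p : org k0 \in p by case/and3P: h0.
suff : forall k', cycle_dart p k' -> org k' = org k -> Q k' by apply.
move: (org k) kp => u.
apply: (next_ind (P := fun u => forall k', cycle_dart p k' -> org k' = u -> Q k') up k0p).
  by move=> k' hk' E; rewrite (cycle_dart_inj hk' h0 E).
move=> {}u up' H k' hk' E; have [k1 hk1 E1] := cycle_dart_ex up'.
apply: (walk_next HQ hk1 hk').
  by case/and3P: hk1 => _ _ /eqP->; rewrite E1.
by apply: Hk => //; apply: H.
Qed.

End OnCycle.

(** In the dual map, delete the duals of all edges of [p] but one, that of k0. The product then has
    a cycle running along [p] from [e k0] to k0, so cutting the last dual edge splits both the
    factor and the product and disconnects. The side is the class of k0. *)
Lemma jordan p : ucycle adj p -> 2 < size p -> exists L, cycle_side p L.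
Proof.
move=> cp sp; have up : uniq p by case/andP: cp.
have [u up0] : exists u, u \in p.
  by case: (p) sp => // a q _; exists a; rewrite inE eqxx.
have [k0 h0 E0] := cycle_dart_ex cp up0.
have l0 := cycle_dart_live h0.
pose K' := [set z | (cycle_dart p z || cycle_dart p (e z)) && (z != k0) && (z != e k0)].
have eK' z : (e z \in K') = (z \in K').
  rewrite !inE (g_inv G) orbC !(can2_eq (g_inv G) (g_inv G)) (g_inv G).
  by rewrite -!andbA (andbC (z != e k0)).
pose e1 := del e (~: K').
have e1E z : e1 z = if z \in K' then z else e z.
  case: ifP => h; first by rewrite /e1 del_out // inE h.
  by rewrite /e1 del_id // inE ?eK' h.
have pl1 : planar e1 f.
  have pl : planar e f.
    by apply: planar_mul (g_planar G); apply/permP=> z; rewrite permM perm1 (g_inv G).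
  by have := dels_planar (enum (~: ~: K')) [::] pl.
have k0K : k0 \notin K' by rewrite !inE eqxx andbF.
have ek0K : e k0 \notin K' by rewrite eK'.
have N z : (e1 * f)%g z = if z \in K' then n (e z) else n z.
  by rewrite permM e1E; case: ifP; rewrite permM ?(g_inv G).
have nk : k0 != e k0 by rewrite eq_sym.
have c1 : k0 \in porbit e1 (e k0).
  by rewrite -porbit_step e1E (negbTE k0K) porbit_id.
have c2 : k0 \in porbit (e1 * f)%g (e k0).
  apply: contraT => nc.
  have HQ z : ~~ cycle_dart p z -> ~~ cycle_dart p (e z) -> z \in porbit (e1 * f)%g (e k0) ->
      n z \in porbit (e1 * f)%g (e k0).
    move=> a b; rewrite -(porbit_step _ _ z) N; case: ifP => //.
    by rewrite inE (negbTE a) (negbTE b).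
  have [k1 h1 E1] := cycle_dart_ex cp (etrans (mem_next p u) up0).
  have k1o : org k1 = org (e k0).
    by rewrite E1; case/and3P: h0 => _ _ /eqP->; rewrite E0.
  have q0 : n (e k0) \in porbit (e1 * f)%g (e k0).
    have : e k0 \in porbit (e1 * f)%g (e k0) by apply: porbit_id.
    by rewrite -(porbit_step _ _ (e k0)) N (negbTE ek0K).
  have q1 : k1 \in porbit (e1 * f)%g (e k0).
    exact: (walk_next (Q := fun z => z \in porbit (e1 * f)%g (e k0)) cp sp HQ h0 h1 k1o q0).
  case/negP: nc; apply: (cycle_dart_ind (Q := fun z => z \in porbit (e1 * f)%g (e k0)) cp sp h1 q1 HQ _ h0) => k hk.
  rewrite -(porbit_step _ _ k) N; case: ifP => // /negbT.
  rewrite inE hk /= negb_and !negbK => /orP[/eqP->|/eqP E] kc.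
    exact: q0.
  by rewrite E cycle_dart_e in hk.
have := planar_cut_l pl1 nk c1 c2.
(* Now every edge of [p] is blocked: [e2] crosses precisely the edges off the cycle. *)
set e2 := (_ * e1)%g; set r := link2 e2 f => ncr.
have e2E z : e2 z = if cycle_dart p z || cycle_dart p (e z) then z else e z.
  rewrite permM; case: tpermP => [->|->|/eqP a /eqP b].
  - by rewrite e1E (negbTE ek0K) (g_inv G) h0.
  - by rewrite e1E (negbTE k0K) (g_inv G) h0 orbT.
  by rewrite e1E !inE a b !andbT.
have cl w x y : connect r x y -> (y \in [set x | connect r w x]) = (x \in [set x | connect r w x]).
  move=> xy; rewrite !inE; apply/idP/idP => h; apply: connect_trans h _ => //.
  by rewrite link2_sym.
have fcl w x : (f x \in [set x | connect r w x]) = (x \in [set x | connect r w x]).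
  by apply: cl; apply: link2_r.
have ecl w x : ~~ cycle_dart p x -> ~~ cycle_dart p (e x) ->
   (e x \in [set x | connect r w x]) = (x \in [set x | connect r w x]).
  move=> a b; apply: cl; have := link2_l e2 f x.
  by rewrite e2E (negbTE a) (negbTE b).
exists [set x | connect r k0 x]; split=> [x|x|k hk]; [exact: fcl|exact: ecl|].
have ncl' w z : ~~ cycle_dart p z -> ~~ cycle_dart p (e z) -> z \in [set x | connect r w x] ->
      n z \in [set x | connect r w x].
  by move=> a b h; rewrite -(f_e G) fcl ecl.
split.
  apply: (cycle_dart_ind (Q := fun z => z \in [set x | connect r k0 x]) cp sp h0 _ (ncl' k0) _ hk);
    first by rewrite inE connect0.
  by move=> k' _; rewrite -fE fcl.
(* If [e k] were on the side of k0, so would be [e k0], which is connected to [e k] along the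
   reversed cycle. *)
rewrite inE; apply: contra ncr => h.
apply: connect_trans h _; rewrite link2_sym.
have cr : ucycle adj (rev p).
  rewrite /ucycle rev_uniq up andbT rev_cycle.
  have /andP[h _] := cp; apply: sub_cycle h => a b; by rewrite (adjm_sym G).
have h0' : cycle_dart (rev p) (e k0) by rewrite cycle_dart_rev // (g_inv G).
have hk' : cycle_dart (rev p) (e k) by rewrite cycle_dart_rev // (g_inv G).
have sr : 2 < size (rev p) by rewrite size_rev.
suff : e k \in [set x | connect r (e k0) x] by rewrite inE.
apply: (cycle_dart_ind (Q := fun z => z \in [set x | connect r (e k0) x]) cr sr h0' _ _ _ hk');
  first by rewrite inE connect0.
  by move=> z; rewrite !cycle_dart_rev // (g_inv G) => a b; apply: ncl'.
by move=> k' _; rewrite -fE fcl.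
Qed.

End Jordan.

(** * Cycles of length at most 12 do not separate *)

Section Sep.
Variables (D V : finType).
Implicit Types (d x y : D) (u v : V) (X A : {set D}).
Variables (e n : {perm D}) (org : D -> V) (R : D -> rel 'I_3).
Variables (S : {set V}) (f0 : V -> 'I_3).
Hypothesis M : mincex e n org R S f0.
Let G := mc_good M.
Local Notation f := (e * n)%g.
Local Notation live := (alive e).
Local Notation adj := (adjm e org).
Local Notation cycle_dart := (cycle_dart e org).
Local Notation cycle_side := (cycle_side e n org).

Lemma cycle_dart_head p k : cycle_dart p k -> org (e k) \in p.
Proof. by case/and3P=> _ h /eqP->; rewrite mem_next. Qed.

Lemma side_e p L x : cycle_side p L -> org x \notin p -> (e x \in L) = (x \in L).
Proof.
move=> [fL eL kL] xp; apply: eL; first by apply: contra xp => /and3P[].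
by apply: contra xp => /cycle_dart_head; rewrite (g_inv G).
Qed.

Lemma side_node p L x y : cycle_side p L -> live x -> live y -> org x \notin p ->
  org y = org x -> (y \in L) = (x \in L).
Proof.
move=> sL lx ly xp oxy; have : y \in porbit n x by apply: (g_node G).
move=> yx; suff [] : (y \in L) = (x \in L) /\ org y = org x by [].
move: y yx {ly oxy}.
apply: (porbit_ind (P := fun y => (y \in L) = (x \in L) /\ org y = org x)) => // z [zL zo].
have [fL eL kL] := sL; rewrite (g_org G); split=> //.
by rewrite -(f_e G) fL (side_e sL) ?zo.
Qed.

(** Keep [L] and the edges of [p]. Turning from k away from [L], the next surviving dart is the
    reverse of the cycle dart arriving at the same vertex; so the reversed cycle bounds a face of
    the submap. *)
Lemma side_del p L k : cycle_side p L -> cycle_dart p k ->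
  let X := [set d | (d \in L) || cycle_dart p (e d)] in
  cycle_dart p (e (del n X k)) /\ org (del n X k) = org k.
Proof.
move=> [fL eL kL] hk X; have [kinL ekL] := kL _ hk.
have kX : k \in X by rewrite inE kinL.
have [zL zo] : del n X k \notin L /\ org (del n X k) = org k.
  apply: (del_skip (P := fun y => y \notin L /\ org y = org k)) => //; last first.
    by rewrite (g_org G) -(f_e G) fL.
  move=> y; rewrite inE negb_or => /andP[yL hy] [_ oy]; rewrite (g_org G); split => //.
  rewrite -(f_e G) fL eL //; apply: contra yL => /kL[]; exact.
split=> //; have := del_mem n kX; rewrite inE (negbTE zL); exact.
Qed.

(** No vertex of [S] is strictly inside. Color the edges without inner vertices, extending [f0],
    then [L] together with [p], where [p] bounds a face and is precolored by the first coloring. The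
    last two hypotheses make both maps strictly smaller. *)
Lemma short_cycle_side p L : ucycle adj p -> 2 < size p <= 12 -> cycle_side p L ->
  (forall d, d \in L -> live d -> org d \in S -> org d \in p) ->
  (exists2 d, live d & (d \in L) && (org d \notin p)) ->
  (exists2 d, live d & (d \notin L) && ~~ cycle_dart p (e d)) -> False.
Proof.
move=> cp /andP[sp sp12] sL SL [d1 l1 /andP[d1L d1p]] [d2 l2 /andP[d2L d2k]].
have up : uniq p by case/andP: cp.
have [fL eL kL] := sL.
pose I := [set v | [exists d, [&& live d, d \in L, org d == v & v \notin p]]].
have IP d : live d -> org d \notin p -> (org d \in I) = (d \in L).
  move=> ld dp; rewrite inE; apply/existsP/idP => [[y /and4P[ly yL /eqP oy _]]|dL].
    by rewrite -(side_node sL ld ly dp oy).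
  by exists d; rewrite ld dL eqxx.
have Ip v : v \in I -> v \notin p by rewrite inE => /existsP[d /and4P[]].
have IL d : live d -> org d \in I -> d \in L.
  by move=> ld dI; rewrite -IP // Ip.
pose X1 := [set d | (org d \notin I) && (org (e d) \notin I)].
have eX1 x : x \in X1 -> e x \in X1 by rewrite !inE (g_inv G) andbC.
have SI v : v \in S -> v \notin I.
  move=> vS; apply/negP; rewrite inE => /existsP[d /and4P[ld dL /eqP dv]].
  by move/negP; apply; rewrite -dv; apply: SL; rewrite ?dv.
have [||||g gX gS] := color_submap M (X := X1) (S' := S) (g0 := f0) eX1.
- by exists d1 => //; rewrite inE IP // d1L.
- by apply: (face_or_small_del M) => // x lx xS exS; rewrite inE !SI.
- exact: mc_12 M.
- by move=> x lx _; apply: (mc_f0 M).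
pose X := [set d | (d \in L) || cycle_dart p (e d)].
have eX x : x \in X -> e x \in X.
  rewrite !inE (g_inv G) => /orP[xL|hx]; last by case: (kL _ hx) => ->.
  case: (boolP (cycle_dart p x)) => [|h1]; first by rewrite orbT.
  case: (boolP (cycle_dart p (e x))) => h2; first by case: (kL _ h2) => _; rewrite (g_inv G) xL.
  by rewrite eL // xL.
have [u0 u0p] : exists u, u \in p.
  by case: (p) sp => // a q _; exists a; rewrite inE eqxx.
have [k0 h0 E0] := cycle_dart_ex cp u0p; have l0 := cycle_dart_live h0.
pose fX := (del e X * del n X)%g.
have fXE k : cycle_dart p k -> fX (e k) = del n X k.
  move=> hk; have kX : e k \in X by apply: eX; rewrite inE (kL _ hk).1.
  by rewrite permM (delE eX) // (g_inv G).
have ofX : forall y, y \in porbit fX (e k0) -> cycle_dart p (e y).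
  apply: (porbit_ind (P := fun y => cycle_dart p (e y))); first by rewrite (g_inv G).
  by move=> z hz; rewrite -(g_inv G z) fXE //; case: (side_del sL hz).
have pE : [set v in p] = [set org d | d in porbit fX (e k0)].
  apply/setP=> v; rewrite inE; apply/idP/imsetP; last first.
    by case=> y /ofX/cycle_dart_head; rewrite (g_inv G) => h ->.
  rewrite -mem_rev => vp.
  have uo : org (e k0) \in rev p by rewrite mem_rev; apply: cycle_dart_head.
  apply: (next_ind (P := fun v => exists2 x, x \in porbit fX (e k0) & v = org x) _ uo) => //.
  - by rewrite rev_uniq.
  - by exists (e k0) => //; apply: porbit_id.
  move=> w _ [y yo ->]; rewrite next_rev //.
  exists (fX y); first by rewrite porbit_step.
  have hy := ofX _ yo; rewrite -{2}(g_inv G y) fXE // (side_del sL hy).2.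
  by case/and3P: hy => _ _ /eqP; rewrite (g_inv G) => ->; rewrite prev_next.
have [||||h hX hS] := color_submap M (X := X) (S' := [set v in p]) (g0 := g) eX.
- by exists d2 => //; rewrite inE negb_or d2L.
- rewrite pE; right; exists (e k0) => //.
  have kX : e k0 \in X by apply: eX; rewrite inE (kL _ h0).1.
  by rewrite live_del // (liveE G) l0 kX.
- by apply: leq_trans sp12; rewrite cardsE card_size.
- move=> x lx _; rewrite !inE => xp exp; apply: gX => //.
  by rewrite inE; apply/andP; split; apply: contraL (Ip _) _ => //; rewrite negbK.
apply: (mc_no M (f := fun u => if u \in I then h u else g u)); last first.
  by move=> u uS; rewrite (negbTE (SI _ uS)) gS.
have key x : live x -> org x \in I -> x \in X /\ (if org (e x) \in I then h (org (e x)) else g (org (e x))) = h (org (e x)).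
  move=> lx xI; have xL := IL _ lx xI; split; first by rewrite inE xL.
  case: ifP => // /negbT exI; apply/esym/hS; rewrite inE; apply: contraT => exp.
  by case/negP: exI; rewrite IP ?(liveE G) // (side_e sL) // Ip.
move=> x lx; have [xI|xI] := boolP (org x \in I).
  by have [xX ->] := key _ lx xI; apply: hX.
have [exI|exI] := boolP (org (e x) \in I).
  have lex : live (e x) by rewrite (liveE G).
  have [xX] := key _ lex exI; rewrite (g_inv G) (negbTE xI) => ->.
  by apply: hX => //; rewrite -(g_inv G x); apply: eX.
by apply: gX => //; rewrite inE xI.
Qed.

(** A face lies entirely on one side of the cycle, so one of the two sides has no vertex of [S] in
    its interior; reversing the cycle exchanges the sides. *)
Lemma short_cycle_not_separating p L : ucycle adj p -> 2 < size p <= 12 -> cycle_side p L ->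
  (exists2 d, live d & (d \in L) && (org d \notin p)) ->
  (exists2 d, live d & (d \notin L) && (org d \notin p)) -> False.
Proof.
move=> cp sp sL ex1 ex2; have up : uniq p by case/andP: cp.
have nk d : org d \notin p -> ~~ cycle_dart p (e d) /\ ~~ cycle_dart p d.
  move=> h; split; apply: contra h => hk; first by have := cycle_dart_head hk; rewrite (g_inv G).
  by case/and3P: hk.
have cr : ucycle adj (rev p).
  rewrite /ucycle rev_uniq up andbT rev_cycle.
  have /andP[h _] := cp; apply: sub_cycle h => a b; by rewrite (adjm_sym G).
have sr : 2 < size (rev p) <= 12 by rewrite size_rev.
have goL : (forall d, d \in L -> live d -> org d \in S -> org d \in p) -> False.
  move=> H; apply: (short_cycle_side cp sp sL H ex1).
  by case: ex2 => d ld /andP[dL dp]; exists d => //; rewrite dL (nk _ dp).1.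
have goR : (forall d, d \notin L -> live d -> org d \in S -> org d \in p) -> False.
  move=> H; apply: (short_cycle_side cr sr (side_rev G up sL)).
  - by move=> d; rewrite inE mem_rev; apply: H.
  - by case: ex2 => d ld /andP[dL dp]; exists d => //; rewrite inE dL mem_rev.
  - case: ex1 => d ld /andP[dL dp]; exists d => //; rewrite inE negbK dL (cycle_dart_rev G) //.
    by rewrite (g_inv G) (nk _ dp).2.
have conf d d' : d \in L -> live d -> org d \notin p -> d' \notin L -> live d' ->
    org d = org d' -> False.
  by move=> dL ld dp dL' ld' oo; move: dL'; rewrite (side_node sL ld ld') // dL.
case: (mc_S M) => [S1|[s ls SE]].
  case: (boolP [exists d, [&& d \in L, live d, org d \in S & org d \notin p]]).
    case/existsP=> d /and4P[dL ld dS dp]; apply: goR => d' dL' ld' dS'.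
    apply: contraT => _; exfalso; apply: (conf _ _ dL ld dp dL' ld').
    exact: (card_le1_eqP S1).
  move=> /existsPn H; apply: goL => d dL ld dS; have := H d.
  by rewrite dL ld dS /= negbK.
have [fL _ _] := sL.
have sC : forall x, x \in porbit f s -> (x \in L) = (s \in L).
  by apply: (porbit_ind (P := fun x => (x \in L) = (s \in L))) => // z; rewrite fL.
have [s_L|s_L] := boolP (s \in L).
  apply: goR => d dL ld dS; apply: contraT => dp; exfalso.
  move: dS; rewrite SE => /imsetP[x xs ox].
  have lx : live x by rewrite (live_porbit_f G xs).
  by apply: (conf x d) => //; rewrite ?(sC _ xs) // -ox.
apply: goL => d dL ld dS; apply: contraT => dp; exfalso.
move: dS; rewrite SE => /imsetP[x xs ox].
have lx : live x by rewrite (live_porbit_f G xs).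
by apply: (conf d x) => //; rewrite ?(sC _ xs).
Qed.

End Sep.

(** * Faces of a minimal counterexample *)

Lemma fconnect_porbit (T : finType) (s : {perm T}) x y : fconnect s x y = (y \in porbit s x).
Proof.
apply/idP/idP.
  case/connectP=> p + ->; elim/last_ind: p => [|p z IH] /=; first by rewrite porbit_id.
  by rewrite rcons_path last_rcons => /andP[/IH h /eqP<-]; rewrite porbit_step.
by apply: porbit_connect => z; apply: fconnect1.
Qed.

Lemma order_porbit (T : finType) (s : {perm T}) x : fingraph.order s x = #|porbit s x|.
Proof. by apply: eq_card => y; rewrite inE fconnect_porbit. Qed.

Lemma porbit1 (T : finType) (s : {perm T}) x : s x = x -> porbit s x = [set x].
Proof.
move=> sx; apply/setP=> y; rewrite inE; apply/idP/eqP => [|->]; last exact: porbit_id.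
by move: y; apply: (porbit_ind (P := fun y => y = x)) => // z ->.
Qed.

Section Faces.
Variables (D V : finType).
Implicit Types (d x y : D) (u v : V) (X A : {set D}).
Variables (e n : {perm D}) (org : D -> V) (R : D -> rel 'I_3).
Variables (S : {set V}) (f0 : V -> 'I_3).
Hypothesis M : mincex e n org R S f0.
Let G := mc_good M.
Local Notation f := (e * n)%g.
Local Notation live := (alive e).
Local Notation adj := (adjm e org).

Lemma same_face d d' : live d -> org d' = org d -> d' \in porbit f d -> d' = d.
Proof.
move=> ld od df; apply/esym; apply: (face_simple M ld) => //.
by rewrite (mem_porbit_n G) // (live_porbit_f G df) ld od eqxx.
Qed.

(** At a vertex of degree 1 the face goes to and fro along the edge. As it meets the other end only
    once, that end has degree 1 too. Both ends must belong to [S], so [S] consists of them and no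
    edge leaves it. *)
Lemma n_neq d : live d -> n d != d.
Proof.
move=> ld; apply/negP=> /eqP nd.
have led : live (e d) by rewrite (liveE G).
have fed : f (e d) = d by rewrite (f_e G).
have ned : n (e d) = e d.
  apply: same_face => //; first by rewrite (g_org G).
  have h : d \in porbit f (e d) by rewrite -{1}fed porbit_step porbit_id.
  by rewrite -(fE e n) porbit_step.
have dS : org d \in S.
  by apply: contraT => /(deg_ge3 M ld); rewrite porbit1 // cards1.
have edS : org (e d) \in S.
  by apply: contraT => /(deg_ge3 M led); rewrite porbit1 // cards1.
case: (mc_S M) => [S1|[s ls SE]].
  by have := g_loop G ld; rewrite (card_le1_eqP S1 _ _ dS edS) eqxx.
have fd : f d = e d by rewrite fE ned.
have P x : x \in porbit f d -> (x == d) || (x == e d).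
  move: x; apply: (porbit_ind (P := fun x => (x == d) || (x == e d))).
    by rewrite eqxx.
  by move=> z /orP[] /eqP->; rewrite ?fed ?fd eqxx ?orbT.
have sd : porbit f s = porbit f d.
  have dfed : e d \in porbit f d by rewrite -fd porbit_step porbit_id.
  case/orP: (S_chord M ls SE ld dS edS); rewrite -eq_porbit_mem => /eqP <- //.
  by apply/eqP; rewrite eq_porbit_mem.
have [x [lx xS nxS]] := S_exit M ls SE; move/negP: nxS; apply.
have /imsetP[z /P] : org x \in [set org y | y in porbit f d] by rewrite -sd -SE.
case/orP=> /eqP-> ox.
  have : x \in porbit n d by rewrite (mem_porbit_n G) // lx ox eqxx.
  by rewrite porbit1 // inE => /eqP->; rewrite edS.
have : x \in porbit n (e d) by rewrite (mem_porbit_n G) // lx ox eqxx.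
by rewrite porbit1 // inE => /eqP->; rewrite (g_inv G) dS.
Qed.

Lemma face_ucycle d : live d -> ucycle adj (map org (fingraph.orbit f d)).
Proof.
move=> ld; apply/andP; split.
  rewrite cycle_map; have := fingraph.cycle_orbit (@perm_inj _ f) d.
  apply: (sub_in_cycle (P := live)).
    move=> x y lx ly /eqP <- /=; rewrite (org_f G); exact: adjm_live.
  by apply/allP=> x; rewrite -fconnect_orbit fconnect_porbit => /(live_porbit_f G) h; rewrite /= h.
rewrite map_inj_in_uniq ?orbit_uniq // => x y.
rewrite -!fconnect_orbit !fconnect_porbit => xd yd oxy.
apply: same_face => //; first by rewrite (live_porbit_f G yd).
by move: yd; rewrite -eq_porbit_mem => /eqP->.
Qed.

Lemma size_face_orbit d : size (map org (fingraph.orbit f d)) = #|porbit f d|.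
Proof. by rewrite size_map size_orbit order_porbit. Qed.

Lemma face_gt2 d : live d -> 2 < #|porbit f d|.
Proof.
move=> ld; rewrite ltnNge; apply/negP=> le2.
have fd : f d != d.
  by apply: contraTneq (g_loop G ld) => E; rewrite -(org_f G) E eqxx.
have ffd : f (f d) = d.
  have := iter_porbit f d; have := card_porbit_neq0 f d.
  case: #|_| le2 => [|[|[|k]]] //= _ _ E.
  by rewrite E eqxx in fd.
have E : f d = e d.
  apply: (g_simple G); rewrite ?(live_f G) ?(liveE G) ?(org_f G) //.
  by rewrite -(org_f G) ffd (g_inv G).
by have := n_neq (d := e d); rewrite (liveE G) -fE E eqxx => /(_ ld).
Qed.

Lemma face_len d : live d -> #|porbit f d| != 3 -> 8 < #|porbit f d|.
Proof.
move=> ld n3; have := face_gt2 ld; have := @g_cyc _ _ _ _ _ _ G _ (face_ucycle ld).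
rewrite size_face_orbit; lia.
Qed.

Lemma card_face d : live d -> #|[set org x | x in porbit f d]| = #|porbit f d|.
Proof.
move=> ld; rewrite card_in_imset // => x y xd yd oxy; apply: same_face => //.
  by rewrite (live_porbit_f G yd).
by move: yd; rewrite -eq_porbit_mem => /eqP->.
Qed.

(** The shorter of the two arcs of a cycle of length at most 12. *)
Lemma S_short_path u v : u \in S -> v \in S -> u != v -> exists q, [/\ path adj u q,
  last u q = v, uniq (u :: q), size q <= 6 & {subset q <= S}].
Proof.
move=> uS vS uv; case: (mc_S M) => [S1|[s ls SE]].
  by rewrite (card_le1_eqP S1 _ _ uS vS) eqxx in uv.
have /andP[cy un] := face_ucycle ls; set p := map _ _ in cy un.
have pS w : (w \in p) = (w \in S).
  rewrite SE; apply/mapP/imsetP => -[x xo ->]; exists x => //;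
    by move: xo; rewrite -fconnect_orbit fconnect_porbit.
have sp : size p <= 12 by have := mc_12 M; rewrite SE card_face // size_face_orbit.
have up : u \in p by rewrite pS.
have [i r rE] := rot_to up.
have cy' : path.cycle adj (u :: r) by rewrite -rE rot_cycle.
have un' : uniq (u :: r) by rewrite -rE rot_uniq.
have sr : size r <= 11 by rewrite -ltnS -(size_rot i p) rE in sp.
have rS w : w \in u :: r -> w \in S by rewrite -rE mem_rot pS.
have vr : v \in r.
  have : v \in u :: r by rewrite -rE mem_rot pS.
  by rewrite inE eq_sym (negbTE uv).
case/splitPr: vr cy' un' sr rS => r1 r2 /= cy' un' sr rS.
rewrite rcons_cat cat_path /= in cy'; case/and3P: cy' => pa1 pa2 pa3.
case: (leqP (size r1) 5) => sr1.
  exists (rcons r1 v); rewrite rcons_path pa1 pa2 last_rcons size_rcons ltnS sr1; split => //.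
    move: un'; rewrite -cat_rcons cat_uniq mem_cat negb_or => /andP[/andP[-> _]].
    by case/and3P.
  by move=> w wr; apply: rS; rewrite -cat_rcons inE mem_cat wr orbT.
have {}pa3 : path adj u (rcons (rev r2) v).
  have := rev_path adj v (rcons r2 u); rewrite last_rcons belast_rcons rev_cons => ->.
  by apply: sub_path pa3 => a b; rewrite (adjm_sym G).
exists (rcons (rev r2) v); split => //; rewrite ?last_rcons //.
- rewrite -rev_cons /= mem_rev rev_uniq.
  move: un'; rewrite cat_uniq mem_cat negb_or => /andP[/andP[_ ->]].
  by case/and3P.
- rewrite size_rcons size_rev; rewrite size_cat /= addnS ltnS in sr.
  rewrite ltnS -(leq_add2l 6) (leq_trans _ (leq_trans sr _)) //.
  by rewrite leq_add2r.
- by move=> w; rewrite -rev_cons mem_rev => wr; apply: rS; rewrite inE mem_cat wr !orbT.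
Qed.

End Faces.

(** * Tetrads *)

Definition partial_inj (T : Type) (Q : rel T) :=
  (forall a b b', Q a b -> Q a b' -> b = b') /\ (forall a a' b, Q a b -> Q a' b -> a = a').

(** Pairs are added one at a time: the image is no larger than the domain, so a point without a
    partner leaves some value free. *)
Lemma partial_inj_perm (T : finType) (Q : rel T) : partial_inj Q ->
  exists s : {perm T}, forall a b, Q a b -> s a = b.
Proof.
have [k] := ubnP #|[set a | ~~ [exists b, Q a b]]|; elim: k Q => // k IH Q lek [Q1 Q2].
have [a0 a0P|tot] := pickP [pred a | ~~ [exists b, Q a b]]; last first.
  have ex a : exists b, Q a b by apply/existsP; have /= /negbFE := tot a.
  have [g gP] := fin_all_exists ex.
  have gi : injective g by move=> a a' E; apply: (Q2 _ _ (g a)); rewrite // E.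
  by exists (perm gi) => a b /(Q1 _ _ _ (gP a)) <-; rewrite permE.
have [b0 b0P] : exists b0, forall a, ~~ Q a b0.
  pose dom := [set a | [exists b, Q a b]]; pose im := [set b | [exists a, Q a b]].
  have le : #|im| <= #|dom|.
    pose g a := odflt a [pick b | Q a b].
    apply: leq_trans (leq_imset_card g dom); apply: subset_leq_card.
    apply/subsetP=> b; rewrite inE => /existsP[a ab]; apply/imsetP; exists a.
      by rewrite inE; apply/existsP; exists b.
    by rewrite /g; case: pickP => [b' /Q1/(_ ab)->//|/(_ b)]; rewrite ab.
  have : 0 < #|~: im|.
    have : 0 < #|~: dom| by apply/card_gt0P; exists a0; rewrite !inE.
    by have := cardsC im; have := cardsC dom; lia.
  by case/card_gt0P=> b; rewrite !inE => /existsPn h; exists b.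
pose Q' a b := Q a b || (a == a0) && (b == b0).
have a0Q b : Q a0 b = false by have /existsPn/(_ b)/negbTE := a0P.
have [||s sP] := IH Q'; last by exists s => a b ab; apply: sP; rewrite /Q' ab.
- rewrite -ltnS; apply: leq_trans lek; apply: proper_card; apply/properP; split.
    apply/subsetP=> a; rewrite !inE; apply: contra => /existsP[b ab].
    by apply/existsP; exists b; rewrite /Q' ab.
  exists a0; rewrite !inE // negbK; apply/existsP; exists b0.
  by rewrite /Q' !eqxx orbT.
- split=> [a b b'|a a' b] /orP[h|/andP[/eqP ? /eqP ?]] /orP[h'|/andP[/eqP ? /eqP ?]]; subst=> //.
  + exact: Q1 h h'.
  + by rewrite a0Q in h.
  + by rewrite a0Q in h'.
  + exact: Q2 h h'.
  + by rewrite (negbTE (b0P _)) in h.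
  + by rewrite (negbTE (b0P _)) in h'.
Qed.

Lemma third_color (a b : 'I_3) : exists c : 'I_3, (c != a) && (c != b).
Proof.
have : 0 < #|~: [set a; b]|.
  by have := cardsC [set a; b]; rewrite cards2 card_ord; case: (a != b) => /=; lia.
by case/card_gt0P=> c; rewrite !inE negb_or; exists c.
Qed.

(** One vertex loses r and [e1], the other q and [e2]. If both are left with a single color, the
    further forbidden color is common, and the remaining colors are q and r, which differ. *)
Lemma pair_color (r q : 'I_3) (e1 e2 : option 'I_3) : r != q ->
  (forall a b, e1 = Some a -> e2 = Some b -> a = b) ->
  exists z1 z2, [/\ z1 != r, e1 <> Some z1, z2 != q, e2 <> Some z2 & z1 != z2].
Proof.
move=> rq; case: e1 => [a|] H; last first.
  have [z2 /andP[h1 h2]] := third_color q (odflt q e2).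
  have [z1 /andP[h3 h4]] := third_color r z2.
  exists z1, z2; split=> //.
  by case: e2 H h2 => //= b _ h2 [E]; rewrite E eqxx in h2.
case: e2 H => [b|] H; last first.
  have [z1 /andP[h1 h2]] := third_color r a.
  have [z2 /andP[h3 h4]] := third_color q z1.
  exists z1, z2; split=> //; last by rewrite eq_sym.
  by move=> [E]; rewrite E eqxx in h2.
have {b H} <- := H a b erefl erefl.
have [ar|ar] := eqVneq a r.
  have [z2 /andP[h1 h2]] := third_color q a.
  have [z1 /andP[h3 h4]] := third_color r z2.
  by exists z1, z2; split=> // -[E]; rewrite -?E -?ar ?E eqxx in h2 h3.
have [aq|aq] := eqVneq a q.
  have [z1 /andP[h1 h2]] := third_color r a.
  have [z2 /andP[h3 h4]] := third_color q z1.
  exists z1, z2; split=> //; last by rewrite eq_sym.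
    by move=> [E]; rewrite E eqxx in h2.
  by move=> [E]; rewrite -aq E eqxx in h3.
exists q, r; split=> //; try by rewrite eq_sym.
  by move=> [E]; rewrite E eqxx in aq.
by move=> [E]; rewrite E eqxx in ar.
Qed.

(** * Coloring the four vertices of a tetrad *)

Section TetradColor.
Variables Rb Rc0 Rc1 Rc2 Rc3 Rg Rh Rx Rw : rel 'I_3.
Hypotheses (ib : partial_inj Rb) (i0 : partial_inj Rc0) (i1 : partial_inj Rc1) (i2 : partial_inj Rc2) (i3 : partial_inj Rc3)
  (ig : partial_inj Rg) (ih : partial_inj Rh) (ix : partial_inj Rx) (iw : partial_inj Rw).
Hypothesis tri1 : forall z1 z2 c z, Rc0 z1 z2 -> Rx z1 c -> Rw c z -> z2 = z.
Hypothesis tri2 : forall z1 z2 c z, Rc0 z1 z2 -> Rx z c -> Rw c z2 -> z1 = z.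

Lemma pick_color (P Q : pred 'I_3) : (forall a b, P a -> P b -> a = b) ->
  (forall a b, Q a -> Q b -> a = b) -> exists c, ~~ P c && ~~ Q c.
Proof.
move=> HP HQ; have [c /andP[h1 h2]] := third_color (odflt ord0 [pick a | P a]) (odflt ord0 [pick a | Q a]).
exists c; apply/andP; split.
  apply: contra h1 => Pc; case: pickP => [a Pa|/(_ c)] /=; last by rewrite Pc.
  by rewrite (HP _ _ Pa Pc).
apply: contra h2 => Pc; case: pickP => [a Pa|/(_ c)] /=; last by rewrite Pc.
by rewrite (HQ _ _ Pa Pc).
Qed.

(* Transport the color of v0 along v0 v1 v2 v3 to y, where v1 v2 is straightened
   through the common neighbour x.  Then v3 can avoid the transported color, and
   this is exactly what v1 and v2 need. *)
Lemma tetrad_color : exists pi : {perm 'I_3}, forall a b cx, exists z1 z2 z3 z4,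
  [/\ [/\ ~~ Rb a z1, ~~ Rx z1 cx & ~~ Rc0 z1 z2], [/\ ~~ Rw cx z2, ~~ Rc1 z2 z3 & ~~ Rc2 z3 z4],
      ~~ Rg z3 (pi a), ~~ Rh (pi a) z4 & ~~ Rc3 z4 b].
Proof.
have [s1 S1] := partial_inj_perm ib.
(* Consistency on the triangle prevents the edge v1 v2 and the path v1 x v2 from contradicting each
   other, so one permutation extends both correspondences. *)
pose Q z1 z2 := Rc0 z1 z2 || [exists c, Rx z1 c && Rw c z2].
have [|s2 S2] := @partial_inj_perm _ Q.
  split=> [z z' z''|z z' z''] /orP[h|/existsP[c /andP[h k]]] /orP[h'|/existsP[c' /andP[h' k']]].
  - exact: i0.1 h h'.
  - exact: tri1 h h' k'.
  - by apply/esym; apply: tri1 h' h k.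
  - by have E := ix.1 _ _ _ h h'; subst c'; apply: iw.1 k k'.
  - exact: i0.2 h h'.
  - exact: tri2 h h' k'.
  - by apply/esym; apply: tri2 h' h k.
  - by have E := iw.2 _ _ _ k k'; subst c'; apply: ix.2 h h'.
have [s3 S3] := partial_inj_perm i1.
have [s4 S4] := partial_inj_perm ig.
exists (s1 * s2 * s3 * s4)%g => a b cx.
set pa := (_ * s4)%g a; pose W := s3 (s2 (s1 a)).
have paE : pa = s4 W by rewrite /pa !permM.
have [z4 /andP[h4 k4]] : exists c, ~~ Rh pa c && ~~ Rc3 c b.
  apply: pick_color; [exact: ih.1|move=> c c'; exact: i3.2].
(* Avoiding [W] serves twice: the edge v3 y is safe because y has color [s4 W], and the colors r and
   q that v0 and v3 forbid, both read at v2, become different. *)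
have [z3 /andP[h3 k3]] : exists c, ~~ (c == W) && ~~ Rc2 c z4.
  by apply: pick_color => [c c' /eqP-> /eqP->|c c']; [|exact: i2.2].
have nW : ~~ Rg z3 pa.
  by apply: contra h3 => /S4; rewrite paE => /perm_inj->.
pose r := s2 (s1 a); pose q := (s3^-1)%g z3.
have rq : r != q.
  by apply: contra h3 => /eqP E; rewrite /W -/r E permKV.
(* [z1'] is the color of v1 carried over to v2 by [s2]; in these terms a conflict on v1 v2 would
   mean equality. *)
have [|z1' [z2 [p1 p2 p3 p4 p5]]] := pair_color (r := r) (q := q)
    (e1 := omap s2 [pick z | Rx z cx]) (e2 := [pick z | Rw cx z]) rq.
  case: pickP => //= z hz z' z'' [<-]; case: pickP => // z2 hz2 [<-].
  by apply: S2; apply/orP; right; apply/existsP; exists cx; rewrite hz hz2.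
pose z1 := (s2^-1)%g z1'.
have z1E : s2 z1 = z1' by rewrite permKV.
exists z1, z2, z3, z4; split=> //; split=> //.
- by apply: contra p1 => /S1 E; rewrite -z1E /r E.
- apply/negP=> h; apply: p2; case: pickP => [z hz|/(_ z1)]; last by rewrite h.
  by rewrite (ix.2 _ _ _ hz h) /= z1E.
- apply: contra p5 => h; rewrite -z1E; apply/eqP; apply: S2; by rewrite /Q h.
- apply/negP=> h; apply: p4; case: pickP => [z hz|/(_ z2)]; last by rewrite h.
  by rewrite (iw.1 _ _ _ hz h).
- by apply: contra p3 => /S3 E; rewrite /q -E permK.
Qed.
End TetradColor.

Lemma porbit3 (T : finType) (s : {perm T}) x : #|porbit s x| = 3 ->
  [/\ s (s (s x)) = x, uniq [:: x; s x; s (s x)] &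
      forall y, y \in porbit s x -> y \in [:: x; s x; s (s x)]].
Proof.
move=> E; have := iter_porbit s x; have := uniq_traject_porbit s x.
have h := porbit_traject s x; rewrite E /= in h *; split=> // y.
by rewrite h.
Qed.

Lemma size_ge9 a : (4 <= a.+4 <= 8 -> False) -> 4 < a.
Proof. lia. Qed.

Lemma size_gt8 a b : 4 < a -> 6 < b -> a + b.+1 <= 8 -> False.
Proof. lia. Qed.

Lemma size48 a : 3 <= a.+1 <= 7 -> 4 <= a.+2 <= 8.
Proof. lia. Qed.

(** * A tetrad in the minimal counterexample *)

Section Tetrad.
Variables (D V : finType).
Implicit Types (d : D) (u v : V).
Variables (e n : {perm D}) (org : D -> V) (R : D -> rel 'I_3).
Variables (S : {set V}) (f0 : V -> 'I_3).
Hypothesis M : mincex e n org R S f0.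
Let G := mc_good M.
Local Notation f := (e * n)%g.
Local Notation live := (alive e).
Local Notation adj := (adjm e org).

Lemma no_cycle4 (a b c d : V) : adj a b -> adj b c -> adj c d -> adj d a ->
  uniq [:: a; b; c; d] -> False.
Proof.
move=> h1 h2 h3 h4 u; apply: (@g_cyc _ _ _ _ _ _ G [:: a; b; c; d]) => //.
by rewrite /ucycle u andbT /= h1 h2 h3 h4.
Qed.

(* The face runs along b, c0, c1, c2, c3, starting at v0, v1, v2, v3, v4; the triangular
   faces are (e c0, x0, w0) and (e c2, g0, h0), so x0, w0 pass through x and g0, h0
   through y. *)
Variable c0 : D.
Let b := (f^-1)%g c0.
Let c1 := f c0.
Let c2 := f c1.
Let c3 := f c2.
Let x0 := n c0.
Let w0 := f x0.
Let g0 := n c2.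
Let h0 := f g0.
Hypothesis lc0 : live c0.
Hypothesis nS : forall c, c \in [:: c0; c1; c2; c3] -> org c \notin S.
Hypothesis deg3 : forall c, c \in [:: c0; c1; c2; c3] -> #|porbit n c| = 3.
Hypothesis tri1 : #|porbit f (e c0)| = 3.
Hypothesis tri2 : #|porbit f (e c2)| = 3.
Hypothesis len : 8 < #|porbit f c0|.

Let v0 := org b.
Let v1 := org c0.
Let v2 := org c1.
Let v3 := org c2.
Let v4 := org c3.
Let v5 := org (e c3).
Let x := org w0.
Let y := org h0.
Let vs := [:: v1; v2; v3; v4].

Let lb : live b. Proof. by rewrite /b (live_fV G). Qed.
Let lc1 : live c1. Proof. by rewrite /c1 (live_f G). Qed.
Let lc2 : live c2. Proof. by rewrite /c2 (live_f G). Qed.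
Let lc3 : live c3. Proof. by rewrite /c3 (live_f G). Qed.
Let lx0 : live x0. Proof. by rewrite /x0 (live_n G). Qed.
Let lw0 : live w0. Proof. by rewrite /w0 (live_f G). Qed.
Let lg0 : live g0. Proof. by rewrite /g0 (live_n G). Qed.
Let lh0 : live h0. Proof. by rewrite /h0 (live_f G). Qed.

Let fb : f b = c0. Proof. by rewrite /b permKV. Qed.
Let feb : n (e b) = c0. Proof. by rewrite -(fE e n). Qed.
Let fw0 : n (e w0) = e c0.
Proof.
have [E _ _] := porbit3 tri1; rewrite -(fE e n) /w0 /x0 -(f_e G c0); exact: E.
Qed.
Let fh0 : n (e h0) = e c2.
Proof.
have [E _ _] := porbit3 tri2; rewrite -(fE e n) /h0 /g0 -(f_e G c2); exact: E.
Qed.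
Let nec0 : n (e c0) = c1. Proof. by rewrite -(fE e n). Qed.
Let nec1 : n (e c1) = c2. Proof. by rewrite -(fE e n). Qed.
Let nec2 : n (e c2) = c3. Proof. by rewrite -(fE e n). Qed.
Let neg0 : n (e g0) = h0. Proof. by rewrite -(fE e n). Qed.

Let nx0 : n x0 = e b.
Proof.
have [|E _ _] := @porbit3 _ n c0; first by apply: deg3; rewrite !inE eqxx.
by apply: (@perm_inj _ n); rewrite feb; exact: E.
Qed.
Let nc1 : n c1 = e w0.
Proof.
have [|E _ _] := @porbit3 _ n c1; first by apply: deg3; rewrite !inE eqxx orbT.
apply: (@perm_inj _ n); apply: (@perm_inj _ n); rewrite E fw0; exact: (esym nec0).
Qed.
Let ng0 : n g0 = e c1.
Proof.
have [|E _ _] := @porbit3 _ n c2; first by apply: deg3; rewrite !inE eqxx !orbT.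
by apply: (@perm_inj _ n); rewrite nec1; exact: E.
Qed.
Let nc3 : n c3 = e h0.
Proof.
have [|E _ _] := @porbit3 _ n c3; first by apply: deg3; rewrite !inE eqxx !orbT.
apply: (@perm_inj _ n); apply: (@perm_inj _ n); rewrite E fh0; exact: (esym nec2).
Qed.

Let node d c p q : live d -> live c -> c \in [:: c0; c1; c2; c3] -> n c = p -> n p = q ->
  org d = org c -> d \in [:: c; p; q].
Proof.
move=> ld lc cc <- <- od; have [|_ _ H] := @porbit3 _ n c; first exact: deg3.
by apply: H; apply: (g_node G).
Qed.

Let N1 d : live d -> org d = v1 -> d \in [:: c0; x0; e b].
Proof. by move=> ld od; apply: node => //; rewrite !inE eqxx. Qed.
Let N2 d : live d -> org d = v2 -> d \in [:: c1; e w0; e c0].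
Proof. by move=> ld od; apply: node => //; rewrite !inE eqxx ?orbT. Qed.
Let N3 d : live d -> org d = v3 -> d \in [:: c2; g0; e c1].
Proof. by move=> ld od; apply: node => //; rewrite !inE eqxx ?orbT. Qed.
Let N4 d : live d -> org d = v4 -> d \in [:: c3; e h0; e c2].
Proof. by move=> ld od; apply: node => //; rewrite !inE eqxx ?orbT. Qed.

Let U1 : uniq [:: c0; x0; e b].
Proof. by rewrite -nx0; case: (@porbit3 _ n c0) => //; apply: deg3; rewrite !inE eqxx. Qed.
Let U2 : uniq [:: c1; e w0; e c0].
Proof. by rewrite -fw0 -nc1; case: (@porbit3 _ n c1) => //; apply: deg3; rewrite !inE eqxx ?orbT. Qed.
Let U3 : uniq [:: c2; g0; e c1].
Proof. by rewrite -ng0; case: (@porbit3 _ n c2) => //; apply: deg3; rewrite !inE eqxx ?orbT. Qed.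

Let oeb : org (e b) = v1. Proof. by rewrite -(org_f G) fb. Qed.
Let oec0 : org (e c0) = v2. Proof. by rewrite -(org_f G). Qed.
Let oec1 : org (e c1) = v3. Proof. by rewrite -(org_f G). Qed.
Let oec2 : org (e c2) = v4. Proof. by rewrite -(org_f G). Qed.
Let ox0 : org x0 = v1. Proof. by rewrite /x0 (g_org G). Qed.
Let og0 : org g0 = v3. Proof. by rewrite /g0 (g_org G). Qed.
Let oex0 : org (e x0) = x. Proof. by rewrite -(org_f G). Qed.
Let oeg0 : org (e g0) = y. Proof. by rewrite -(org_f G). Qed.
Let oew0 : org (e w0) = v2. Proof. by rewrite -(g_org G) fw0. Qed.
Let oeh0 : org (e h0) = v4. Proof. by rewrite -(g_org G) fh0. Qed.

Let adjI d u v : live d -> org d = u -> org (e d) = v -> adj u v.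
Proof. by move=> ld <- <-; apply: adjm_live. Qed.
Let a01 : adj v0 v1. Proof. exact: (adjI lb). Qed.
Let a12 : adj v1 v2. Proof. exact: (adjI lc0). Qed.
Let a23 : adj v2 v3. Proof. exact: (adjI lc1). Qed.
Let a34 : adj v3 v4. Proof. exact: (adjI lc2). Qed.
Let a1x : adj v1 x. Proof. exact: (adjI lx0). Qed.
Let ax2 : adj x v2. Proof. exact: (adjI lw0). Qed.
Let a3y : adj v3 y. Proof. exact: (adjI lg0). Qed.
Let ay4 : adj y v4. Proof. exact: (adjI lh0). Qed.

Let vU : uniq [:: v0; v1; v2; v3; v4; v5].
Proof.
have sb : porbit f b = porbit f c0.
  by apply/eqP; rewrite eq_porbit_mem /b porbit_stepV porbit_id.
have : uniq (traject f b 6).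
  have := uniq_traject_porbit f b; rewrite sb.
  rewrite -(@subnKC 6 #|porbit f c0|); last exact: leq_trans len.
  by rewrite trajectD cat_uniq => /and3P[].
rewrite /= fb -/c1 -/c2 -/c3 => u6.
have : uniq (map org [:: b; c0; c1; c2; c3; f c3]).
  rewrite map_inj_in_uniq // => d d' hd hd' odd.
  have mem z : z \in [:: b; c0; c1; c2; c3; f c3] -> z \in porbit f c0.
    rewrite -sb !inE => /or4P[/eqP->|/eqP->|/eqP->|/or3P[/eqP->|/eqP->|/eqP->]];
    by rewrite /c3 /c2 /c1 ?porbit_step -?fb ?porbit_step porbit_id.
  apply: (same_face M) => //; first by rewrite (live_porbit_f G (mem _ hd')).
  have /eqP -> : porbit f d' == porbit f c0 by rewrite eq_porbit_mem; apply: mem.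
  exact: mem.
by rewrite /= (org_f G).
Qed.

Let neqs : [/\ [/\ v0 != v1, v0 != v2, v0 != v3 & v0 != v4],
  [/\ v1 != v2, v1 != v3 & v1 != v4], [/\ v2 != v3, v2 != v4 & v3 != v4] &
  [/\ v5 != v1, v5 != v2, v5 != v3 & v5 != v4]].
Proof.
move: vU; rewrite /= !inE !negb_or !(eq_sym v5) -!andbA.
by do ![case/andP=> ?] => *; split; split.
Qed.

Let adj_neq u v : adj u v -> u != v.
Proof. by apply: contraTneq => ->; rewrite (adjm_irr G). Qed.
Let adjC u v : adj u v = adj v u. Proof. exact: (adjm_sym G). Qed.

(** Apart from the neighbours v3 and v4, a coincidence would close a cycle of length 4 or give v3
    two darts to the same vertex. *)
Let yneq : [/\ y != v0, y != v1, y != v2, y != v3 & y != v4].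
Proof.
have [[n01 n02 n03 n04] [n12 n13 n14] [n23 n24 n34] _] := neqs.
have ny3 : y != v3 by rewrite eq_sym adj_neq.
have ny4 : y != v4 by apply: adj_neq.
split=> //.
- apply/negP=> /eqP E; apply: (no_cycle4 a01 a12 a23); first by rewrite -E.
  by rewrite /= !inE !negb_or n01 n02 n03 n12 n13 n23.
- apply/negP=> /eqP E; apply: (no_cycle4 a12 a23 a34); first by rewrite -E adjC.
  by rewrite /= !inE !negb_or n14 n24 n34 n12 n13 n23.
- apply/negP=> /eqP E; have : g0 = e c1.
    by apply: (g_simple G); rewrite ?(liveE G) ?og0 ?oec1 ?oeg0 ?(g_inv G).
  by move: U3 => /=; rewrite !inE => /and3P[_ /negP h _] E2; apply: h; rewrite E2.
Qed.

Let xneq : [/\ x != v0, x != v1, x != v2, x != v3 & x != v4] /\ x != y.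
Proof.
have [[n01 n02 n03 n04] [n12 n13 n14] [n23 n24 n34] _] := neqs.
have [ny0 ny1 ny2 ny3 ny4] := yneq.
have nx1 : x != v1 by rewrite eq_sym adj_neq.
have nx2 : x != v2 by apply: adj_neq.
split; first split=> //.
- apply/negP=> /eqP E; have : x0 = e b.
    by apply: (g_simple G); rewrite ?(liveE G) ?ox0 ?oeb ?oex0 ?(g_inv G).
  by move: U1 => /=; rewrite !inE => /and3P[_ /negP h _] E2; apply: h; rewrite E2.
- apply/negP=> /eqP E; have E2 : w0 = e c1.
    by apply: (g_simple G); rewrite ?(liveE G) ?oec1 ?oew0 ?(g_inv G).
  by move: U2 => /=; rewrite !inE negb_or E2 (g_inv G) eqxx.
- apply/negP=> /eqP E; apply: (no_cycle4 a12 a23 a34); first by rewrite -E adjC.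
  by rewrite /= !inE !negb_or n14 n24 n34 n12 n13 n23.
- apply/negP=> /eqP E; apply: (no_cycle4 a12 a23 a3y); first by rewrite -E adjC.
  by rewrite /= !inE !negb_or n12 n13 n23 !(eq_sym _ y) ny1 ny2 ny3.
Qed.

(** The separation argument assumes that x is off the path. If x is on it, the part from y to x
    closes with v2 v3, and the part from x to v0 closes with v1. Neither cycle has length 4 to 8, so
    both are long, and the path would have more than 8 edges. *)
Lemma tetrad_nopath q : path adj y q -> last y q = v0 -> uniq (y :: q) ->
  (forall u, u \in y :: q -> u \notin vs) -> size q <= 8 -> False.
Proof.
have [[n01 n02 n03 n04] [n12 n13 n14] [n23 n24 n34] _] := neqs.
have [ny0 ny1 ny2 ny3 ny4] := yneq.
have [[nx0' nx1 nx2 nx3 nx4] nxy] := xneq.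
move=> pq lq uq qvs sq; pose p := [:: v1, v2, v3, y & q].
have qn u : u \in y :: q -> [/\ u != v1, u != v2, u != v3 & u != v4].
  by move/qvs; rewrite !inE !negb_or => /and4P[].
have up : uniq p.
  have nin v : v \in vs -> v \notin y :: q by move=> vv; apply: contraL vv => /qvs.
  have h1 : v1 \notin y :: q by apply: nin; rewrite !inE eqxx.
  have h2 : v2 \notin y :: q by apply: nin; rewrite !inE eqxx orbT.
  have h3 : v3 \notin y :: q by apply: nin; rewrite !inE eqxx !orbT.
  rewrite /p cons_uniq (cons_uniq v2) (cons_uniq v3) uq h3.
  by rewrite in_cons negb_or n12 in_cons negb_or n13 h1 in_cons negb_or n23 h2.
have cp : ucycle adj p.
  by rewrite /ucycle up andbT /= a12 a23 a3y rcons_path pq lq a01.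
have sp : 2 < size p <= 12 by exact: sq.
have sp2 : 2 < size p by case/andP: sp.
have [L sL] := jordan G cp sp2; have [fL eL kL] := sL.
have v4p : v4 \notin p.
  rewrite /p (in_cons v1) (in_cons v2) (in_cons v3) (in_cons y) !(eq_sym v4) (negbTE n14) (negbTE n24) (negbTE n34) (negbTE ny4) /=.
  apply/negP=> h; have [] := qn v4; first by rewrite inE h orbT.
  by rewrite eqxx.
have kc0 : cycle_dart e org p c0.
  by rewrite /cycle_dart lc0 -/v1 oec0 /p !inE eqxx /= eqxx.
have kc1 : cycle_dart e org p c1.
  have v2p : v2 \in p by rewrite !inE eqxx orbT.
  by rewrite /cycle_dart lc1 -/v2 oec1 v2p /= (eq_sym v2 v1) (negbTE n12) !eqxx.
have [_ ec0L] := kL _ kc0; have [c1L _] := kL _ kc1.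
have c2L : c2 \in L by rewrite /c2 fL.
have ec2L : e c2 \in L.
  by rewrite -(side_e M sL) ?(g_inv G) // oec2.
have x0L : x0 \notin L by rewrite /x0 -(f_e G) fL.
have [xp|xp] := boolP (x \in p); last first.
  apply: (short_cycle_not_separating M cp sp sL); first by exists (e c2); rewrite ?(liveE G) // ec2L oec2.
  exists (e x0); rewrite ?(liveE G) // oex0 xp andbT.
  by rewrite -(side_e M sL) ?(g_inv G) // oex0.
have xq : x \in q.
  by move: xp; rewrite /p (in_cons v1) (in_cons v2) (in_cons v3) (in_cons y) (negbTE nx1) (negbTE nx2) (negbTE nx3) (negbTE nxy).
case/splitPr: xq pq lq uq qvs sq qn {p cp sp sp2 sL fL eL kL v4p kc0 kc1 ec0L c1L c2L ec2L x0L xp L up}.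
move=> q1 q2 pq lq uq qvs sq qn.
move: pq; rewrite cat_path /= => /and3P[pq1 pq2 pq3].
rewrite last_cat /= in lq.
have u1 : uniq [:: v2, v3, y & rcons q1 x].
  have nin v : v \in vs -> v \notin y :: q1 ++ x :: q2 by move=> vv; apply: contraL vv => /qvs.
  have h2 : v2 \notin y :: q1 ++ x :: q2 by apply: nin; rewrite !inE eqxx orbT.
  have h3 : v3 \notin y :: q1 ++ x :: q2 by apply: nin; rewrite !inE eqxx !orbT.
  have sub z : z \in y :: rcons q1 x -> z \in y :: q1 ++ x :: q2.
    by rewrite -cat_rcons -cat_cons mem_cat => ->.
  have h2' : v2 \notin y :: rcons q1 x by apply: contra h2; apply: sub.
  have h3' : v3 \notin y :: rcons q1 x by apply: contra h3; apply: sub.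
  move: uq; rewrite -cat_rcons -cat_cons cat_uniq => /andP[uq _].
  by rewrite cons_uniq (cons_uniq v3) uq in_cons negb_or n23 h2' h3'.
have s1 : 4 < size q1.
  have h : ucycle adj [:: v2, v3, y & rcons q1 x].
    by rewrite /ucycle u1 andbT /= a23 a3y rcons_path rcons_path pq1 pq2 last_rcons ax2.
  by have := @g_cyc _ _ _ _ _ _ G _ h; rewrite /= size_rcons; apply: size_ge9.
have u2 : uniq [:: v1, x & q2].
  have h1 : v1 \notin y :: q1 ++ x :: q2.
    apply/negP=> /qvs; by rewrite !inE eqxx.
  have h1' : v1 \notin x :: q2.
    by apply: contra h1; rewrite -cat_cons mem_cat => ->; rewrite orbT.
  move: uq; rewrite -cat_cons cat_uniq => /and3P[_ _ h2].
  by rewrite cons_uniq h1' h2.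
have s2 : 6 < size q2.
  have h : ucycle adj [:: v1, x & q2].
    by rewrite /ucycle u2 andbT /= a1x rcons_path pq3 lq a01.
  have := @g_cyc _ _ _ _ _ _ G _ h; rewrite /=.
  (* The short exceptions: an empty [q2] means x = v0, and if [q2] is v0 alone, then v0 v1 v2 x is a
     cycle of length 4. *)
  case: q2 pq3 lq u2 h {uq qvs sq qn} => [|z [|z' q2]] /= pq3 lq u2 h; last by move/size_ge9.
    by rewrite lq eqxx in nx0'.
  subst z; rewrite andbT in pq3; exfalso; apply: (no_cycle4 a01 a12 (c := v2) (d := x)) => //.
  - by rewrite adjC.
  - by rewrite /= !inE !negb_or n01 n02 n12 !(eq_sym _ x) nx0' nx1 nx2.
by move: sq; rewrite size_cat /=; apply: size_gt8 s1 s2.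
Qed.

Let y_vs : y \notin vs.
Proof. by have [a0 a1 a2 a3 a4] := yneq; rewrite !inE !negb_or a1 a2 a3 a4. Qed.
Let v0_vs : v0 \notin vs.
Proof. by have [[a1 a2 a3 a4] _ _ _] := neqs; rewrite !inE !negb_or a1 a2 a3 a4. Qed.
Let v5_vs : v5 \notin vs.
Proof. by have [_ _ _ [a1 a2 a3 a4]] := neqs; rewrite !inE !negb_or a1 a2 a3 a4. Qed.
Let x_vs : x \notin vs.
Proof. by have [[a0 a1 a2 a3 a4] _] := xneq; rewrite !inE !negb_or a1 a2 a3 a4. Qed.
Let vsS u : u \in S -> u \notin vs.
Proof.
move=> uS; apply/negP; rewrite !inE => /or4P[] /eqP E; move: uS; rewrite E; apply/negP;
  by apply: nS; rewrite !inE eqxx ?orbT.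
Qed.
Let yv0 : y != v0. Proof. by case: yneq. Qed.
Let v1_vs : v1 \in vs. Proof. by rewrite !inE eqxx. Qed.
Let v3_vs : v3 \in vs. Proof. by rewrite !inE eqxx !orbT. Qed.
Let v4_vs : v4 \in vs. Proof. by rewrite !inE eqxx !orbT. Qed.

Let X0 := ~: [set c2; e c2].
Let eX0 d : d \in X0 -> e d \in X0.
Proof. by rewrite !inE (can2_eq (g_inv G) (g_inv G)) (inj_eq perm_inj) orbC. Qed.
Let X0I d : org d \notin [:: v3; v4] -> d \in X0.
Proof.
rewrite !inE !negb_or => /andP[a b']; apply/andP; split.
  by apply: contraNneq a => ->.
by apply: contraNneq b' => ->; rewrite oec2.
Qed.
Let X0vs d : org d \notin vs -> d \in X0.
Proof. by move=> h; apply: X0I; apply: contra h; rewrite !inE => /orP[] ->; rewrite ?orbT. Qed.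
Let e2 := del e X0.
Let n2 := del n X0.
Let G2 : plane_map e2 n2 org R := plane_map_del G eX0.
Let e2E d : d \in X0 -> e2 d = e d. Proof. exact: delE. Qed.
Let n2E d : d \in X0 -> n d \in X0 -> n2 d = n d. Proof. exact: del_id. Qed.

(* Once the edge v3 v4 is deleted, v0 and y lie on a common face and can be merged. *)
Let f2_h0 : h0 \in porbit (e2 * n2)%g b.
Proof.
have [[n01 n02 n03 n04] [n12 n13 n14] [n23 n24 n34] _] := neqs.
have [ny0 ny1 ny2 ny3 ny4] := yneq.
have bX : b \in X0 by apply: X0vs.
have c0X : c0 \in X0 by apply: X0I; rewrite !inE !negb_or n13 n14.
have c1X : c1 \in X0 by apply: X0I; rewrite !inE !negb_or n23 n24.
have h0X : h0 \in X0 by apply: X0vs.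
have g0X : g0 \in X0.
  rewrite !inE negb_or; apply/andP; split.
    by move: U3 => /=; rewrite inE negb_or eq_sym => /andP[/andP[]].
  by apply: contraTneq n34 => E; rewrite -og0 E oec2 eqxx.
have s1 : (e2 * n2)%g b = c0 by rewrite permM (e2E bX) n2E ?feb ?eX0.
have s2 : (e2 * n2)%g c0 = c1 by rewrite permM (e2E c0X) n2E ?nec0 ?eX0.
have s3 : (e2 * n2)%g c1 = g0.
  rewrite permM (e2E c1X); have ec1X := eX0 c1X.
  have : n2 (e c1) = c2 \/ n2 (e c1) = g0.
    apply: (del_skip (P := fun z => z = c2 \/ z = g0)) => //; last by rewrite nec1; left.
    move=> z zX [E|E]; last by rewrite E g0X in zX.
    by right; rewrite E.
  case=> // E; have := del_mem n ec1X; rewrite -/n2 E !inE eqxx //.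
have s4 : (e2 * n2)%g g0 = h0 by rewrite permM (e2E g0X) n2E ?neg0 ?eX0.
by rewrite -s4 -s3 -s2 -s1 !porbit_step porbit_id.
Qed.

(** [b] starts at v0 and [h0] at y, so multiplication by [t] joins the two rotations into one. The
    other edges at the tetrad are deleted only afterwards, which keeps the map planar. *)
Let t := tperm b h0.
Let n3 := (n2 * t)%g.
Let b_n2 : b \notin porbit n2 h0.
Proof. by apply/negP=> /(org_porbit G2) /eqP; rewrite -/v0 -/y eq_sym (negbTE yv0). Qed.
Let pl3 : planar e2 n3.
Proof. by apply: planar_merge_r (g_planar G2) b_n2 _; rewrite porbit_sym. Qed.

Let b_n3 : b \in porbit n3 h0.
Proof.
have := b_n2; rewrite -porbitV => /porbit_tperm_merge.
by rewrite -porbitV invMg tpermV invgK.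
Qed.
Let n2_n3 d d' : d' \in porbit n2 d -> d' \in porbit n3 d.
Proof.
move: d'; apply: (porbit_ind (P := fun d' => d' \in porbit n3 d)); first exact: porbit_id.
move=> z; rewrite -(porbit_step n3) permM /t; case: tpermP => [->|->|_ _ //].
  by rewrite !(porbit_sym _ _ d); move: b_n3; rewrite -eq_porbit_mem => /eqP->.
by rewrite !(porbit_sym _ _ d); move: b_n3; rewrite -eq_porbit_mem => /eqP->.
Qed.

Let X3 := [set d | (org d \notin vs) && (org (e d) \notin vs)].
Let X30 d : d \in X3 -> d \in X0.
Proof. by rewrite inE => /andP[h _]; apply: X0vs. Qed.
Let eX3 d : d \in X3 -> e2 d \in X3.
Proof. by move=> h; rewrite e2E ?X30 //; move: h; rewrite !inE (g_inv G) andbC. Qed.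
Let e4 := del e2 X3.
Let n4 := del n3 X3.
Let e4E d : d \in X3 -> e4 d = e d.
Proof. by move=> h; rewrite /e4 delE // e2E // X30. Qed.
Let eX3' d : d \in X3 -> e d \in X3.
Proof. by rewrite !inE (g_inv G) andbC. Qed.
Let live4 d : alive e4 d = (d \in X3) && live d.
Proof.
rewrite /e4 live_del //; case: (boolP (d \in X3)) => //= h.
by rewrite /alive e2E // X30.
Qed.

(** * The map with v0 and y identified *)

Section Merge.
Variable pi : {perm 'I_3}.
Let h u := if u == y then v0 else u.
(** Color p of the merged vertex stands for p at v0 and for [pi p] at y. *)
Let sg u : {perm 'I_3} := if u == y then pi else 1%g.
Let org4 d := h (org d).
Let R4 d : rel 'I_3 := fun p q => R d (sg (org d) p) (sg (org (e d)) q).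

Let hE u w : h u = h w -> u = w \/ ((u = y /\ w = v0) \/ (u = v0 /\ w = y)).
Proof.
rewrite /h; case: (u =P y) => [->|_]; by case: (w =P y) => [->|_]; auto.
Qed.
Let h_nv0 u : h u != v0 -> h u = u /\ u != y.
Proof. by rewrite /h; case: (eqVneq u y) => // _; rewrite eqxx. Qed.
Let h_v0 u : h u = v0 -> u = v0 \/ u = y.
Proof. by rewrite /h; case: (u =P y); auto. Qed.

Let hy : h y = v0. Proof. by rewrite /h eqxx. Qed.
Let hv0 : h v0 = v0. Proof. by rewrite /h; case: eqP. Qed.

Let adjX d : live d -> adj (org d) (org (e d)). Proof. exact: adjm_live. Qed.

Let no_v0y : adj y v0 = false.
Proof.
apply/negbTE; apply/negP => a; apply: (@tetrad_nopath [:: v0]) => //.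
- by rewrite /= a.
- by rewrite /= inE yv0.
- by move=> u; do 2![rewrite in_cons => /predU1P[-> //|]].
Qed.

Let no_2 w : adj y w -> adj w v0 -> w \notin vs -> False.
Proof.
move=> a b' wv; apply: (@tetrad_nopath [:: w; v0]) => //.
- by rewrite /= a b'.
- by rewrite /= !inE negb_or yv0 (adj_neq a) (adj_neq b').
- by move=> u; do 3![rewrite in_cons => /predU1P[-> //|]].
Qed.

Let loop4 d : live d -> org4 d != org4 (e d).
Proof.
move=> ld; apply/negP=> /eqP /hE [E|[[E E']|[E E']]].
- by have := g_loop G ld; rewrite E eqxx.
- by have := adjX ld; rewrite E E' no_v0y.
- by have := adjX ld; rewrite E E' adjC no_v0y.
Qed.

Let simple4 d d' : live d -> live d' -> d \in X3 -> org d != org d' ->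
  org4 d = org4 d' -> org4 (e d) = org4 (e d') -> False.
Proof.
move=> ld ld' dX nd od oed.
have lo := loop4 ld; have lo' := loop4 ld'.
have od0 : org4 d = v0 by case: (hE od) nd => [->|[[E _]|[E _]]]; rewrite ?eqxx // /org4 E ?hy ?hv0.
have [|hn wy] := @h_nv0 (org (e d)); first by rewrite -/(org4 _) eq_sym -od0.
have [|hn' wy'] := @h_nv0 (org (e d')); first by rewrite -/(org4 _) eq_sym -od0 od.
have ww : org (e d) = org (e d') by rewrite -hn -hn'.
have wvs : org (e d) \notin vs by move: dX; rewrite inE => /andP[].
have a := adjX ld; have a' := adjX ld'; rewrite -ww in a'.
case: (hE od) nd => [->|[[E E']|[E E']]]; rewrite ?eqxx // => _; rewrite E in a; rewrite E' in a'.
  by apply: (no_2 a) => //; rewrite adjC.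
by apply: (no_2 a') => //; rewrite adjC.
Qed.

(** A triangle whose darts do not already fit together would be a path of 3 edges between y and v0.
    Hence the triangles of the merged map are old ones and inherit consistency. *)
Let tri4 d1 d2 d3 : live d1 -> live d2 -> live d3 -> d2 \in X3 -> d3 \in X3 ->
  org4 (e d1) = org4 d2 -> org4 (e d2) = org4 d3 -> org4 (e d3) = org4 d1 ->
  org (e d1) = org d2.
Proof.
move=> l1 l2 l3 X2 X3' o12 o23 o31; apply/eqP; apply: contraT => nE; exfalso.
have o1 : org4 (e d1) = v0.
  by case: (hE o12) nE => [->|[[E _]|[E _]]]; rewrite ?eqxx // /org4 E ?hy ?hv0.
have [u3 _] : h (org d3) = org d3 /\ org d3 != y.
  by apply: h_nv0; rewrite -/(org4 d3) -o23 eq_sym -o1 o12 loop4.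
have [u2 _] : h (org (e d2)) = org (e d2) /\ org (e d2) != y.
  by apply: h_nv0; rewrite -/(org4 _) eq_sym -o1 o12 loop4.
have [w3 _] : h (org (e d3)) = org (e d3) /\ org (e d3) != y.
  by apply: h_nv0; rewrite -/(org4 _) o31 -o1 loop4.
have [w1 _] : h (org d1) = org d1 /\ org d1 != y.
  by apply: h_nv0; rewrite -/(org4 d1) -o1 loop4.
have E23 : org (e d2) = org d3 by rewrite -u2 -u3.
have E31 : org (e d3) = org d1 by rewrite -w1 -w3.
have a1 := adjX l1; have a2 := adjX l2; have a3 := adjX l3.
rewrite E23 in a2; rewrite E31 in a3.
have /andP[uv wv] : (org d3 \notin vs) && (org (e d3) \notin vs) by rewrite inE in X3'.
rewrite E31 in wv.
case: (hE o12) nE => [->|[[E E']|[E E']]]; rewrite ?eqxx // => _; rewrite E' in a2; rewrite E in a1.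
  have a1' : adj y (org d1) by rewrite adjC.
  apply: (@tetrad_nopath [:: org d1; org d3; v0]) => //.
  - by rewrite /= a1' (adjC _ (org d3)) a3 adjC a2.
  - have e1 : y != org d3 by apply: contraFneq no_v0y => ->; rewrite adjC.
    have e2' : org d1 != v0 by apply: contraFneq no_v0y => <-.
    have e3 := adj_neq a2; have e5 := adj_neq a3; rewrite eq_sym in e3; rewrite eq_sym in e5.
    by rewrite /= !inE !negb_or yv0 (adj_neq a1') e1 e2' e3 e5.
  - by move=> u; do 4![rewrite in_cons => /predU1P[-> //|]].
apply: (@tetrad_nopath [:: org d3; org d1; v0]) => //.
- by rewrite /= a2 a3 a1.
- have e1 : y != org d1 by apply: contraFneq no_v0y => ->.
  have e2' : org d3 != v0 by apply: contraFneq no_v0y => <-.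
  by rewrite /= !inE !negb_or yv0 (adj_neq a2) (adj_neq a3) (adj_neq a1) e1 e2'.
- by move=> u; do 4![rewrite in_cons => /predU1P[-> //|]].
Qed.

Let adj4 := adjm e4 org4.
Let adj4P u w : adj4 u w -> u != v0 -> w != v0 -> [/\ adj u w, u \notin vs, w \notin vs & u != y].
Proof.
case/adjmP=> d [ld ou ow] uv wv; move: ld; rewrite live4 => /andP[dX ld].
rewrite e4E // in ow.
have [hu huy] : h (org d) = org d /\ org d != y by apply: h_nv0; rewrite -/(org4 d) ou.
have [hw _] : h (org (e d)) = org (e d) /\ org (e d) != y by apply: h_nv0; rewrite -/(org4 (e d)) ow.
rewrite -ou -ow /org4 hu hw; move: dX; rewrite inE => /andP[a b'].
by split=> //; apply: adjX.
Qed.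

Let adj4l u w : adj4 u w -> u != v0 -> (u \notin vs) && (u != y).
Proof.
case/adjmP=> d [ld ou ow] uv; move: ld; rewrite live4 => /andP[dX ld].
have [hu huy] : h (org d) = org d /\ org d != y by apply: h_nv0; rewrite -/(org4 d) ou.
by rewrite -ou /org4 hu huy; move: dX; rewrite inE => /andP[->].
Qed.

Let adj4v w : adj4 v0 w -> [/\ w \notin vs, w != v0, w != y & adj v0 w \/ adj y w].
Proof.
case/adjmP=> d [ld ou ow]; move: ld; rewrite live4 => /andP[dX ld].
rewrite e4E // in ow.
have wv : w != v0 by rewrite -ow -ou eq_sym; apply: loop4.
have [hw wy] : h (org (e d)) = org (e d) /\ org (e d) != y.
  by apply: h_nv0; rewrite -/(org4 (e d)) ow.
have wE : w = org (e d) by rewrite -ow /org4 hw.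
move: dX; rewrite inE => /andP[_ b']; rewrite wE; split=> //; first by rewrite -wE.
by have := adjX ld; case: (h_v0 ou) => ->; auto.
Qed.

Let sym4 : symmetric adj4.
Proof.
have H u w : adj4 u w -> adj4 w u.
  case/adjmP=> d [ld ou ow]; move: ld; rewrite live4 => /andP[dX ld].
  apply/adjmP; exists (e d); rewrite live4 (eX3' dX) (liveE G) ld.
  by rewrite e4E ?eX3' // (g_inv G); split=> //; rewrite -ow e4E.
by move=> u w; apply/idP/idP; apply: H.
Qed.

(** If the two edges of the cycle at the merged vertex both come from v0, or both from y, the cycle
    is an old one. Otherwise it opens to a path between y and v0 of at most 8 edges. *)
Let cyc4 p : ucycle adj4 p -> 4 <= size p <= 8 -> False.
Proof.
move=> /andP[cp up] sp; have [vp|vp] := boolP (v0 \in p); last first.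
  apply: (@g_cyc _ _ _ _ _ _ G p) => //; rewrite /ucycle up andbT.
  apply: (sub_in_cycle (P := [pred u | u != v0])) cp.
    by move=> u w; rewrite !inE => a b' /adj4P[].
  by apply/allP=> u upp; rewrite inE; apply: contraNneq vp => <-.
have [i r rE] := rot_to vp.
have cp' : path.cycle adj4 (v0 :: r) by rewrite -rE rot_cycle.
have up' : uniq (v0 :: r) by rewrite -rE rot_uniq.
have sr : 3 <= size r <= 7 by rewrite -(size_rot i p) rE in sp.
case: r {rE} cp' up' sr => // u r /=; rewrite inE negb_or => /andP[a1 pr].
move=> /and3P[/andP[vu vr] ur unr] sr.
rewrite rcons_path in pr; case/andP: pr => pr lr.
have nv w : w \in u :: r -> w != v0.
  by rewrite inE => /orP[/eqP->|wr]; [rewrite eq_sym|apply: contraNneq vr => <-].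
have pr' : path adj u r.
  apply: (sub_in_path (P := [pred w | w != v0])) pr.
    by move=> w w'; rewrite !inE => a b' /adj4P[].
  by apply/allP=> w /nv; rewrite inE.
have [uvs uv0 uy a1'] := adj4v a1.
have [lvs lv0 ly al'] : [/\ last u r \notin vs, last u r != v0, last u r != y
    & adj v0 (last u r) \/ adj y (last u r)] by apply: adj4v; rewrite sym4.
have plane_map w : w \in u :: r -> (w \notin vs) && (w != y).
  move=> wr; apply: (@adj4l _ (next [:: v0, u & r] w)); last exact: nv.
  apply: next_cycle; last by rewrite in_cons wr orbT.
  by rewrite (cycle_path v0) /= lr a1 pr.
have yr : y \notin u :: r by apply/negP=> /plane_map; rewrite eqxx andbF.
have v0r : v0 \notin u :: r by rewrite inE negb_or vu vr.
have un : uniq (u :: r) by rewrite /= ur unr.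
have sz : size (u :: r) <= 7 by case/andP: sr.
case: a1' => a1'; case: al' => al'.
- apply: (@g_cyc _ _ _ _ _ _ G [:: v0, u & r]); last exact: size48 sr.
  by rewrite /ucycle cons_uniq v0r un /= a1' rcons_path pr' adjC al'.
- apply: (@tetrad_nopath (rcons (rev (u :: r)) v0)).
  + rewrite rev_cons; have := rev_path adj v0 (rcons (u :: r) y).
    rewrite last_rcons belast_rcons rev_cons rev_cons => ->.
    rewrite /= (adjC u v0) a1' rcons_path /= al' andbT.
    by apply: sub_path pr' => p1 p2; rewrite adjC.
  + by rewrite last_rcons.
  + by rewrite cons_uniq rcons_uniq mem_rcons inE negb_or yv0 !mem_rev yr v0r rev_uniq.
  + move=> w; rewrite in_cons mem_rcons in_cons mem_rev.
    by case/predU1P=> [->//|/predU1P[->//|/plane_map/andP[]//]].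
  + by rewrite size_rcons size_rev.
- apply: (@tetrad_nopath (rcons (u :: r) v0)).
  + by rewrite /= a1' rcons_path pr' adjC.
  + by rewrite last_rcons.
  + by rewrite cons_uniq rcons_uniq mem_rcons inE negb_or yv0 yr v0r un.
  + move=> w; rewrite in_cons mem_rcons in_cons.
    by case/predU1P=> [->//|/predU1P[->//|/plane_map/andP[]//]].
  + by rewrite size_rcons.
- apply: (@g_cyc _ _ _ _ _ _ G [:: y, u & r]); last exact: size48 sr.
  by rewrite /ucycle cons_uniq yr un /= a1' rcons_path pr' adjC al'.
Qed.

Let t_org d : org4 (t d) = org4 d.
Proof.
have E : org4 b = org4 h0 by rewrite /org4 -/v0 -/y hy hv0.
by rewrite /t; case: tpermP => [->|->|].
Qed.

Let good4 : plane_map e4 n4 org4 R4.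
Proof.
split.
- move=> d; have [dX|dX] := boolP (d \in X3); last by rewrite /e4 !del_out.
  by rewrite e4E // e4E ?eX3' // (g_inv G).
- move=> d; rewrite live4 negb_and; case: (boolP (d \in X3)) => [dX|dX _] /=; last first.
    by rewrite /n4 del_out.
  move=> nd; have nE := g_dead G nd.
  have E : n3 d = d.
    rewrite permM n2E ?nE ?X30 // /t tpermD //.
      by apply: contraNneq nd => <-.
    by apply: contraNneq nd => <-.
  by rewrite /n4 del_id ?E.
- move=> d; have [dX|dX] := boolP (d \in X3); last by rewrite /n4 del_out.
  have st z : org4 (n3 z) = org4 z by rewrite permM t_org /org4 (g_org G2).
  by apply: (del_skip (P := fun z => org4 z = org4 d)) => // z _; rewrite st.
- move=> d d'; rewrite !live4 => /andP[dX ld] /andP[dX' ld'] od.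
  have l2 z : z \in X0 -> live z -> alive e2 z by rewrite /alive => zX lz; rewrite e2E.
  have bX : b \in X0 by apply: X0vs.
  have h0X : h0 \in X0 by apply: X0vs.
  rewrite /n4 del_porbit //.
  have nd z z' : z \in X0 -> z' \in X0 -> live z -> live z' -> org z = org z' -> z' \in porbit n3 z.
    by move=> *; apply: n2_n3; apply: (g_node G2) => //; apply: l2.
  have tr z z' : z \in X0 -> z' \in X0 -> live z -> live z' -> org z = y -> org z' = v0 ->
      z' \in porbit n3 z.
    move=> zX zX' lz lz' oz oz'.
    have h1 : h0 \in porbit n3 z by apply: nd.
    have h2 : z' \in porbit n3 b by apply: nd.
    move: h1; rewrite -eq_porbit_mem => /eqP <-.
    by move: b_n3; rewrite -eq_porbit_mem => /eqP <-.
  case: (hE od) => [E|[[E E']|[E E']]].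
  + by apply: nd; rewrite ?X30.
  + by apply: tr; rewrite ?X30.
  + by rewrite porbit_sym; apply: tr; rewrite ?X30.
- exact: del_planar.
- by move=> d; rewrite live4 => /andP[dX ld]; rewrite e4E //; apply: loop4.
- move=> d d'; rewrite !live4 => /andP[dX ld] /andP[dX' ld']; rewrite !e4E // => od oed.
  have [E|ne] := eqVneq (org d) (org d'); last by case: (simple4 ld ld' dX ne od oed).
  have [E'|ne] := eqVneq (org (e d)) (org (e d')); first exact: (g_simple G).
  by exfalso; apply: (@simple4 (e d) (e d')); rewrite ?(liveE G) ?eX3' ?(g_inv G).
- exact: cyc4.
- move=> d p q; rewrite live4 => /andP[dX ld]; rewrite /R4 e4E // (g_inv G).
  by rewrite (g_Rsym G).
- move=> d p q q'; rewrite live4 => /andP[dX ld] h1 h2.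
  exact: (perm_inj (g_Rinj G ld h1 h2)).
- move=> d1 d2 d3 p q r p'; rewrite !live4 => /andP[X1 l1] /andP[X2 l2] /andP[X3' l3].
  rewrite !e4E // => o12 o23 o31 r1 r2 r3.
  have E12 := tri4 l1 l2 l3 X2 X3' o12 o23 o31.
  have E23 := tri4 l2 l3 l1 X3' X1 o23 o31 o12.
  have E31 := tri4 l3 l1 l2 X1 X2 o31 o12 o23.
  rewrite /R4 E12 in r1; rewrite /R4 E23 in r2; rewrite /R4 E31 in r3.
  exact: (perm_inj (g_Rtri G l1 l2 l3 E12 E23 E31 r1 r2 r3)).
Qed.

(** An arc of [S] has at most 6 edges, at most 7 with the extra edge in [V2] and [V3]. So the
    identification neither merges two precolored vertices nor adds an edge between precolored
    ones. *)
Let v0y_S : v0 \in S -> y \in S -> False.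
Proof.
move=> vS yS; have [q [pq lq uq sq qS]] := S_short_path M yS vS yv0.
apply: (tetrad_nopath pq lq uq); last exact: leq_trans sq _.
by move=> u; rewrite in_cons => /predU1P[->//|/qS/vsS].
Qed.

Let V2 w : v0 \in S -> adj y w -> w \in S -> False.
Proof.
move=> vS a wS; have [E|ne] := eqVneq w v0; first by rewrite E no_v0y in a.
have [q [pq lq uq sq qS]] := S_short_path M wS vS ne.
apply: (@tetrad_nopath (w :: q)) => //.
- by rewrite /= a.
- rewrite /= -/(uniq (w :: q)) uq andbT; apply/negP => yq; apply: v0y_S => //.
  by move: yq; rewrite inE => /orP[/eqP->//|/qS].
- move=> u; rewrite in_cons => /predU1P[->//|].
  by rewrite in_cons => /predU1P[->|/qS/vsS//]; apply: vsS.
- by apply: leq_ltn_trans sq _.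
Qed.

Let V3 w : y \in S -> adj v0 w -> w \in S -> False.
Proof.
move=> yS a wS; have [E|ne] := eqVneq y w; first by rewrite -E adjC no_v0y in a.
have [q [pq lq uq sq qS]] := S_short_path M yS wS ne.
apply: (@tetrad_nopath (rcons q v0)).
- by rewrite rcons_path pq lq adjC.
- by rewrite last_rcons.
- rewrite -rcons_cons rcons_uniq uq andbT; apply/negP => yq; apply: v0y_S => //.
  by move: yq; rewrite inE => /orP[/eqP->//|/qS].
- move=> u; rewrite in_cons mem_rcons in_cons.
  by case/predU1P=> [->//|/predU1P[->//|/qS/vsS//]].
- by rewrite size_rcons; apply: leq_ltn_trans sq _.
Qed.

Let S4 := [set h u | u in S].
(** When y is precolored, the merged vertex gets the color that [pi] sends to the color of y. *)
Let g4 u := if u == v0 then (if v0 \in S then f0 v0 else (pi^-1)%g (f0 y)) else f0 u.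

Let g4E u : u \in S -> sg u (g4 (h u)) = f0 u.
Proof.
move=> uS; rewrite /sg /h /g4; have [E|ne] := eqVneq u y.
  rewrite eqxx ifN ?permKV ?E //; apply/negP=> vS; apply: v0y_S => //; by rewrite -E.
by rewrite perm1; have [E|//] := eqVneq u v0; rewrite E in uS *; rewrite uS.
Qed.

Let S4P u : h u \in S4 -> u \in S \/ ((u = y /\ v0 \in S) \/ (u = v0 /\ y \in S)).
Proof.
case/imsetP=> w wS /hE [->|[[-> E]|[-> E]]]; [by left|right; left|right; right];
  by rewrite -E.
Qed.

Let ok4 : face_or_small e4 n4 org4 S4.
Proof.
case: (mc_S M) => [S1|[s ls SE]]; first by left; apply: leq_trans (leq_imset_card _ _) S1.
have sS d : d \in porbit f s -> org d \in S by move=> ds; rewrite SE imset_f.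
have sX d : d \in porbit f s -> d \in X3.
  by move=> ds; rewrite inE -(org_f G) !vsS // sS // porbit_step.
right; exists s; first by rewrite live4 ls sX // porbit_id.
have st d : d \in porbit f s -> (e4 * n4)%g d = f d.
  move=> ds; have dX := sX _ ds; have fds : f d \in porbit f s by rewrite porbit_step.
  have E : n3 (e d) = f d.
    have edX : e d \in X0 by apply: X30; apply: eX3'.
    have nX : n (e d) \in X0 by rewrite -(fE e n); apply: X30; apply: sX.
    rewrite /n3 permM (n2E edX nX) -(fE e n).
    (* The face of [S] contains neither [b] nor [h0]: the darts following them start at v1 and v4,
       which are outside [S]. *)
    rewrite /t tpermD //.
      apply: contraTneq fds => <-; apply/negP=> bs.
      by have := vsS (sS c0 _); rewrite -fb porbit_step bs fb v1_vs => /(_ isT).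
    apply: contraTneq fds => <-; apply/negP=> bs.
    have := sS (f h0); rewrite porbit_step => /(_ bs)/vsS.
    by rewrite (org_f G) oeh0 v4_vs.
  have fX : n3 (e d) \in X3 by rewrite E; apply: sX.
  by rewrite permM (e4E dX) /n4 (del_id (eX3' dX) fX) E.
rewrite /S4 SE -imset_comp; congr ([set _ | _ in pred_of_set _]).
apply/setP=> d; apply/idP/idP.
  move=> ds; suff [] : d \in porbit f s /\ d \in porbit (e4 * n4)%g s by [].
  move: d ds; apply: (porbit_ind (P := fun d => d \in porbit f s /\ d \in porbit (e4 * n4)%g s)).
    by rewrite !porbit_id.
  by move=> z [z1 z2]; rewrite porbit_step; split=> //; rewrite -st // porbit_step.
move: d; apply: (porbit_ind (P := fun d => d \in porbit f s)); first exact: porbit_id.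
by move=> z zs; rewrite st // porbit_step.
Qed.

Let prop4 : proper_on e4 org4 R4 S4 g4.
Proof.
move=> d; rewrite live4 => /andP[dX ld] uS; rewrite e4E // => wS; rewrite /R4 /org4.
have a := adjX ld.
case: (S4P uS) => [uS'|[[E vS]|[E yS]]]; case: (S4P wS) => [wS'|[[E' vS']|[E' yS']]].
- by rewrite !g4E //; apply: (mc_f0 M).
- by rewrite E' adjC in a; case: (V2 vS' a uS').
- by rewrite E' adjC in a; case: (V3 yS' a uS').
- by rewrite E in a; case: (V2 vS a wS').
- by rewrite E E' (adjm_irr G) in a.
- by case: (v0y_S vS yS').
- by rewrite E in a; case: (V3 yS a wS').
- by case: (v0y_S vS' yS).
- by rewrite E E' (adjm_irr G) in a.
Qed.

Lemma tetrad_merge : exists2 g, (forall d, live d -> d \in X3 -> ~~ R d (g (org d)) (g (org (e d)))) &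
  {in S, g =1 f0} /\ g y = pi (g v0).
Proof.
have lt : #|[set d | alive e4 d]| < #|[set d | live d]|.
  apply: proper_card; apply/properP; split.
    by apply/subsetP=> d; rewrite !inE live4 => /andP[].
  by exists c2; rewrite !inE // live4 inE v3_vs.
have ext := mc_IH M good4 lt; have [||g pg gS] := ext S4 g4 ok4.
- by apply: leq_trans (leq_imset_card _ _) (mc_12 M).
- exact: prop4.
exists (fun u => sg u (g (h u))).
  by move=> d ld dX; have := pg d; rewrite live4 dX ld /R4 /org4 e4E //; apply.
split; first by move=> u uS; rewrite gS ?g4E // imset_f.
by rewrite hy hv0 /sg eqxx ifN ?perm1 // eq_sym.
Qed.

End Merge.

Let pinjR d : live d -> partial_inj (R d).
Proof.
move=> ld; split=> [a a1 a2|a a1 a2]; first exact: (g_Rinj G).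
by rewrite -!(g_Rsym G _ _ ld); apply: (g_Rinj G); rewrite (liveE G).
Qed.

Lemma no_tetrad : False.
Proof.
have [||pi Hpi] := tetrad_color (pinjR lb) (pinjR lc0) (pinjR lc1) (pinjR lc2) (pinjR lc3)
  (pinjR lg0) (pinjR lh0) (pinjR lx0) (pinjR lw0).
- move=> z1 z2 c z r1 r2 r3; apply: (g_Rtri G (d1 := e c0) (d2 := x0) (d3 := w0)) r2 r3 => //.
  + by rewrite (liveE G).
  + by rewrite (g_inv G).
  + by rewrite oec0.
  + by rewrite (g_Rsym G).
- move=> z1 z2 c z r1 r2 r3; apply/esym.
  apply: (g_Rtri G (d1 := x0) (d2 := w0) (d3 := e c0)) r2 r3 _ => //.
  + by rewrite (liveE G).
  + by rewrite oec0.
  + by rewrite (g_inv G).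
  + by rewrite (g_Rsym G).
(* The merged map depends on [pi], so [pi] had to be chosen before any color was known; the colors
   of v0, v5 and x enter only now. *)
have [g gX [gS gy]] := tetrad_merge pi.
have := Hpi (g v0) (g v5) (g x); rewrite -gy.
case=> z1 [z2 [z3 [z4 [[rb rx r0] [rw r1 r2] rg rh r3]]]].
have [_ [n12 n13 n14] [n23 n24 n34] _] := neqs.
pose F u := if u == v1 then z1 else if u == v2 then z2 else if u == v3 then z3
  else if u == v4 then z4 else g u.
have F1 : F v1 = z1 by rewrite /F eqxx.
have F2 : F v2 = z2 by rewrite /F eq_sym (negbTE n12) eqxx.
have F3 : F v3 = z3 by rewrite /F !(eq_sym v3) (negbTE n13) (negbTE n23) eqxx.
have F4 : F v4 = z4.
  by rewrite /F !(eq_sym v4) (negbTE n14) (negbTE n24) (negbTE n34) eqxx.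
have Fg u : u \notin vs -> F u = g u.
  rewrite /F !inE !negb_or => /and4P[h1 h2 h3 h4].
  by rewrite (negbTE h1) (negbTE h2) (negbTE h3) (negbTE h4).
pose ok d := ~~ R d (F (org d)) (F (org (e d))).
have okE d : live d -> ok d -> ok (e d).
  by move=> ld; rewrite /ok (g_inv G) (g_Rsym G).
have kb : ok b by rewrite /ok oeb F1 -/v0 (Fg v0).
have k0 : ok c0 by rewrite /ok oec0 F2 -/v1 F1.
have k1 : ok c1 by rewrite /ok oec1 F3 -/v2 F2.
have k2 : ok c2 by rewrite /ok oec2 F4 -/v3 F3.
have k3 : ok c3 by rewrite /ok -/v4 F4 -/v5 (Fg v5).
have kx : ok x0 by rewrite /ok ox0 oex0 F1 (Fg x).
have kw : ok w0 by rewrite /ok oew0 F2 -/x (Fg x).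
have kg : ok g0 by rewrite /ok og0 oeg0 F3 (Fg y).
have kh : ok h0 by rewrite /ok oeh0 F4 -/y (Fg y).
have okvs d : live d -> org d \in vs -> ok d.
  move=> ld; rewrite !inE => /or4P[] /eqP od.
  - by move: (N1 ld od); rewrite !inE => /or3P[] /eqP-> //; apply: okE.
  - by move: (N2 ld od); rewrite !inE => /or3P[] /eqP-> //; apply: okE.
  - by move: (N3 ld od); rewrite !inE => /or3P[] /eqP-> //; apply: okE.
  - by move: (N4 ld od); rewrite !inE => /or3P[] /eqP-> //; apply: okE.
apply: (mc_no M (f := F)); last by move=> u uS; rewrite Fg ?gS // vsS.
move=> d ld; rewrite -/(ok d).
have [dv|dv] := boolP (org d \in vs); first exact: okvs.
have [edv|edv] := boolP (org (e d) \in vs).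
  by rewrite -(g_inv G d); apply: okE; [rewrite (liveE G)|apply: okvs => //; rewrite (liveE G)].
by rewrite /ok !Fg //; apply: gX => //; rewrite inE dv.
Qed.

End Tetrad.

(** * Discharging *)

Section LocalStructure.
Variables (D V : finType).
Implicit Types (d x s z : D) (u v : V).
Variables (e n : {perm D}) (org : D -> V) (R : D -> rel 'I_3).
Variables (S : {set V}) (f0 : V -> 'I_3).
Hypothesis M : mincex e n org R S f0.
Let G := mc_good M.
Local Notation f := (e * n)%g.
Local Notation live := (alive e).
Local Notation adj := (adjm e org).

(** The two faces share the edge of d. Their vertices form a cycle of length 4 unless the two apexes
    coincide, and then the origin of d has degree 2. *)
Lemma no_adjacent_triangles d : live d -> n (n d) != d -> #|porbit f d| = 3 ->
  #|porbit f (n d)| = 3 -> False.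
Proof.
move=> ld nnd t1 t2.
have lnd : live (n d) by rewrite (live_n G).
have [f3 _ _] := porbit3 t1; have [g3 _ _] := porbit3 t2.
have fed : f (e d) = n d by rewrite (f_e G).
have ffn : f (f (n d)) = e d by apply: (@perm_inj _ f); rewrite g3 fed.
set v := org d; set a := org (e d); set b := org (f (f d)); set w := org (f (n d)).
have ofd : org (f d) = a by rewrite (org_f G).
have avb : adj b v.
  by apply/adjmP; exists (f (f d)); rewrite !(live_f G) ld; split=> //; rewrite -(org_f G) f3.
have aab : adj a b.
  by apply/adjmP; exists (f d); rewrite (live_f G) ld; split=> //; rewrite -(org_f G).
have aav : adj v a by apply: adjm_live.
have avw : adj v w.
  by apply/adjmP; exists (n d); rewrite lnd (g_org G); split=> //; rewrite -(org_f G).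
have awa : adj w a.
  by apply/adjmP; exists (f (n d)); rewrite (live_f G) lnd; split=> //; rewrite -(org_f G) ffn.
have ne u u' : adj u u' -> u != u' by apply: contraTneq => ->; rewrite (adjm_irr G).
have bw : b != w.
  apply: contraNneq nnd => bw.
  have E : n d = e (f (f d)).
    apply: (g_simple G); rewrite ?(liveE G) ?(live_f G) //.
      by rewrite (g_org G) -(org_f G (f (f d))) f3.
    by rewrite (g_inv G) -(org_f G).
  by rewrite E -(fE e n) f3.
apply: (no_cycle4 M (a := v) (b := b) (c := a) (d := w)) => //.
- by rewrite (adjm_sym G).
- by rewrite (adjm_sym G).
- by rewrite (adjm_sym G).
- by rewrite (adjm_sym G).
- by rewrite /= !inE !negb_or (eq_sym v) (ne _ _ avb) (ne _ _ aav) (ne _ _ avw)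
    (eq_sym b) (ne _ _ aab) bw (eq_sym a) (ne _ _ awa).
Qed.

Variable s0 : D.
Hypothesis ls0 : live s0.
Let O := porbit f s0.
Hypothesis SE : S = [set org d | d in O].

Let liveO s : s \in O -> live s. Proof. by move/(live_porbit_f G) ->. Qed.
Let OS s : s \in O -> org s \in S. Proof. by move=> sO; rewrite SE imset_f. Qed.
Let fO s : (f s \in O) = (s \in O). Proof. exact: porbit_step. Qed.
Let fVO s : (f^-1%g s \in O) = (s \in O). Proof. exact: porbit_stepV. Qed.

Lemma O_simple s s' : s \in O -> s' \in O -> org s = org s' -> s = s'.
Proof.
move=> sO s'O oo; apply: (same_face M) => //; first exact: liveO.
by move: s'O; rewrite /O -eq_porbit_mem => /eqP->.
Qed.

Lemma eO_notin s : s \in O -> e s \notin O.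
Proof.
move=> sO; apply/negP=> esO; have E : f s = e s.
  by apply: O_simple; rewrite ?fO // (org_f G).
by have := n_neq M (d := e s); rewrite (liveE G) liveO // -(fE e n) E eqxx => /(_ isT).
Qed.

(** Where an edge leaves [S], the rotation has a dart besides the two that belong to the face. *)
Lemma O_exit : exists2 s, s \in O & n (n s) != s.
Proof.
have [d [ld dS edS]] := S_exit M ls0 SE.
move: (dS); rewrite SE => /imsetP[s sO os]; exists s => //; apply/negP=> /eqP nz.
have ds : d != s by apply: contraNneq edS => ->; rewrite -(org_f G) OS ?fO.
have : d \in porbit n s by rewrite (mem_porbit_n G) ?(liveO sO) // ld os eqxx.
have P : forall y, y \in porbit n s -> (y == s) || (y == n s).
  apply: (porbit_ind (P := fun y => (y == s) || (y == n s))); first by rewrite eqxx.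
  by move=> y /orP[] /eqP->; rewrite ?nz eqxx ?orbT.
move/P; rewrite (negbTE ds) /= => /eqP dE; move: edS; rewrite dE.
have -> : n s = e (f^-1%g s).
  by apply: (@perm_inj _ n); rewrite -(fE e n) permKV nz.
by rewrite (g_inv G) OS ?fVO.
Qed.

(** Let B be the face across s. In both directions B follows [S] up to the first vertex of degree at
    least 3, and these two stops are different corners of B. *)
Lemma two_big s : s \in O -> exists z z', [/\ z \in O, z' \in O,
  [/\ e z \in porbit f (e s) & n z' \in porbit f (e s)],
  [/\ n (n (e z)) != e z & n (n (n z')) != n z'] & e z != n z'].
Proof.
move=> sO; set B := porbit f (e s).
have [s1 s1O big1] := O_exit.
have [z [zO zB zbig]] : exists z, [/\ z \in O, e z \in B & n (n (e z)) != e z].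
  case: (boolP [exists z, [&& z \in O, e z \in B & n (n (e z)) != e z]]).
    by case/existsP=> z /and3P[]; exists z.
  move=> /existsPn H; exfalso.
  have {}H z : z \in O -> e z \in B -> n (n (e z)) = e z.
    by move=> zO zB; have := H z; rewrite zO zB /= negbK => /eqP.
  (* Otherwise B would follow all of [S], past the vertex of degree at least 3 as well. *)
  have all z : z \in O -> e z \in B.
    move=> zO; have : z \in porbit f s by move: sO; rewrite /O -eq_porbit_mem => /eqP->.
    move=> zs; suff [] : e z \in B /\ z \in O by [].
    move: z zs {zO}; apply: (porbit_ind (P := fun z => e z \in B /\ z \in O)).
      by rewrite porbit_id.
    move=> z [zB zO]; rewrite fO; split=> //.
    by rewrite -(porbit_step f) (f_e G) fE H.
  have s1' : f^-1%g s1 \in O by rewrite fVO.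
  have := H _ s1' (all _ s1'); rewrite (e_fV e n) permKV => E.
  by rewrite E permKV eqxx in big1.
have [z' [z'O z'B z'big]] : exists z, [/\ z \in O, e z \in B & n (n z) != z].
  case: (boolP [exists z, [&& z \in O, e z \in B & n (n z) != z]]).
    by case/existsP=> z' /and3P[]; exists z'.
  move=> /existsPn H; exfalso.
  have {}H x : x \in O -> e x \in B -> n (n x) = x.
    by move=> xO xB; have := H x; rewrite xO xB /= negbK => /eqP.
  have all x : x \in O -> e x \in B.
    move=> xO; have : x \in porbit f^-1%g s.
      by rewrite porbitV; move: sO; rewrite /O -eq_porbit_mem => /eqP->.
    move=> xs; suff [] : e x \in B /\ x \in O by [].
    move: x xs {xO}; apply: (porbit_ind (P := fun x => e x \in B /\ x \in O)).
      by rewrite porbit_id.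
    move=> x [xB xO]; rewrite fVO (e_fV e n); split=> //.
    have -> : n^-1%g x = n x by apply: (@perm_inj _ n); rewrite permKV H.
    by rewrite -(f_e G) porbit_step.
  by rewrite H ?all ?eqxx in big1.
exists z, z'; split=> //.
- by split=> //; rewrite -(f_e G) porbit_step.
- by split=> //; apply: contraNneq z'big => /perm_inj ->.
apply: contraNneq z'big => E.
have E' : f z = z'.
  by apply: O_simple; rewrite ?fO // (org_f G) E (g_org G).
by rewrite -E -(fE e n) E'.
Qed.

(** The two corners from [two_big] put all three vertices of the triangle into [S]. There are no
    chords, so the three edges are edges of the face of [S], and then the corners from [two_big]
    would have degree 2. *)
Lemma deg2_no_triangle s : s \in O -> n (n s) = s -> #|porbit f (n s)| = 3 -> False.
Proof.
move=> sO nn t3; set x := n s in t3; pose z1 := f^-1%g s.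
have z1O : z1 \in O by rewrite fVO.
have xE : x = e z1.
  by apply: (@perm_inj _ n); rewrite /x nn -(fE e n) permKV.
have [z [z' [zO z'O [zB z'B] [zbig z'big] zz']]] := two_big z1O.
rewrite -xE in zB z'B.
have nnx : n (n x) = x by rewrite /x nn.
have xz : x != e z by apply: contraNneq zbig => <-; rewrite nnx.
have xz' : x != n z' by apply: contraNneq z'big => <-; rewrite nnx.
have [f3 u3 P3] := porbit3 t3.
have xO : x \notin O by rewrite xE eO_notin.
have BO y : y \in porbit f x -> y \notin O.
  move=> yx; apply: contra xO; rewrite /O !(porbit_sym _ _ s0).
  by move: yx; rewrite -eq_porbit_mem => /eqP->.
have lx : live x by rewrite xE (liveE G) liveO.
have BS y : y \in porbit f x -> org y \in S.
  have xS : org x \in S by rewrite /x (g_org G) OS.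
  have zS : org (e z) \in S by rewrite -(org_f G) OS ?fO.
  have z'S : org (n z') \in S by rewrite (g_org G) OS.
  have cov w : w \in porbit f x -> [|| w == x, w == e z | w == n z'].
    move=> wB; apply: contraT; rewrite !negb_or => /and3P[w1 w2 w3]; exfalso.
    have : #|[set x; e z; n z'; w]| <= #|porbit f x|.
      apply: subset_leq_card; apply/subsetP=> q; rewrite !inE.
      by case/orP=> [/orP[/orP[]|]|] /eqP->; rewrite ?porbit_id.
    rewrite t3 -setUA -!setUA !cardsU1 cards1 !inE !negb_or.
    by rewrite xz xz' zz' (eq_sym x) w1 (eq_sym (e z)) w2 (eq_sym _ w) w3.
  by move/cov => /or3P[] /eqP->.
have eBO y : y \in porbit f x -> e y \in O.
  move=> yB; have ly : live y by rewrite (live_porbit_f G yB).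
  have := S_chord M ls0 SE ly (BS _ yB).
  rewrite -(org_f G) BS ?porbit_step // => /(_ isT) /orP[h|//].
  by have := BO _ yB; rewrite /O h.
pose g := e z; have gB : g \in porbit f x by [].
have z2O := eBO (f^-1%g g); rewrite porbit_stepV in z2O; have {}z2O := z2O gB.
set z2 := e (f^-1%g g) in z2O.
have nz2 : n z2 = g by rewrite /z2 -(fE e n) permKV.
have E : z2 = f z.
  by apply: O_simple; rewrite ?fO // (org_f G) -(g_org G) nz2.
by case/negP: zbig; rewrite -(fE e n) -E nz2.
Qed.

End LocalStructure.

(** * Sums over cycles, and Euler's formula for live darts *)

Section PorbitSums.
Variables (D : finType) (s : {perm D}).
Local Open Scope ring_scope.

Lemma sum_porbit_iter (g : D -> int) x :
  \sum_(z in porbit s x) g z = \sum_(i < #|porbit s x|) g (iter i s x).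
Proof.
rewrite (eq_bigl _ _ (porbit_traject s x)) -big_uniq ?uniq_traject_porbit //=.
rewrite -[RHS](big_mkord xpredT (fun i => g (iter i s x))) /index_iota subn0.
rewrite -(big_map (fun i => iter i s x) xpredT g); congr (bigop _ _ _).
apply: (@eq_from_nth _ x); first by rewrite size_traject size_map size_iota.
move=> i; rewrite size_traject => lti.
by rewrite nth_traject // (nth_map 0%N) ?size_iota // nth_iota.
Qed.

Lemma sum_porbits (P : pred D) (g : D -> int) : (forall d, P (s d) = P d) ->
  \sum_(d | P d) g d = \sum_(A in [set porbit s d | d in P]) \sum_(d in A) g d.
Proof.
move=> Ps; rewrite (partition_big (porbit s) (mem [set porbit s d | d in P])) /=; last first.
  by move=> d Pd; apply: imset_f.
apply: eq_bigr => A /imsetP[x Px ->]; apply: eq_bigl => d.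
rewrite eq_porbit_mem andbC; case: (boolP (d \in porbit s x)) => //= dx.
suff -> : P d = P x by [].
by move: d dx; apply: (porbit_ind (P := fun d => P d = P x)) => // z; rewrite Ps.
Qed.

Lemma sum_porbit_shift (g : D -> int) x :
  \sum_(z in porbit s x) g (s z) = \sum_(z in porbit s x) g z.
Proof.
rewrite [RHS](reindex_inj (@perm_inj _ s)); apply: eq_bigl => z.
by rewrite porbit_step.
Qed.

Lemma card_porbits_live (P : pred D) : (forall d, P (s d) = P d) ->
  (forall d, ~~ P d -> s d = d) ->
  #|porbits s| = (#|[set porbit s d | d in P]| + #|[set d | ~~ P d]|)%N.
Proof.
move=> Ps fix0.
have -> : porbits s = [set porbit s d | d in P] :|: [set [set d] | d in [set d | ~~ P d]].
  apply/setP=> A; rewrite inE; apply/imsetP/orP.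
    case=> d _ ->; have [Pd|Pd] := boolP (P d); [left|right]; first exact: imset_f.
    by rewrite porbit1 ?fix0 // imset_f ?inE.
  case=> /imsetP[d Pd ->]; exists d => //; rewrite porbit1 //; apply: fix0.
  by rewrite inE in Pd.
rewrite cardsU (_ : _ :&: _ = set0) ?cards0 ?subn0.
  by rewrite (card_imset _ (@set1_inj D)).
apply/setP=> A; rewrite !inE; apply/negP=> /andP[/imsetP[d Pd ->] /imsetP[d' Pd' E]].
have : d \in [set d'] by rewrite -E porbit_id.
by rewrite inE => /eqP dd; rewrite inE -dd in Pd'; rewrite unfold_in (negbTE Pd') in Pd.
Qed.
End PorbitSums.

Lemma card_porbits_inv (D : finType) (e : {perm D}) : (forall d, e (e d) = d) ->
  (#|[set porbit e d | d in alive e]|).*2 = #|[set d | alive e d]|.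
Proof.
move=> ee.
have tr : trivIset [set porbit e d | d in alive e].
  apply/trivIsetP => _ _ /imsetP[d _ ->] /imsetP[d' _ ->] ne.
  apply/pred0P=> x; apply/negbTE; apply: contra ne => /andP[/= xd xd'].
  by move: xd xd'; rewrite -!eq_porbit_mem => /eqP <- /eqP <-.
have /eqP := tr.
have -> : cover [set porbit e d | d in alive e] = [set d | alive e d].
  apply/setP=> d; rewrite inE; apply/bigcupP/idP.
    case=> _ /imsetP[x lx ->] dx; rewrite unfold_in in lx.
    move: d dx; apply: (porbit_ind (P := fun d => alive e d)) => // z; by rewrite /alive ee eq_sym.
  by move=> ld; exists (porbit e d); [apply: imset_f|apply: porbit_id].
move=> <-; rewrite (eq_bigr (fun _ => 2)) ?sum_nat_const ?muln2 //.
move=> _ /imsetP[d ld ->]; have -> : porbit e d = [set d; e d].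
  apply/setP=> x; rewrite !inE; apply/idP/orP.
    move: x; apply: (porbit_ind (P := fun x => x == d \/ x == e d)); first by left.
    by move=> z [] /eqP->; [right|left; rewrite ee].
  by case=> /eqP->; rewrite ?porbit_step porbit_id.
by rewrite cards2 eq_sym; rewrite unfold_in in ld; rewrite ld.
Qed.

Section Euler.
Variables (D V : finType).
Variables (e n : {perm D}) (org : D -> V) (R : D -> rel 'I_3).
Hypothesis G : plane_map e n org R.
Local Notation f := (e * n)%g.
Local Notation live := (alive e).

(** A dead dart is fixed by all three permutations and is a class of its own, so it cancels from the
    genus formula. The 4 comes from the one class of live darts that must exist. *)
Lemma euler_live : (exists d, live d) ->
  #|[set d | live d]| + 4 <=
  (#|[set porbit n d | d in live]| + #|[set porbit f d | d in live]|).*2.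
Proof.
case=> d0 l0.
have pl := g_planar G; rewrite /planar in pl.
have dn d : ~~ live d -> n d = d := @g_dead _ _ _ _ _ _ G d.
have de d : ~~ live d -> e d = d by rewrite /alive negbK => /eqP.
have df d : ~~ live d -> f d = d by move=> h; rewrite permM de // dn.
rewrite (card_porbits_live (live_n G) dn) (card_porbits_live (liveE G) de)
  (card_porbits_live (live_f G) df) in pl.
have cD : #|D| = #|[set d | live d]| + #|[set d | ~~ live d]|.
  rewrite -(cardsC [set d | live d]); congr (_ + _).
  by apply: eq_card => d; rewrite !inE.
have cE := card_porbits_inv (g_inv G).
have nc : #|[set d | ~~ live d]| < ncl (link2 e n).
  have cl0 d : live d -> forall x, connect (link2 e n) d x -> live x.
    move=> ld x; case/connectP=> p + ->; elim/last_ind: p => [|p z IH] //=.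
    rewrite rcons_path last_rcons => /andP[/IH lz].
    case/or4P=> /eqP E; move: lz; rewrite E ?(liveE G) ?(live_n G) //.
  have cl1 d : ~~ live d -> [set x | connect (link2 e n) d x] = [set d].
    move=> ld; apply/setP=> x; rewrite !inE; apply/idP/eqP => [|->]; last exact: connect0.
    case/connectP=> p + ->; elim/last_ind: p => [|p z IH] //=.
    rewrite rcons_path last_rcons => /andP[/IH ->].
    case/or4P=> /eqP E; first by rewrite E de.
    - by apply: (@perm_inj _ e); rewrite -E de.
    - by rewrite E dn.
    - by apply: (@perm_inj _ n); rewrite -E dn.
  rewrite -(card_imset _ (@set1_inj D)) -/(ncl _).
  apply: proper_card; apply/properP; split.
    apply/subsetP=> _ /imsetP[d ld ->]; rewrite inE in ld.
    by rewrite -(cl1 _ ld); apply: imset_f.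
  exists [set x | connect (link2 e n) d0 x]; first exact: imset_f.
  apply/negP=> /imsetP[d ld E].
  have : d0 \in [set d] by rewrite -E inE connect0.
  by rewrite inE => /eqP E'; rewrite inE -E' l0 in ld.
move: cD cE nc pl.
set a := #|[set d | live d]|; set b := #|[set d | ~~ live d]|.
set pe := #|[set porbit e d | d in live]|; set pn := #|[set porbit n d | d in live]|.
set pf := #|[set porbit f d | d in live]|; set c := ncl _.
move: a b pe pn pf c #|D| => a b pe pn pf c m; lia.
Qed.

End Euler.

Local Open Scope ring_scope.

Lemma porbitE (T : finType) (s : {perm T}) x y : y \in porbit s x -> porbit s y = porbit s x.
Proof. by rewrite -eq_porbit_mem => /eqP. Qed.

Lemma sum3 (T : finType) (s : {perm T}) (g : T -> int) x : #|porbit s x| = 3%N ->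
  \sum_(z in porbit s x) g z = g x + g (s x) + g (s (s x)).
Proof. by move=> E; rewrite sum_porbit_iter E !big_ord_recr big_ord0 /= add0r. Qed.

Lemma sum4 (T : finType) (s : {perm T}) (g : T -> int) x : #|porbit s x| = 4%N ->
  \sum_(z in porbit s x) g z = g x + g (s x) + g (s (s x)) + g (s (s (s x))).
Proof. by move=> E; rewrite sum_porbit_iter E !big_ord_recr big_ord0 /= add0r. Qed.

Lemma sum2 (T : finType) (s : {perm T}) (g : T -> int) x : #|porbit s x| = 2%N ->
  \sum_(z in porbit s x) g z = g x + g (s x).
Proof. by move=> E; rewrite sum_porbit_iter E !big_ord_recr big_ord0 /= add0r. Qed.

(** * Final charges of vertices and faces *)

Section Discharging.
Variables (D V : finType).
Implicit Types (d x s z : D) (u v : V).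
Variables (e n : {perm D}) (org : D -> V) (R : D -> rel 'I_3).
Variables (S : {set V}) (f0 : V -> 'I_3).
Hypothesis M : mincex e n org R S f0.
Let G := mc_good M.
Local Notation f := (e * n)%g.
Local Notation live := (alive e).

Variable O : {set D}.
Hypothesis HO : (O = set0 /\ (#|S| <= 1)%N) \/
  (exists2 s0, live s0 & O = porbit f s0 /\ S = [set org d | d in O]).

Let fO s : (f s \in O) = (s \in O).
Proof. by case: HO => [[-> _]|[s0 _ [-> _]]]; rewrite ?inE // porbit_step. Qed.
Let OS s : s \in O -> org s \in S.
Proof. by case: HO => [[-> _]|[s0 _ [_ ->]]] h; [rewrite inE in h|rewrite imset_f]. Qed.
Let liveO s : s \in O -> live s.
Proof.
case: HO => [[-> _]|[s0 ls [-> _]]]; first by rewrite inE.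
by move/(live_porbit_f G) ->.
Qed.
Let Of d x : x \in porbit f d -> (x \in O) = (d \in O).
Proof. by move: x; apply: (porbit_ind (P := fun x => (x \in O) = (d \in O))) => // z; rewrite fO. Qed.

Definition tri d := (#|porbit f d| == 3%N) && (d \notin O).

Lemma tri_face d x : x \in porbit f d -> tri x = tri d.
Proof. by move=> h; rewrite /tri (porbitE h) (Of h). Qed.

Lemma tri_n d : tri (n d) = tri (e d).
Proof. by apply: tri_face; rewrite -(f_e G) porbit_step porbit_id. Qed.

Lemma tri_nV d : tri (n^-1%g d) = tri (e (f^-1%g d)).
Proof. by rewrite (e_fV e n). Qed.

(* Charge sent to the face of d through the corner d by its vertex, in half units. *)
Definition tau d : int :=
  if d \in O then 0 else if tri d then 2 else
  if org d \in S then (if (#|porbit n d| == 2%N) && (O != set0) then - 1 else 1) else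
  if #|porbit n d| == 3%N then (if tri (n d) || tri (n^-1%g d) then - 1 else 0)
  else if tri (n d) (+) tri (n^-1%g d) then 1 else 0.

Lemma tau_le2 d : tau d <= 2.
Proof. by rewrite /tau; do !case: ifP. Qed.

Lemma tau_gem1 d : -1 <= tau d.
Proof. by rewrite /tau; do !case: ifP. Qed.

Let degE d x : x \in porbit n d -> #|porbit n x| = #|porbit n d|.
Proof. by move/porbitE->. Qed.

Let nn_deg d : live d -> (2 < #|porbit n d|)%N -> n (n d) != d.
Proof.
move=> ld; apply: contraTneq => nn; rewrite -leqNgt.
have -> : porbit n d = [set d; n d]; last by rewrite cards2; case: eqP.
apply/setP=> x; rewrite !inE; apply/idP/orP; last by case=> /eqP->; rewrite ?porbit_step porbit_id.
move: x; apply: (porbit_ind (P := fun x => x == d \/ x == n d)); first by left.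
by move=> z [] /eqP->; [right|left; rewrite nn].
Qed.

Let tri_adj d : live d -> (2 < #|porbit n d|)%N -> tri d -> tri (n d) -> False.
Proof.
move=> ld dg /andP[/eqP t1 _] /andP[/eqP t2 _].
by apply: (no_adjacent_triangles M ld _ t1 t2); apply: nn_deg.
Qed.

Let iter3 d : #|porbit n d| = 3%N -> n (n (n d)) = d.
Proof. by case/porbit3. Qed.

(** At degree 3 there is at most one triangular corner, and the other two repay it. At degree 4 the
    available 4 covers two opposite triangular corners, or one with its two neighbours. *)
Lemma node_nonS d : live d -> org d \notin S ->
  \sum_(x in porbit n d) tau x <= 4 * #|porbit n d|%:Z - 12.
Proof.
move=> ld dS; have dg := deg_ge3 M ld dS.
have nx x : x \in porbit n d -> (org x \in S) = false.
  by move=> xd; rewrite (org_porbit G xd) (negbTE dS).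
have nO x : x \in porbit n d -> (x \in O) = false.
  by move=> xd; apply/negP=> /OS; rewrite nx.
have lx x : x \in porbit n d -> live x by move=> xd; rewrite (live_porbit G xd).
have adj x : x \in porbit n d -> tri x && tri (n x) = false.
  move=> xd; apply/negP=> /andP[]; apply: tri_adj; rewrite ?lx //.
  by rewrite (degE xd).
have nd x : x \in porbit n d -> n x \in porbit n d by rewrite porbit_step.
have d0 := porbit_id n d; have d1 := nd _ d0; have d2 := nd _ d1; have d3 := nd _ d2.
have tauE x : x \in porbit n d -> tau x = if tri x then 2 else
   if #|porbit n d| == 3%N then (if tri (n x) || tri (n^-1%g x) then - 1 else 0)
    else if tri (n x) (+) tri (n^-1%g x) then 1 else 0.
  by move=> xd; rewrite /tau nO // nx // (degE xd).
case: (ltngtP #|porbit n d| 4%N) => [lt4|gt4|eq4].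
- have E3 : #|porbit n d| = 3%N by apply/eqP; rewrite eqn_leq -ltnS lt4 dg.
  have n3 := iter3 E3.
  rewrite (sum3 _ E3) !tauE // E3 /= n3 !permK.
  have -> : n^-1%g d = n (n d) by apply: (@perm_inj _ n); rewrite permKV.
  have := adj _ d0; have := adj _ d1; have := adj _ d2; rewrite n3.
  by case: (tri d); case: (tri (n d)); case: (tri (n (n d))).
(* Triangular corners are not consecutive, so two consecutive corners take at most 3 together; 3/2
   per corner is affordable from degree 5 on. *)
- have H : 2 * (\sum_(x in porbit n d) tau x) <= 3 * #|porbit n d|%:Z.
    have -> : 2 * (\sum_(x in porbit n d) tau x)
        = \sum_(x in porbit n d) (tau x + tau (n x)).
      by rewrite big_split /= sum_porbit_shift mulr_natl mulr2n.
    have -> : 3 * #|porbit n d|%:Z = \sum_(x in porbit n d) 3.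
      by rewrite sumr_const; set k := #|_|; move: k => k; clear; lia.
    apply: ler_sum => x xd; rewrite (tauE x) // (tauE (n x)) ?nd //.
    rewrite (gtn_eqF (ltn_trans _ gt4)) //.
    rewrite permK; have := adj _ xd.
    by case: (tri x); case: (tri (n x)); case: (tri (n (n x))); case: (tri (n^-1%g x)).
  move: H gt4; set q := \sum_(x in _) _; set k := #|_|; move: q k => q k; clear; lia.
- have n4 : n (n (n (n d))) = d by have := iter_porbit n d; rewrite eq4.
  rewrite (sum4 _ eq4) !tauE // eq4 /= n4 !permK.
  have -> : n^-1%g d = n (n (n d)) by apply: (@perm_inj _ n); rewrite permKV.
  have := adj _ d0; have := adj _ d1; have := adj _ d2; have := adj _ d3; rewrite n4.
  by case: (tri d); case: (tri (n d)); case: (tri (n (n d))); case: (tri (n (n (n d)))).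
Qed.

Section FaceCase.
Variable s0 : D.
Hypothesis ls0 : live s0.
Hypothesis OE : O = porbit f s0.
Hypothesis SE : S = [set org d | d in O].
Let SE' : S = [set org d | d in porbit f s0]. Proof. by rewrite -OE. Qed.

Let Osimp s s' : s \in O -> s' \in O -> org s = org s' -> s = s'.
Proof. by rewrite OE => a b; apply: (O_simple M ls0). Qed.

(** The corner in [O] takes nothing. At degree 2 the other corner is not triangular and returns 1;
    at degree 3 the other two are not both triangular; from degree 4 on, 2 for each remaining corner
    is affordable. *)
Lemma node_S d : d \in O -> \sum_(x in porbit n d) tau x <= 4 * #|porbit n d|%:Z - 9 /\
  ((3 < #|porbit n d|)%N -> \sum_(x in porbit n d) tau x <= 4 * #|porbit n d|%:Z - 10).
Proof.
move=> dO; have ld := liveO dO.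
have xS x : x \in porbit n d -> org x \in S by move=> xd; rewrite (org_porbit G xd) OS.
have xO x : x \in porbit n d -> x != d -> (x \in O) = false.
  move=> xd; apply: contraNF => h; apply/eqP; apply: Osimp => //; exact: (org_porbit G xd).
have td : tau d = 0 by rewrite /tau dO.
have nd := n_neq M ld.
have nd1 : n d \in porbit n d by rewrite porbit_step porbit_id.
have nd2 : n (n d) \in porbit n d by rewrite porbit_step.
have dg2 : (1 < #|porbit n d|)%N.
  rewrite (cardsD1 d) porbit_id (cardsD1 (n d)) !inE nd nd1; lia.
case: (ltngtP #|porbit n d| 3%N) => [lt3|gt3|eq3].
- have E2 : #|porbit n d| = 2%N by apply/eqP; rewrite eqn_leq -ltnS lt3 dg2.
  have nn : n (n d) = d by have := iter_porbit n d; rewrite E2.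
  have nt : tri (n d) = false.
    apply/negP=> /andP[/eqP t3 _]; apply: (deg2_no_triangle M ls0 SE' _ nn t3).
    by rewrite -OE.
  have O0 : O != set0 by apply/set0Pn; exists d.
  rewrite (sum2 _ E2) td add0r /tau (xO _ nd1 nd) nt xS // (degE nd1) E2 O0 /=.
  by split.
- have H : \sum_(x in porbit n d) tau x <= 2 * #|porbit n d|%:Z - 2.
    rewrite (bigD1 d) ?porbit_id //= td add0r.
    have le : \sum_(x in porbit n d | x != d) tau x <= \sum_(x in porbit n d | x != d) 2.
      by apply: ler_sum => x _; apply: tau_le2.
    apply: le_trans le _; rewrite sumr_const.
    have -> : #|[pred x in porbit n d | x != d]| = #|porbit n d :\ d|.
      by apply: eq_card => x; rewrite !inE andbC.
    have := cardsD1 d (porbit n d); rewrite porbit_id.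
    set k := #|porbit n d|; set k' := #|_|; move: k k' => k k'; clear; lia.
  move: H gt3; set q := \sum_(x in _) _; set k := #|_|; move: q k => q k; clear => H gt3.
  by split=> [|_]; lia.
- split; last by rewrite eq3.
  have nnd : n (n d) != d by apply: nn_deg; rewrite ?eq3.
  have nnd' : n d != n (n d) by rewrite eq_sym; apply: (n_neq M); rewrite (live_n G).
  have ad : tri (n d) && tri (n (n d)) = false.
    apply/negP=> /andP[]; apply: tri_adj; rewrite ?(live_n G) //.
    by rewrite (degE nd1) eq3.
  rewrite (sum3 _ eq3) td add0r /tau !xO // !xS // !(degE nd1) (degE nd2) eq3 /=.
  by move: ad; case: (tri (n d)); case: (tri (n (n d))).
Qed.

(** Such a face has length l >= 9. Two corners bring 1 each by [two_big] and the others take at most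
    1, which leaves 2l - 12 + 2 - (l - 2) = l - 8. *)
Lemma face_rev s : s \in O -> #|porbit f (e s)| != 3%N ->
  1 <= 2 * #|porbit f (e s)|%:Z - 12 + \sum_(x in porbit f (e s)) tau x.
Proof.
move=> sO n3; have ls := liveO sO; have les : live (e s) by rewrite (liveE G).
have len := face_len M les n3.
have sO' : s \in porbit f s0 by rewrite -OE.
have [z [z' [zO z'O [zB z'B] [zbig z'big] zz']]] := two_big M ls0 SE' sO'.
rewrite -OE in zO z'O.
have esO : e s \notin O by rewrite OE (eO_notin M ls0).
have one x : x \in porbit f (e s) -> org x \in S -> n (n x) != x -> tau x = 1.
  move=> xB xS nnx; rewrite /tau (Of xB) (negbTE esO) (tri_face xB) /tri (negbTE n3) /= xS.
  rewrite ifN //; apply/negP=> /andP[/eqP E _]; case/negP: nnx.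
  by have := iter_porbit n x; rewrite E /= => ->.
have t1 : tau (e z) = 1 by apply: one => //; rewrite -(org_f G) OS ?fO.
have t2 : tau (n z') = 1 by apply: one => //; rewrite (g_org G) OS.
rewrite (bigD1 (e z)) //= (bigD1 (n z')) /=; last by rewrite z'B eq_sym.
rewrite t1 t2.
have le : - (#|porbit f (e s) :\ e z :\ n z'|)%:Z <=
  \sum_(i in porbit f (e s) | (i != e z) && (i != n z')) tau i.
  have -> : \sum_(i in porbit f (e s) | (i != e z) && (i != n z')) tau i =
      \sum_(i in porbit f (e s) :\ e z :\ n z') tau i.
    by apply: eq_bigl => x; rewrite !inE andbC -andbA andbCA.
  have -> : - (#|porbit f (e s) :\ e z :\ n z'|)%:Z =
      \sum_(i in porbit f (e s) :\ e z :\ n z') (-1).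
    by rewrite sumr_const; set k := #|_|; move: k => k; clear; lia.
  by apply: ler_sum => x _; apply: tau_gem1.
rewrite (eq_bigl (fun i => (i \in porbit f (e s)) && ((i != e z) && (i != n z')))); last first.
  by move=> x; rewrite andbA.
have := cardsD1 (e z) (porbit f (e s)); rewrite zB.
have := cardsD1 (n z') (porbit f (e s) :\ e z); rewrite !inE z'B eq_sym zz'.
move: le len; set q := \sum_(i in _ | _) _; set k := #|porbit f (e s)|.
set k1 := #|_ :\ n z'|; set k2 := #|_|; move: q k k1 k2; clear => q k k1 k2; lia.
Qed.

(** Take a vertex of [S] of degree at least 3. From degree 4 on it has a unit to spare itself. At
    degree 3 its two other faces share an edge, so one of them is not a triangle and has a unit to
    spare. *)
Lemma charge_strict : (exists2 s, s \in O & \sum_(x in porbit n s) tau x <= 4 * #|porbit n s|%:Z - 10)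
  \/ (exists2 s, s \in O & 1 <= 2 * #|porbit f (e s)|%:Z - 12 + \sum_(x in porbit f (e s)) tau x).
Proof.
have [s sO' nn] := O_exit M ls0 SE'; have sO : s \in O by rewrite OE.
have ls := liveO sO.
case: (ltnP 3 #|porbit n s|) => [gt3|le3].
  by left; exists s => //; case: (node_S sO) => _; apply.
right; have [t3|] := eqVneq #|porbit f (e s)| 3%N; last first.
  by move=> h; exists s => //; apply: face_rev.
have E3 : #|porbit n s| = 3%N.
  apply/eqP; rewrite eqn_leq le3 ltnNge; apply/negP=> le2; case/negP: nn.
  have := iter_porbit n s; have := card_porbit_neq0 n s.
  by case: #|_| le2 => [|[|[|k]]] //= _ _ E; rewrite ?E ?eqxx //= E.
exists (f^-1%g s); first by rewrite -fO permKV.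
have n3 := iter3 E3.
have E : e (f^-1%g s) = n (n s) by rewrite (e_fV e n); apply: (@perm_inj _ n); rewrite permKV.
apply: face_rev; first by rewrite -fO permKV.
rewrite E; apply/negP=> /eqP t3'.
apply: (@no_adjacent_triangles _ _ _ _ _ _ _ _ M (n s)) => //.
- by rewrite (live_n G).
- by rewrite n3 eq_sym (n_neq M).
- by rewrite -(f_e G) -t3; congr #|pred_of_set _|; apply: porbitE; rewrite porbit_step porbit_id.
Qed.

End FaceCase.

Lemma neg_corner x : (org x \in S -> #|porbit n x| = 2%N -> O = set0) -> tau x = - 1 ->
  [/\ org x \notin S, #|porbit n x| = 3%N, tri x = false & tri (n x) || tri (n^-1%g x)].
Proof.
move=> H; rewrite /tau; case: ifP => // _; case: ifP => // tx.
case: ifP => xS.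
  by case: ifP => // /andP[/eqP E]; rewrite H ?eqxx.
by case: eqP => [E|_]; case: ifP.
Qed.

(** Away from vertices of degree 2 in [S], a corner that takes 1 has a triangle across exactly one
    of its two edges. If all corners but at most one took 1, triangles would alternate and produce a
    tetrad. So at least two corners take nothing and l - 10 is left, which is negative only for l =
    9. *)
Lemma face_ge0 d : live d -> d \notin O ->
  0 <= 2 * #|porbit f d|%:Z - 12 + \sum_(x in porbit f d) tau x.
Proof.
move=> ld dO; have [t3|n3] := eqVneq #|porbit f d| 3%N.
  have tx x : x \in porbit f d -> tau x = 2.
    by move=> xd; rewrite /tau (Of xd) (negbTE dO) (tri_face xd) /tri t3 eqxx dO.
  have fd : f d \in porbit f d by rewrite porbit_step porbit_id.
  rewrite (sum3 _ t3) t3 !tx ?porbit_step ?porbit_id //.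
have len := face_len M ld n3.
have nO x : x \in porbit f d -> (x \in O) = false by move=> xd; rewrite (Of xd) (negbTE dO).
have nt x : x \in porbit f d -> tri x = false by move=> xd; rewrite (tri_face xd) /tri (negbTE n3).
have lx x : x \in porbit f d -> live x by move=> xd; rewrite (live_porbit_f G xd).
case: (boolP [exists x, [&& x \in porbit f d, org x \in S, #|porbit n x| == 2%N & O != set0]]).
  case/existsP=> x /and4P[xd xS /eqP x2 O0].
  case: HO => [[E _]|[s0 ls0 [OE SE]]]; first by rewrite E eqxx in O0.
  move: (xS); rewrite SE => /imsetP[s sO os].
  have ls := liveO sO.
  have nn : n (n x) = x by have := iter_porbit n x; rewrite x2.
  have xs : s = n x.
    have : s \in porbit n x by rewrite (mem_porbit_n G _ (lx _ xd)) ls os eqxx.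
    rewrite porbit_traject x2 !inE => /orP[/eqP E|/eqP //].
    by have := nO _ xd; rewrite -E sO.
  have E : e (f^-1%g s) = x by rewrite (e_fV e n) xs permK.
  have B : porbit f (e (f^-1%g s)) = porbit f d by rewrite E (porbitE xd).
  have := @face_rev s0 ls0 OE SE (f^-1%g s); rewrite B -fO permKV => /(_ sO n3).
  by apply: le_trans.
move=> /existsPn H.
have {}H x : x \in porbit f d -> org x \in S -> #|porbit n x| = 2%N -> O = set0.
  by move=> xd xS x2; have := H x; rewrite xd xS x2 eqxx /= negbK => /eqP.
pose Ng := [set x in porbit f d | tau x == -1].
have NgP x : x \in Ng -> [/\ x \in porbit f d, org x \notin S, #|porbit n x| = 3%N &
    tri (n x) || tri (n^-1%g x)].
  rewrite inE => /andP[xd /eqP tx]; have [] := neg_corner (H _ xd) tx.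
  by move=> a b _ c.
have NgX x : x \in Ng -> tri (e x) (+) tri (e (f^-1%g x)).
  move=> xN; have [xd xS x3 tt] := NgP _ xN; rewrite -tri_n -tri_nV.
  have lnx : live (n x) by rewrite (live_n G) lx.
  have a : tri (n x) && tri (n^-1%g x) = false.
    apply/negP=> /andP[a]; have -> : n^-1%g x = n (n x).
      by apply: (@perm_inj _ n); rewrite permKV iter3.
    by apply: tri_adj => //; rewrite (@degE x) ?x3 // porbit_step porbit_id.
  by move: tt a; case: (tri (n x)); case: (tri (n^-1%g x)).
have sub : Ng \subset porbit f d by apply/subsetP=> x; rewrite inE => /andP[].
have le2 : (#|Ng| + 2 <= #|porbit f d|)%N.
  rewrite leqNgt; apply/negP=> gt.
  have c1 : (#|porbit f d :\: Ng| <= 1)%N.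
    have := cardsD (porbit f d) Ng; rewrite (setIidPr sub).
    move: gt; set a := #|Ng|; set b := #|porbit f d|; set c := #|_ :\: _|.
    by move: a b c; clear => a b c; lia.
  have [z zd zN] : exists2 z, z \in porbit f d & forall x, x \in porbit f d -> x != z -> x \in Ng.
    case: (set_0Vmem (porbit f d :\: Ng)) => [E|[z zz]].
      exists d; first exact: porbit_id.
      by move=> x xd _; apply: contraT => xN; have := in_set0 x; rewrite -E inE xN xd.
    exists z; first by move: zz; rewrite inE => /andP[].
    move=> x xd xz; apply: contraT => xN.
    have xx : x \in porbit f d :\: Ng by rewrite inE xN.
    by rewrite (card_le1_eqP c1 _ _ xx zz) eqxx in xz.
  (* The face has length at least 9, so the 8 corners after the possible exception z are distinct
     from z. *)
  have it i : (0 < i < 9)%N -> iter i f z \in Ng.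
    move=> i9; apply: zN.
      by elim: (i) => [|j IH] //=; rewrite porbit_step.
    have := uniq_traject_porbit f z; rewrite (porbitE zd).
    have -> : #|porbit f d| = (#|porbit f d|.-1.+1)%N by rewrite prednK // (leq_trans _ len).
    rewrite trajectS cons_uniq => /andP[nz _]; apply: contraNneq nz => {1}<-.
    have -> : iter i f z = iter i.-1 f (f z) by rewrite -iterSr prednK //; case/andP: i9.
    apply/trajectP; exists i.-1 => //.
    by move: i9 len; set k := #|_|; move: k; clear => k; lia.
  pose y i := iter i f z.
  have x1 := it 1%N isT; have x2 := it 2%N isT; have x3 := it 3%N isT.
  have x4 := it 4%N isT; have x5 := it 5%N isT.
  have yN i : (0 < i < 9)%N -> (org (y i) \notin S) /\ #|porbit n (y i)| = 3%N.
    by move=> /it/NgP[].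
  have xo i : (0 < i < 8)%N -> tri (e (y i.+1)) = ~~ tri (e (y i)).
    move=> i8; have := NgX (y i.+1) (it i.+1 _); rewrite [y i.+1]/= permK.
    have i9 : (0 < i.+1 < 9)%N by case/andP: i8.
    by move=> /(_ i9); case: (tri (e (iter i.+1 f z))); case: (tri (e (y i))).
  have lz : live z by rewrite (lx _ zd).
  have ly i : live (y i) by elim: i => [|i IH] //=; rewrite (live_f G).
  have lny i : porbit f (y i) = porbit f d.
    by rewrite -(porbitE zd); apply: porbitE; elim: i => [|i IH]; rewrite ?porbit_id //= porbit_step.
  have go i : (0 < i < 3)%N -> tri (e (y i)) -> False.
    move=> i3 ti; apply: (@no_tetrad _ _ _ _ _ _ _ _ M (y i) (ly i)).
    - move=> c; have k := yN; rewrite !inE => /or4P[] /eqP->.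
      + by case: (yN i) => //; move: i3; clear; lia.
      + by case: (yN i.+1) => //; move: i3; clear; lia.
      + by case: (yN i.+2) => //; move: i3; clear; lia.
      + by case: (yN i.+3) => //; move: i3; clear; lia.
    - move=> c; have k := yN; rewrite !inE => /or4P[] /eqP->.
      + by case: (yN i) => //; move: i3; clear; lia.
      + by case: (yN i.+1) => //; move: i3; clear; lia.
      + by case: (yN i.+2) => //; move: i3; clear; lia.
      + by case: (yN i.+3) => //; move: i3; clear; lia.
    - by case/andP: ti => /eqP.
    - have : tri (e (y i.+2)).
        by rewrite !xo ?ti //; move: i3; clear; lia.
      by case/andP=> /eqP.
    - by rewrite lny.
  (* By alternation a tetrad starts at the first or at the second corner after z. *)
  have [t1|t1] := boolP (tri (e (y 1%N))); first exact: (go 1%N).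
  by apply: (go 2%N) => //; rewrite xo // t1.
have split_sum : \sum_(x in porbit f d) tau x = - #|Ng|%:Z +
    \sum_(x in porbit f d | tau x != -1) tau x.
  rewrite (bigID (fun x => tau x == -1)) /=; congr (_ + _).
  rewrite (eq_bigl (fun x => x \in Ng)); last by move=> x; rewrite inE.
  rewrite (eq_bigr (fun _ => -1)); last by move=> x; rewrite inE => /andP[_ /eqP].
  by rewrite sumr_const; set k := #|_|; move: k => k; clear; lia.
have rest0 x : tau x != -1 -> 0 <= tau x.
  by move: (tau_gem1 x); move: (tau x); clear => t; lia.
have rest : 0 <= \sum_(x in porbit f d | tau x != -1) tau x.
  by apply: sumr_ge0 => x /andP[_]; apply: rest0.
rewrite split_sum.
case: (boolP ((#|porbit f d| == 9%N) && (#|Ng| == 7%N))); last first.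
  move: rest len le2; set r := \sum_(x in _ | _) _; set a := #|porbit f d|; set b := #|Ng|.
  by move: r a b; clear => r a b; lia.
(* Length 9 with 7 negative corners falls short by 1. If no corner brings a positive charge, [Ng]
   consists of all corners where the edges change between triangular and not; around a face such
   changes are even in number, and 7 is odd. *)
case/andP=> /eqP l9 /eqP N7.
suff : 1 <= \sum_(x in porbit f d | tau x != -1) tau x.
  by rewrite l9 N7; set r := \sum_(x in _ | _) _; move: r; clear => r; lia.
case: (boolP [exists x, (x \in porbit f d) && (1 <= tau x)]).
  case/existsP=> x /andP[xd tx]; rewrite (bigD1 x) /=; last first.
    by rewrite xd; move: tx; move: (tau x); clear => t; lia.
  apply: le_trans tx _; rewrite lerDl; apply: sumr_ge0 => z /andP[/andP[_ h] _]; exact: rest0.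
move=> /existsPn pos; exfalso.
have xorN x : x \in porbit f d -> (tri (e x) (+) tri (e (f^-1%g x))) = (x \in Ng).
  move=> xd; apply/idP/idP => [|/NgX //]; rewrite inE xd /= => xx.
  have := pos x; rewrite xd /= /tau nO // nt // tri_n tri_nV xx.
  case: ifP => xS; first by case: ifP.
  case: eqP => // _; case: ifP => //.
  by move: xx; case: (tri (e x)); case: (tri _).
pose g x := (tri (e x))%:Z.
have E1 : \sum_(x in porbit f d) (g x + g (f^-1%g x)) = 2 * \sum_(x in porbit f d) g x.
  rewrite big_split /= -(sum_porbit_shift f (fun x => g (f^-1%g x))).
  under [X in _ + X]eq_bigr => x _ do rewrite permK.
  by rewrite mulr_natl mulr2n.
have E2 : \sum_(x in porbit f d) (g x + g (f^-1%g x)) = #|Ng|%:Z +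
    2 * \sum_(x in porbit f d) (tri (e x) && tri (e (f^-1%g x)))%:Z.
  have -> : #|Ng|%:Z = \sum_(x in porbit f d) (x \in Ng)%:Z.
    rewrite (bigID (mem Ng)) /= [X in _ + X]big1 ?addr0; last first.
      by move=> x /andP[_ /negbTE ->].
    rewrite (eq_bigl (fun x => x \in Ng)); last first.
      by move=> x; rewrite /= andb_idl //; apply: (subsetP sub).
    rewrite (eq_bigr (fun _ => 1)); last by move=> x ->.
    by rewrite sumr_const; set k := #|_|; move: k => k; clear; lia.
  rewrite mulr_sumr -big_split /=; apply: eq_bigr => x xd; rewrite -xorN // /g.
  by case: (tri (e x)); case: (tri _).
move: E1; rewrite E2 N7; set p := \sum_(x in _) _; set q := \sum_(x in _) _.
by move: p q; clear => p q; lia.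
Qed.

End Discharging.

Lemma sum_gt (T : finType) (P : {set T}) (b N : T -> int) x : x \in P ->
  (forall y, y \in P -> b y <= N y) -> b x + 1 <= N x ->
  \sum_(y in P) b y + 1 <= \sum_(y in P) N y.
Proof.
move=> xP H h; rewrite (bigD1 x) //= [X in _ <= X](bigD1 x) //=.
have : \sum_(y in P | y != x) b y <= \sum_(y in P | y != x) N y.
  by apply: ler_sum => y /andP[yP _]; apply: H.
set p := \sum_(y in _ | _) b y; set q := \sum_(y in _ | _) N y; move: p q h.
move: (b x) (N x); clear => a c p q; lia.
Qed.

Lemma sum_if (T : finType) (P Q : {set T}) (c : int) : Q \subset P ->
  \sum_(y in P) (if y \in Q then c else 0) = c * #|Q|%:Z.
Proof.
move=> QP; rewrite -big_mkcondr /= (eq_bigl (fun y => y \in Q)); last first.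
  by move=> y; rewrite andb_idl //; apply: (subsetP QP).
by rewrite sumr_const -[LHS]mulr_natr natz.
Qed.

(** * Total charge against Euler's formula *)

Section Total.
Variables (D V : finType).
Implicit Types (d x s z : D).
Variables (e n : {perm D}) (org : D -> V) (R : D -> rel 'I_3).
Variables (S : {set V}) (f0 : V -> 'I_3).
Hypothesis M : mincex e n org R S f0.
Let G := mc_good M.
Local Notation f := (e * n)%g.
Local Notation live := (alive e).

Let Pn := [set porbit n d | d in live].
Let Pf := [set porbit f d | d in live].

(** Whatever the corners transfer cancels. Each live dart counts 4 at its vertex and 2 at its face,
    against 12 for each vertex and each face. *)
Lemma total_charge (t : D -> int) :
  \sum_(A in Pn) (4 * #|A|%:Z - 12 - \sum_(x in A) t x) +
  \sum_(B in Pf) (2 * #|B|%:Z - 12 + \sum_(x in B) t x) <= - 24.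
Proof.
have [d0 l0] : exists d, live d.
  case: (boolP [exists d, live d]) => [/existsP//|/existsPn H]; exfalso.
  by apply: (mc_no M (f := f0)) => // d; rewrite (negbTE (H d)).
have eu := euler_live G (ex_intro _ d0 l0); rewrite -/Pn -/Pf in eu.
have cst (T : finType) (A : {set T}) (c : int) : \sum_(x in A) c = c * #|A|%:Z.
  by rewrite sumr_const -[LHS]mulr_natr natz.
have E1 : \sum_(A in Pn) (4 * #|A|%:Z - 12 - \sum_(x in A) t x) =
    \sum_(d | live d) (4 - t d) - 12 * #|Pn|%:Z.
  rewrite (sum_porbits (s := n)) ?(live_n G) //; last exact: (live_n G).
  rewrite -(cst _ Pn 12) -sumrB; apply: eq_bigr => A _.
  by rewrite sumrB cst addrAC.
have E2 : \sum_(B in Pf) (2 * #|B|%:Z - 12 + \sum_(x in B) t x) =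
    \sum_(d | live d) (2 + t d) - 12 * #|Pf|%:Z.
  rewrite (sum_porbits (s := f)); last exact: (live_f G).
  rewrite -(cst _ Pf 12) -sumrB; apply: eq_bigr => A _.
  by rewrite big_split /= cst addrAC.
have E3 : \sum_(d | live d) (4 - t d) + \sum_(d | live d) (2 + t d) = 6 * #|[set d | live d]|%:Z.
  rewrite -big_split /= -cst; apply: eq_big => [d|d _]; first by rewrite inE.
  by move: (t d); clear => k; lia.
rewrite E1 E2; move: E3 eu.
set a := \sum_(d | _) _; set b := \sum_(d | _) _; set l := #|[set d | live d]|.
set p := #|Pn|; set q := #|Pf|; move: a b l p q; clear => a b l p q; lia.
Qed.

Lemma no_mincex : False.
Proof.
have PnP A : A \in Pn -> exists2 d, live d & A = porbit n d.
  by case/imsetP=> d; rewrite unfold_in => ld ->; exists d.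
have PfP A : A \in Pf -> exists2 d, live d & A = porbit f d.
  by case/imsetP=> d; rewrite unfold_in => ld ->; exists d.
case: (mc_S M) => [S1|[s0 ls0 SE]].
  have HO : (set0 = set0 :> {set D} /\ (#|S| <= 1)%N) \/ (exists2 s0, live s0 &
      set0 = porbit f s0 /\ S = [set org d | d in (set0 : {set D})]) by left.
  have := total_charge (tau e n org S set0).
  have h2 : 0 <= \sum_(B in Pf) (2 * #|B|%:Z - 12 + \sum_(x in B) tau e n org S set0 x).
    apply: sumr_ge0 => B /PfP[d ld ->]; apply: (face_ge0 M HO) => //; by rewrite inE.
  (* At most one vertex is in [S]. With degree k >= 1 it gives away at most 2 per corner and keeps
     4k - 12 - 2k >= -10, well above -24. *)
  pose Q := [set A in Pn | [exists d in A, org d \in S]].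
  have QP : Q \subset Pn by apply/subsetP=> A; rewrite inE => /andP[].
  have cQ : (#|Q| <= 1)%N.
    apply/card_le1_eqP=> A B; rewrite !inE => /andP[/PnP[a la ->] /exists_inP[a' aa' aS]].
    case/andP=> /PnP[b lb ->] /exists_inP[b' bb' bS].
    have := card_le1_eqP S1 _ _ aS bS.
    rewrite (org_porbit G aa') (org_porbit G bb') => ab.
    by apply: porbitE; rewrite (mem_porbit_n G _ la) lb ab eqxx.
  have h1 : -10 * #|Q|%:Z <= \sum_(A in Pn) (4 * #|A|%:Z - 12 - \sum_(x in A) tau e n org S set0 x).
    rewrite -(sum_if _ QP); apply: ler_sum => A AP; have [d ld AE] := PnP _ AP.
    case: ifP => [_|/negbT AQ].
      have : \sum_(x in A) tau e n org S set0 x <= \sum_(x in A) 2.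
        by apply: ler_sum => x _; apply: tau_le2.
      rewrite sumr_const; have : (0 < #|A|)%N by rewrite AE lt0n card_porbit_neq0.
      set q := \sum_(x in _) _; set k := #|_|; move: q k; clear => q k; lia.
    have dS : org d \notin S.
      apply: contra AQ => dS; rewrite inE AP; apply/exists_inP; exists d => //.
      by rewrite AE porbit_id.
    by rewrite subr_ge0 AE; apply: (node_nonS M HO).
  move: h1 h2 cQ; set p := \sum_(_ in _) _; set q := \sum_(_ in _) _; set k := #|_|.
  move: p q k; clear => p q k; lia.
pose O := porbit f s0.
have HO : (O = set0 /\ (#|S| <= 1)%N) \/ (exists2 s0, live s0 &
      O = porbit f s0 /\ S = [set org d | d in O]) by right; exists s0.
have := total_charge (tau e n org S O).
pose N (A : {set D}) : int := 4 * #|A|%:Z - 12 - \sum_(x in A) tau e n org S O x.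
pose F (B : {set D}) : int := 2 * #|B|%:Z - 12 + \sum_(x in B) tau e n org S O x.
pose Q := [set porbit n d | d in O].
have liveO s : s \in O -> live s by move/(live_porbit_f G) ->.
have QP : Q \subset Pn.
  by apply/subsetP=> _ /imsetP[s sO ->]; apply: imset_f; exact: liveO.
have cQ : (#|Q| <= #|O|)%N by apply: leq_imset_card.
have cO : (#|O| <= 12)%N by rewrite -(card_face M ls0) -SE (mc_12 M).
have OPf : [set O] \subset Pf by rewrite sub1set; apply: imset_f.
have nS s : s \in O -> -3 <= N (porbit n s) /\ ((\sum_(x in porbit n s) tau e n org S O x <=
    4 * #|porbit n s|%:Z - 10) -> -3 + 1 <= N (porbit n s)).
  move=> sO; have [h _] := node_S M HO ls0 erefl SE sO; move: h; rewrite /N.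
  set p := \sum_(_ in _) _; set k := #|_|; move: p k; clear => p k; split; lia.
have bN A : A \in Pn -> (if A \in Q then -3 else 0) <= N A.
  move=> AP; have [d ld AE] := PnP _ AP; case: ifP => [/imsetP[s sO ->]|/negbT AQ].
    by case: (nS _ sO).
  have dS : org d \notin S.
    apply: contra AQ; rewrite SE => /imsetP[s sO od]; apply/imsetP; exists s => //.
    by rewrite AE; apply: porbitE; rewrite (mem_porbit_n G _ (liveO _ sO)) ld od eqxx.
  by rewrite /N subr_ge0 AE; apply: (node_nonS M HO).
have tO : \sum_(x in O) tau e n org S O x = 0.
  by apply: big1 => x xO; rewrite /tau xO.
have bF B : B \in Pf -> (if B \in [set O] then 2 * #|O|%:Z - 12 else 0) <= F B.
  move=> BP; have [d ld BE] := PfP _ BP; rewrite inE; case: eqP => [->|/eqP BO].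
    by rewrite /F tO addr0.
  rewrite /F BE; apply: (face_ge0 M HO) => //.
  by apply: contra BO => dO; rewrite BE eq_porbit_mem.
have sN : \sum_(A in Pn) (if A \in Q then -3 else 0) <= \sum_(A in Pn) N A.
  exact: ler_sum.
have sF : \sum_(B in Pf) (if B \in [set O] then 2 * #|O|%:Z - 12 else 0) <= \sum_(B in Pf) F B.
  exact: ler_sum.
rewrite (sum_if _ QP) in sN; rewrite (sum_if _ OPf) cards1 in sF.
(* For a face of length l this is at least -3l + (2l - 12) + 1 = -l - 11, which exceeds -24 because
   l <= 12. *)
have st : -3 * #|Q|%:Z + (2 * #|O|%:Z - 12) * 1%:Z + 1 <= \sum_(A in Pn) N A + \sum_(B in Pf) F B.
  case: (charge_strict M HO ls0 erefl SE) => [[s sO h]|[s sO h]].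
    have sP : porbit n s \in Pn by apply: imset_f; exact: liveO.
    have := sum_gt sP bN; rewrite (sum_if _ QP) imset_f //= (proj2 (nS _ sO) h) => /(_ isT).
    move: sF; set p := \sum_(_ in Pn) _; set q := \sum_(_ in Pf) _; set k := #|_|; set m := #|_|.
    move: p q k m; clear => p q k m; lia.
  have les : live (e s) by rewrite (liveE G) liveO.
  have sP : porbit f (e s) \in Pf by apply: imset_f.
  have nO : porbit f (e s) \in [set O] = false.
    apply/negP; rewrite inE eq_porbit_mem; apply/negP; exact: (eO_notin M ls0).
  have := sum_gt sP bF; rewrite (sum_if _ OPf) nO cards1 add0r => /(_ h).
  move: sN; set p := \sum_(_ in Pn) _; set q := \sum_(_ in Pf) _; set k := #|_|; set m := #|_|.
  move: p q k m; clear => p q k m; lia.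
move: st cQ cO; rewrite -[\sum_(A in Pn) _]/(\sum_(A in Pn) N A) -[\sum_(B in Pf) (_ + _)]/(\sum_(B in Pf) F B).
set p := \sum_(_ in Pn) _; set q := \sum_(_ in Pf) _; set k := #|_|; set m := #|_|.
move: p q k m; clear => p q k m; lia.
Qed.

End Total.

Local Close Scope ring_scope.

(** There are finitely many colorings, so the existence of an extension is decidable and a map
    without one, by induction on live darts, is a minimal counterexample. *)
Theorem map_extendable (D V : finType) (e n : {perm D}) (org : D -> V) (R : D -> rel 'I_3) :
  plane_map e n org R -> extendable e n org R.
Proof.
have [k] := ubnP #|[set d | alive e d]|; elim: k e n org R => // k IH e n org R lek G S f0 oS S12 pS.
have [ex|nex] := boolP [exists g : {ffun V -> 'I_3}, [forall d, alive e d ==> ~~ R d (g (org d)) (g (org (e d)))]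
   && [forall u, (u \in S) ==> (g u == f0 u)]].
  case/existsP: ex => g /andP[/forallP pg /forallP gS]; exists g.
    by move=> d ld; have := pg d; rewrite ld.
  by move=> u uS; have := gS u; rewrite uS => /eqP.
exfalso; apply: (@no_mincex _ _ e n org R S f0); split=> //.
  move=> e' n' org' R' G' lt; apply: IH => //.
  by rewrite -ltnS in lek; apply: leq_trans lt _; rewrite -ltnS.
move=> f pf fS; case/negP: nex; apply/existsP; exists [ffun u => f u]; apply/andP; split.
  by apply/forallP=> d; apply/implyP=> ld; rewrite !ffunE; apply: pf.
by apply/forallP=> u; apply/implyP=> uS; rewrite ffunE fS.
Qed.

(** * From plane embeddings to plane maps *)

Lemma ncl_n_comp (T : finType) (r : rel T) : connect_sym r -> n_comp r T = ncl r.
Proof.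
move=> sr; rewrite /ncl.
have -> : [set [set y | connect r x y] | x in T] =
    [set [set y | connect r x y] | x in [set x | roots r x]].
  apply/setP=> A; apply/imsetP/imsetP => -[x xx ->]; last by exists x.
  exists (fingraph.root r x); first by rewrite inE roots_root.
  by apply/setP=> y; rewrite !inE (same_connect sr (connect_root r x)).
rewrite card_in_imset; first by apply: eq_card => x; rewrite !inE andbT.
move=> x y; rewrite !inE => /eqP rx /eqP ry E; rewrite -rx -ry; apply/(fingraph.rootP sr).
have : y \in [set z | connect r x z] by rewrite E inE connect0.
by rewrite inE.
Qed.

Lemma ncl_map (T T' : finType) (h : T -> T') (r : rel T) (r' : rel T') :
  (forall z, exists x, h x = z) -> (forall x y, connect r x y = connect r' (h x) (h y)) ->
  ncl r = ncl r'.
Proof.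
move=> surj E; rewrite /ncl.
pose F (A : {set T'}) := h @^-1: A.
have -> : [set [set y | connect r x y] | x in T] =
    F @: [set [set y | connect r' x y] | x in T'].
  rewrite -imset_comp; apply/setP=> A; apply/imsetP/imsetP => -[x _ ->].
    by exists (h x) => //; apply/setP=> y; rewrite !inE E.
  have [x' <-] := surj x; exists x' => //; apply/setP=> y; by rewrite !inE E.
apply: card_in_imset => A B _ _ /setP FE; apply/setP=> z.
by have [x <-] := surj z; have := FE x; rewrite !inE.
Qed.

(** * Corners of an embedding as the darts of a map *)

Section Corners.
Variables (G : sgraph) (M : plane_embedding G).
Local Notation rot := (@rotation G M).
Local Notation sd := (@side G M).

Lemma mem_ends (u v : G) :
  (u \in ends v) = adj v u || (u == v) && ~~ [exists w, adj v w].
Proof.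
rewrite /ends; case: ifP => [ex|nex]; rewrite inE ?andbF ?orbF //= andbT.
by case: (boolP (adj v u)) => // a; move/negbT/existsPn/(_ u): nex; rewrite a.
Qed.

Lemma ends_sym (u v : G) : (u \in ends v) = (v \in ends u).
Proof.
rewrite !mem_ends adj_sym; congr (_ || _); rewrite eq_sym.
by case: eqP => // ->.
Qed.

Lemma ends_ex (v : G) : exists u, u \in ends v.
Proof.
rewrite /ends; case: ifP => [/existsP[w a]|_]; first by exists w; rewrite inE.
by exists v; rewrite inE.
Qed.

Lemma rot_ends (v u : G) : u \in ends v -> rot v u \in ends v.
Proof. by move=> h; rewrite -(rotation_cyclic M h) porbit_step porbit_id. Qed.

(** The corner (v, v) of an isolated vertex becomes a dead dart, so that cycles and classes also
    count isolated vertices and their trivial walks. The origin of a corner is its first component;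
    then [crev] followed by [cturn] is [face_step]. *)
Definition corner := {d : G * G | d.1 \in ends d.2}.
Implicit Types d : corner.

Lemma rev_proof d : (val d).2 \in ends (val d).1.
Proof. by rewrite ends_sym; apply: (valP d). Qed.

Definition crev d : corner := exist _ ((val d).2, (val d).1) (rev_proof d).

Lemma turn_proof d : (val d).1 \in ends (rot (val d).1 (val d).2).
Proof. by rewrite ends_sym rot_ends // rev_proof. Qed.

Definition cturn d : corner := exist _ ((val d).1, rot (val d).1 (val d).2) (turn_proof d).

Lemma crevK : involutive crev.
Proof. by move=> d; apply: val_inj; rewrite /=; case: (val d). Qed.

Lemma cturn_inj : injective cturn.
Proof.
case=> [[a b] h] [[a' b'] h'] /(congr1 val) /= [E1 E2]; apply: val_inj => /=.
by rewrite -E1 in E2 *; rewrite (perm_inj E2).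
Qed.

Definition ce : {perm corner} := perm (inv_inj crevK).
Definition cn : {perm corner} := perm cturn_inj.
Definition corg d : G := (val d).1.
Local Notation cf := (ce * cn)%g.

Lemma ceE d : ce d = crev d. Proof. by rewrite permE. Qed.
Lemma cnE d : cn d = cturn d. Proof. by rewrite permE. Qed.
Lemma ceK d : ce (ce d) = d. Proof. by rewrite !ceE crevK. Qed.
Lemma corg_e d : corg (ce d) = (val d).2. Proof. by rewrite ceE. Qed.
Lemma corg_n d : corg (cn d) = corg d. Proof. by rewrite cnE. Qed.
Lemma corg_f d : corg (cf d) = (val d).2. Proof. by rewrite permM corg_n corg_e. Qed.

Lemma clive d : alive ce d = adj (corg d) (val d).2.
Proof.
case: d => [[a b] h]; rewrite /alive /corg ceE /=.
have := h; rewrite mem_ends /= adj_sym => hh; apply/idP/idP => [ne|ad].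
  by case/orP: hh => // /andP[/eqP E _]; case/eqP: ne; apply: val_inj; rewrite /= E.
by apply: contraTneq ad => /(congr1 val) /= [-> _]; rewrite adj_irrefl.
Qed.

Lemma cdead d : ~~ alive ce d -> cn d = d.
Proof.
case: d => [[a b] h]; rewrite clive /corg /= => na.
have := h; rewrite mem_ends /= adj_sym (negbTE na) /= => /andP[/eqP E iso].
rewrite cnE; apply: val_inj; rewrite /= E; congr pair.
have bb : b \in ends b by rewrite mem_ends eqxx iso orbT.
have := rot_ends bb; rewrite mem_ends iso andbT.
by move/existsPn/(_ (rot b b))/negbTE: iso => -> /eqP.
Qed.

Lemma cnode d d' : corg d = corg d' -> d' \in porbit cn d.
Proof.
move=> od; have h := rev_proof d; have h' := rev_proof d'; rewrite -/(corg d') -od in h'.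
rewrite -(rotation_cyclic M h) in h'; case/porbitP: h' => i E; apply/porbitP; exists i.
have it j : val ((cn ^+ j)%g d) = (corg d, (rot (corg d) ^+ j)%g (val d).2).
  elim: j => [|j IH]; first by rewrite !expg0 !perm1 /corg; case: (val d).
  by rewrite !expgSr !permM cnE /= IH.
by apply: val_inj; rewrite it -E od /corg; case: (val d').
Qed.

Lemma corg_surj (v : G) : exists d, corg d = v.
Proof.
have [u uv] := ends_ex v; have h : (v, u).1 \in ends (v, u).2 by rewrite /= ends_sym.
by exists (exist _ (v, u) h).
Qed.

Lemma corner_ex (u v : G) : adj u v -> exists2 d, alive ce d & val d = (u, v).
Proof.
move=> a; have h : (u, v).1 \in ends (u, v).2 by rewrite /= mem_ends adj_sym a.
by exists (exist _ (u, v) h) => //; rewrite clive.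
Qed.

Lemma adjm_corner : adjm ce corg =2 @adj G.
Proof.
move=> u v; apply/adjmP/idP => [[d [ld <- <-]]|/corner_ex[d ld E]].
  by rewrite corg_e -clive.
by exists d; split; rewrite ?corg_e /corg ?E.
Qed.

Lemma card_porbits_cn : #|porbits cn| = #|G|.
Proof.
pose F (v : G) := [set d | corg d == v].
have -> : porbits cn = [set F v | v in G].
  have pE d : porbit cn d = F (corg d).
    apply/setP=> d'; rewrite inE; apply/idP/eqP => [|E]; last exact: cnode.
    by move: d'; apply: (porbit_ind (P := fun d' => corg d' = corg d)) => // z; rewrite corg_n.
  apply/setP=> A; apply/imsetP/imsetP => -[d _ ->]; first by exists (corg d).
  by have [d' <-] := corg_surj d; exists d'.
rewrite card_in_imset // => u v _ _ /setP E.
by have [d du] := corg_surj u; have := E d; rewrite !inE du eqxx => /esym/eqP.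
Qed.

(** An edge is two corners forming one cycle of [ce]; the corner of an isolated vertex is a cycle by
    itself and belongs to no edge. *)
Lemma card_porbits_ce : #|porbits ce| + #|edge_set G| = #|{: corner}|.
Proof.
have liveE d : alive ce (ce d) = alive ce d by rewrite /alive ceK eq_sym.
have ded d : ~~ alive ce d -> ce d = d by rewrite /alive negbK => /eqP.
rewrite (card_porbits_live liveE ded).
have cI := card_porbits_inv ceK.
have -> : #|edge_set G| = #|[set porbit ce d | d in alive ce]|.
  pose h (A : {set corner}) := corg @: A.
  have pE d x : x \in porbit ce d -> x = d \/ x = ce d.
    move: x; apply: (porbit_ind (P := fun x => x = d \/ x = ce d)); first by left.
    by move=> z [] ->; [right|left; rewrite ceK].
  have hE d : h (porbit ce d) = [set (val d).1; (val d).2].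
    apply/setP=> v; rewrite !inE; apply/imsetP/orP.
      by case=> x /pE[] -> ->; [left|right; rewrite corg_e].
    case=> /eqP->; [by exists d; rewrite ?porbit_id|exists (ce d); rewrite ?corg_e //].
    by rewrite porbit_step porbit_id.
  have -> : edge_set G = h @: [set porbit ce d | d in alive ce].
    apply/setP=> A; apply/imset2P/imsetP.
      case=> x y _; rewrite inE => /andP[_ a] ->; have [d ld dE] := corner_ex a.
      by exists (porbit ce d); [apply: imset_f|rewrite hE dE].
    case=> _ /imsetP[d ld ->] ->; rewrite hE; exists (val d).1 (val d).2 => //.
    by rewrite inE -clive.
  rewrite card_in_imset // => _ _ /imsetP[d _ ->] /imsetP[d' _ ->]; rewrite !hE => E.
  apply/eqP; rewrite eq_porbit_mem.
  suff : (val d == val d') || (val d == val (ce d')).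
    by case/orP=> /eqP/val_inj->; rewrite ?porbit_step porbit_id.
  have h1 : (val d).1 \in [set (val d').1; (val d').2] by rewrite -E !inE eqxx.
  have h2 : (val d).2 \in [set (val d').1; (val d').2] by rewrite -E !inE eqxx orbT.
  have h3 : (val d').1 \in [set (val d).1; (val d).2] by rewrite E !inE eqxx.
  have h4 : (val d').2 \in [set (val d).1; (val d).2] by rewrite E !inE eqxx orbT.
  move: h1 h2 h3 h4; rewrite ceE !inE /=; case: (val d) => a b; case: (val d') => a' b' /=.
  rewrite !xpair_eqE.
  move=> h1 h2 h3 h4; case/orP: h1 h3 h4 => /eqP->; case/orP: h2 => /eqP-> h3 h4;
    rewrite ?eqxx ?orbT //.
    by case/orP: h4 => /eqP->; rewrite eqxx.
  by case/orP: h3 => /eqP->; rewrite eqxx.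
have <- := cardsC [set d | alive ce d].
rewrite addnAC -cI addnn; congr (_ + _); by apply: eq_card => d; rewrite !inE.
Qed.

Lemma connect_corner d d' : connect (link2 ce cn) d d' = connect (@adj G) (corg d) (corg d').
Proof.
have sG : connect_sym (@adj G) by apply: sym_connect_sym; apply: adj_sym.
apply/idP/idP.
  case/connectP=> p + ->; elim/last_ind: p => [|p z IH] /=; first by rewrite connect0.
  rewrite rcons_path last_rcons => /andP[/IH h l]; apply: connect_trans h _.
  have st x : connect (@adj G) (corg x) (corg (ce x)).
    rewrite corg_e; have [l'|/negbTE l'] := boolP (alive ce x).
      by apply: connect1; rewrite -clive.
    by move/negbT/cdead: (l') => _; have /eqP E := negbFE l'; rewrite -corg_e E connect0.
  by case/or4P: l => /eqP->; rewrite ?corg_n ?connect0 //; rewrite sG.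
move: (erefl (corg d')); move: {-2}(corg d') => w + /connectP[p].
elim: p d => [|v p IH] d /= od; first by move=> _ E; apply: porbit_connect (cnode _); [exact: link2_r|rewrite -E].
case/andP=> a pv E; have [x lx xE] := corner_ex a.
have h1 : connect (link2 ce cn) d x.
  by apply: porbit_connect (cnode _); [exact: link2_r|rewrite /corg xE].
apply: connect_trans h1 (connect_trans (link2_l _ _ _) (IH _ od _ _)).
  by rewrite corg_e xE.
by rewrite corg_e xE.
Qed.

Lemma connect_ends d : connect (@adj G) (corg d) (val d).2.
Proof.
rewrite -(corg_f d) -connect_corner permM.
exact: connect_trans (link2_l _ _ _) (link2_r _ _ _).
Qed.

Lemma ncl_corner : ncl (link2 ce cn) = n_comp (@adj G) G.
Proof.
rewrite (ncl_map (h := corg) corg_surj connect_corner) -ncl_n_comp //.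
exact: sym_connect_sym (@adj_sym G).
Qed.

Lemma sd_f d : sd (val (cf d)) = sd (val d).
Proof.
rewrite permM cnE ceE /=; have := side_walk M (u := (val d).1) (v := (val d).2) (valP d).
by rewrite /face_step /=; case: (val d).
Qed.

Lemma sd_porbit d d' : d' \in porbit cf d ->
  sd (val d') = sd (val d) /\ connect (@adj G) (corg d) (corg d').
Proof.
move: d'; apply: (porbit_ind (P := fun d' => sd (val d') = sd (val d) /\ connect (@adj G) (corg d) (corg d'))).
  by rewrite connect0.
move=> z [h c]; rewrite sd_f h; split=> //; apply: connect_trans c _.
rewrite -connect_corner permM.
exact: connect_trans (link2_l _ _ _) (link2_r _ _ _).
Qed.

(* The bipartite graph of components and faces, with one edge for each facial walk of P. *)
Definition walk_rel (P : seq {set corner}) : rel (G + face M) := fun x y =>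
  match x, y with
  | inl u, inl v => adj u v
  | inl v, inr a | inr a, inl v =>
      has (fun A : {set corner} => [exists d in A, (corg d == v) && (sd (val d) == a)]) P
  | inr _, inr _ => false
  end.

Lemma walk_rel_sym P : connect_sym (walk_rel P).
Proof.
by apply: sym_connect_sym => -[u|a] [v|b] //=; rewrite adj_sym.
Qed.

Lemma walk_rel_adj P u v : connect (@adj G) u v -> connect (walk_rel P) (inl u) (inl v).
Proof.
case/connectP=> p + ->; elim/last_ind: p => [|p z IH] /=; first by rewrite connect0.
by rewrite rcons_path last_rcons => /andP[/IH h a]; apply: connect_trans h (connect1 _).
Qed.

Lemma walk_rel_corner P d d' : d' \in porbit cf d -> porbit cf d \in P ->
  connect (walk_rel P) (inl (corg d)) (inr (sd (val d'))).
Proof.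
move=> dd' dP; rewrite (sd_porbit dd').1; apply: connect1 => /=; apply/hasP.
by exists (porbit cf d) => //; apply/exists_inP; exists d; rewrite ?porbit_id ?eqxx.
Qed.

Lemma ncl_walk0 : n_comp (@adj G) G + #|face M| <= ncl (walk_rel [::]).
Proof.
have sG : connect_sym (@adj G) by apply: sym_connect_sym; apply: adj_sym.
rewrite (ncl_n_comp sG) /ncl.
pose F (A : {set G}) : {set G + face M} := inl @: A.
have Fi : injective F by apply: imset_inj => a b [].
pose C := [set [set y | connect (@adj G) x y] | x in G].
rewrite -(card_imset _ Fi) -cardsT.
have fi : injective (fun a : face M => [set (inr a : G + face M)]) by move=> a b /set1_inj[].
rewrite -(card_imset _ fi) -cardsUI (_ : _ :&: _ = set0); last first.
  apply/setP=> A; rewrite !inE; apply/negP=> /andP[/imsetP[B _ ->] /imsetP[a _ E]].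
  have : inr a \in F B by rewrite E inE.
  by case/imsetP.
rewrite cards0 addn0; apply: subset_leq_card; apply/subsetP=> A; rewrite inE.
case/orP=> /imsetP[].
  move=> _ /imsetP[u _ ->] ->; apply/imsetP; exists (inl u) => //.
  apply/setP=> z; rewrite inE; apply/imsetP/idP.
    by case=> v; rewrite inE => uv ->; apply: walk_rel_adj.
  case/connectP=> p + ->; elim/last_ind: p => [|p w IH] /=.
    by exists u; rewrite ?inE ?connect0.
  rewrite rcons_path last_rcons => /andP[/IH[v]]; rewrite inE => uv ->.
  by case: w => [w|//] /= a; exists w => //; rewrite inE; apply: connect_trans uv (connect1 a).
move=> a _ ->; apply/imsetP; exists (inr a) => //.
apply/setP=> z; rewrite !inE; apply/eqP/idP => [->|]; first exact: connect0.
case/connectP=> p + ->; elim/last_ind: p => [|p w IH] //=.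
by rewrite rcons_path last_rcons => /andP[/IH ->]; case: w.
Qed.

(** All corners of a facial walk share their face and their component, so a further walk adds a
    single edge to the bipartite graph and joins at most two classes. *)
Lemma ncl_walk P : {subset P <= porbits cf} ->
  n_comp (@adj G) G + #|face M| <= ncl (walk_rel P) + size P.
Proof.
elim: P => [|A P IH] sP; first by rewrite addn0 ncl_walk0.
have {}IH := IH (fun B BP => sP B (mem_behead (s := A :: P) BP)).
have /imsetP[d _ AE] : A \in porbits cf by apply: sP; rewrite inE eqxx.
have := @ncl_add _ (walk_rel P) (walk_rel (A :: P)) (inl (corg d)) (inr (sd (val d))).
move=> H; have {}H : ncl (walk_rel (A :: P)) + ~~ connect (walk_rel P) (inl (corg d)) (inr (sd (val d)))
    = ncl (walk_rel P).
  apply: H; do ?exact: walk_rel_sym.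
  - by move=> [u|a] [v|b] //= h; apply: connect1 => //=; rewrite h orbT.
  - by apply: walk_rel_corner; rewrite ?porbit_id // inE AE eqxx.
  have key v a : [exists d in A, (corg d == v) && (sd (val d) == a)] ->
      connect (walk_rel P) (inl v) (inl (corg d)) /\ a = sd (val d).
    case/exists_inP=> x; rewrite AE => xd /andP[/eqP <- /eqP <-].
    have [-> c] := sd_porbit xd; split=> //.
    by rewrite walk_rel_sym; apply: walk_rel_adj.
  move=> [u|a] [v|b] //=.
  - by move=> a; rewrite (@connect1 _ (walk_rel P) (inl u) (inl v)).
  - case/orP=> [/key[c ->]|h]; first by rewrite c connect0 orbT.
    by rewrite (@connect1 _ (walk_rel P) (inl u) (inr b)).
  - case/orP=> [/key[c ->]|h]; first by rewrite connect0 (walk_rel_sym P (inl (corg d))) c !orbT.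
    by rewrite (@connect1 _ (walk_rel P) (inr a) (inl v)).
move: IH H => /=; set k := n_comp _ _; set p := ncl _; set q := ncl _.
move: k p q #|face M| (size P) => k p q m l; case: connect => /=; lia.
Qed.

Lemma ncl_connected (T : finType) (r : rel T) : (forall x y, connect r x y) -> ncl r <= 1.
Proof.
move=> H; apply/card_le1_eqP=> A B /imsetP[x _ ->] /imsetP[y _ ->].
by apply/setP=> z; rewrite !inE !H.
Qed.

Definition linking P := forall d, connect (walk_rel P) (inl (val d).2) (inr (sd (val d))).

(** If every corner is linked to its face by way of [P], connectedness of the surface passes to the
    bipartite graph with edges [P], and a connected graph has at most one vertex more than it has
    edges. *)
Lemma linking_card P : {subset P <= porbits cf} -> linking P ->
  n_comp (@adj G) G + #|face M| <= (size P).+1.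
Proof.
move=> sP lP; apply: leq_trans (ncl_walk sP) _; rewrite -add1n leq_add2r.
apply: ncl_connected => x y; have := plane_connected x y.
apply: connect_sub => {x y} -[u|a] [v|b] //=.
- by move=> a; apply: connect1.
- rewrite inE => /exists_inP[w wu /eqP <-].
  by apply: (lP (exist _ (w, u) wu)).
- rewrite inE walk_rel_sym => /exists_inP[w wu /eqP <-].
  by apply: (lP (exist _ (w, v) wu)).
Qed.

Lemma linking_all : linking (enum (porbits cf)).
Proof.
move=> d; rewrite -corg_f -sd_f; apply: walk_rel_corner; first exact: porbit_id.
by rewrite mem_enum; apply: imset_f.
Qed.

(** Connectedness bounds the number of facial walks from below and the nonnegative genus bounds it
    from above; Euler's formula for the faces makes the two bounds meet. *)
Lemma corner_euler : #|porbits cf| + #|G| = #|edge_set G| + (n_comp (@adj G) G).*2.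
Proof.
have h1 : n_comp (@adj G) G + #|face M| <= #|porbits cf|.+1.
  rewrite cardE; apply: linking_card linking_all.
  by move=> A; rewrite mem_enum.
have h2 := genus_ge ce cn; rewrite ncl_corner card_porbits_cn -card_porbits_ce in h2.
move: h1 h2 (plane_euler M).
set k := n_comp _ _; set p := #|porbits ce|; set q := #|porbits cf|.
move: k p q #|G| #|edge_set G| #|face M| => k p q a b c; lia.
Qed.

Lemma corner_planar : planar ce cn.
Proof.
rewrite /planar ncl_corner card_porbits_cn -card_porbits_ce.
move: corner_euler; set k := n_comp _ _; set p := #|porbits ce|; set q := #|porbits cf|.
move: k p q #|G| #|edge_set G| => k p q a b; lia.
Qed.

(* Otherwise one of the two walks could be left out in linking_card. *)
Lemma face_walk_unique d d' : connect (@adj G) (corg d) (corg d') ->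
  sd (val d) = sd (val d') -> d' \in porbit cf d.
Proof.
move=> cdd sdd; apply: contraT => nd; exfalso.
pose P := rem (porbit cf d') (enum (porbits cf)).
have mP A : A \in porbits cf -> A != porbit cf d' -> A \in P.
  by move=> Ap Ad; rewrite mem_rem_uniq ?enum_uniq // inE Ad mem_enum.
have dP : porbit cf d \in P.
  by apply: mP; rewrite ?imset_f // eq_porbit_mem porbit_sym.
have lP : linking P.
  move=> x; rewrite -corg_f -sd_f.
  have [E|ne] := eqVneq (porbit cf (cf x)) (porbit cf d'); last first.
    apply: walk_rel_corner; first exact: porbit_id.
    by apply: mP ne; apply: imset_f.
  have xd : cf x \in porbit cf d' by rewrite -E porbit_id.
  have [-> c] := sd_porbit xd; rewrite -sdd.
  apply: connect_trans (walk_rel_corner (porbit_id _ _) dP).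
  rewrite walk_rel_sym; apply: walk_rel_adj; exact: connect_trans cdd c.
have sP : {subset P <= porbits cf} by move=> A /mem_rem; rewrite mem_enum.
have := linking_card sP lP; rewrite size_rem; last by rewrite mem_enum; apply: imset_f.
rewrite -cardE prednK; last by apply/card_gt0P; exists (porbit cf d'); apply: imset_f.
move: corner_euler (plane_euler M); set k := n_comp _ _; set q := #|porbits cf|.
move: k q #|G| #|edge_set G| #|face M| => k q a b c; lia.
Qed.

End Corners.

(** * From correspondences to conflict relations *)

Section Conflicts.
Variables (G : sgraph) (M : plane_embedding G) (o : orientation G) (C : correspondence 3 o).

(** As a relation, the correspondence of an edge is independent of the orientation up to exchanging
    its arguments, so inverses of partial functions disappear. *)
Definition conflict (u v : G) : rel 'I_3 := fun a b =>
  if o u v then C u v a == Some b else o v u && (C v u b == Some a).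

Lemma conflict_sym u v a b : conflict u v a b = conflict v u b a.
Proof.
rewrite /conflict; case: (boolP (o u v)) => [uv|uv] /=; last by case: ifP.
by have := arc_asym o u v; rewrite uv /= => /negbTE->.
Qed.

Lemma conflict_inj u v a b b' : conflict u v a b -> conflict u v a b' -> b = b'.
Proof.
rewrite /conflict; case: ifP => [uv /eqP-> /eqP[]//|_ /andP[vu /eqP h] /andP[_ /eqP h']].
exact: corr_inj vu _ _ _ h h'.
Qed.

Lemma conflict_edge u v a b : conflict u v a b -> edge_corr C u v a = Some b.
Proof.
rewrite /conflict /edge_corr; case: ifP => [uv /eqP //|_ /andP[vu /eqP h]].
rewrite /pfun_inv; case: pickP => [c /eqP h'|/(_ b)]; last by rewrite h eqxx.
by rewrite (corr_inj vu h h').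
Qed.

Hypothesis hG : forall k : nat, 4 <= k <= 8 -> no_cycle_of_length G k.
Hypothesis hC : forall (v : G) (p : seq G),
  closed_walk v p -> size p = 3 -> consistent_on C v p.

Lemma corner_plane_map : plane_map (ce G) (cn M) (@corg G)
  (fun d => conflict (corg d) (corg (ce G d))).
Proof.
split.
- exact: ceK.
- exact: cdead.
- exact: corg_n.
- by move=> d d' _ _; apply: cnode.
- exact: corner_planar.
- move=> d; rewrite clive corg_e => a; apply: contraTneq a => ->.
  by rewrite adj_irrefl.
- move=> d d' _ _; rewrite !corg_e /corg; case: d d' => [[a b] h] [[a' b'] h'] /= E E'.
  by apply: val_inj; rewrite /= E E'.
- move=> p cp sp; apply: (hG sp (erefl (size p))).
  by move: cp; rewrite /ucycle (eq_cycle (@adjm_corner G)).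
- by move=> d a b _; rewrite ceK conflict_sym.
- by move=> d a b b' _; apply: conflict_inj.
- move=> d1 d2 d3 a b c a'; rewrite !clive -!corg_e => l1 l2 l3 E12 E23 E31 r1 r2 r3.
  apply/esym; have := @hC (corg d1) [:: corg d2; corg d3; corg d1]; apply => //.
    by split=> //=; rewrite -{1}E12 l1 -{1}E23 l2 -E31 l3.
  rewrite E12 in r1; rewrite E23 in r2; rewrite E31 in r3.
  by rewrite /= /pfun_comp (conflict_edge r1) /= (conflict_edge r2) /= (conflict_edge r3).
Qed.

End Conflicts.

(** Each component is colored with its own part of [S] precolored. By [face_walk_unique] that part
    is the vertex set of one facial walk, or it has at most one vertex. *)
Theorem theorem5 (G : sgraph) (M : plane_embedding G)
    (hG : forall n : nat, 4 <= n <= 8 -> no_cycle_of_length G n)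
    (S : {set G})
    (hS : #|S| <= 1 \/ exists a : face M, S = face_vertices a)
    (o : orientation G) (C : correspondence 3 o)
    (hC : forall (v : G) (p : seq G),
        closed_walk v p -> size p = 3 -> consistent_on C v p)
    (hS12 : #|S| <= 12)
    (f0 : G -> 'I_3) (hf0 : coloring_on C S f0) :
  exists f : G -> 'I_3, coloring C f /\ {in S, f =1 f0}.
Proof.
have ext := map_extendable (corner_plane_map M hG hC).
have sG : connect_sym (@adj G) by apply: sym_connect_sym; apply: adj_sym.
pose Sx (x : G) := [set v in S | connect (@adj G) x v].
have confl f : forall u v, o u v -> conflict C u v (f u) (f v) = (C u v (f u) == Some (f v)).
  by move=> u v uv; rewrite /conflict uv.
have exx x : exists f : G -> 'I_3, coloring C f /\ {in Sx x, f =1 f0}.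
  have okx : face_or_small (ce G) (cn M) (@corg G) (Sx x).
    case: hS => [S1|[a SE]].
      by left; apply: leq_trans S1; apply: subset_leq_card; apply/subsetP=> v; rewrite inE => /andP[].
    have [ex|nex] := boolP [exists d, [&& alive (ce G) d, connect (@adj G) x (corg d) &
        side M (val d) == a]].
      case/existsP: ex => d /and3P[ld cd /eqP sd_a]; right; exists d => //.
      apply/setP=> v; rewrite inE SE; apply/andP/imsetP.
        case; rewrite inE => /exists_inP[u uv /eqP su] xv.
        pose d' : corner G := exist _ (u, v) uv.
        exists ((ce G * cn M)%g d'); last by rewrite corg_f.
        rewrite porbit_step; apply: (face_walk_unique (d := d)); last by rewrite sd_a su.
        apply: (@connect_trans _ _ x); first by rewrite sG.
        by apply: connect_trans xv _; rewrite sG; exact: (connect_ends M d').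
      case=> d' dd' ->; have [sd' c] := sd_porbit dd'; split; last exact: connect_trans cd c.
      pose d'' := ((ce G * cn M)^-1)%g d'.
      have s'' : side M (val d'') = a by rewrite -sd_f permKV sd' sd_a.
      have <- : (val d'').2 = corg d' by rewrite -(corg_f M) permKV.
      rewrite inE; apply/exists_inP; exists (val d'').1; first exact: (valP d'').
      by rewrite -s''; case: (val d'').
    (* No edge of this component borders the face, so a vertex of [S] in it is isolated and hence
       equal to x. *)
    left; apply/card_le1_eqP.
    have iso v : v \in Sx x -> x = v.
      rewrite inE SE inE => /andP[/exists_inP[u uv /eqP su] xv].
      pose d : corner G := exist _ (u, v) uv.
      have cd : connect (@adj G) v (corg d).
        by rewrite sG; exact: (connect_ends M d).
      have := nex; move/existsPn/(_ d); rewrite (connect_trans xv cd) su eqxx !andbT clive /=.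
      have := uv; rewrite mem_ends adj_sym => + nuv; rewrite (negbTE nuv) /= => /andP[_ niso].
      move: xv; rewrite sG => /connectP[[|w p] /=]; first by move=> _ ->.
      by case/andP=> vw _ _; case/existsP: niso; exists w.
    by move=> u v /iso <- /iso <-.
  have cx : #|Sx x| <= 12.
    by apply: leq_trans hS12; apply: subset_leq_card; apply/subsetP=> v; rewrite inE => /andP[].
  have [|g pg gS] := ext (Sx x) f0 okx cx.
    move=> d ld; rewrite !inE => /andP[uS _] /andP[vS _]; rewrite /conflict.
    case: ifP => uv; first by apply/eqP; apply: hf0.
    by rewrite negb_and; case: (boolP (o _ _)) => // vu; apply/eqP; apply: hf0.
  exists g; split=> // u v _ _ uv.
  have a : adj u v by rewrite (arc_adj o) uv.
  have [d ld dE] := corner_ex a; have := pg d ld.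
  by rewrite corg_e /corg dE /= /conflict uv => /eqP.
have [F FP] := fin_all_exists exx.
(* Choosing the coloring by the root of the component makes adjacent vertices use the same one. *)
exists (fun u => F (fingraph.root (@adj G) u) u); split.
  move=> u v _ _ uv; have a : adj u v by rewrite (arc_adj o) uv.
  have /(fingraph.rootP sG) -> : connect (@adj G) u v by apply: connect1.
  by case: (FP (fingraph.root (@adj G) v)) => h _; apply: h; rewrite ?inE.
move=> u uS; case: (FP (fingraph.root (@adj G) u)) => _; apply.
by rewrite inE uS sG connect_root.
Qed.
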